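(* Let $X$ be a smooth complex projective variety of complex dimension $m$, with fixed ordered basis $\mathcal{B}$ of $H^*(X)$. The following isomorphisms of $\mathcal{S}_n$-modules hold (multiplicities $m_i\ge1$). a) Let $n\ge3$, $x_{h_1}\in\mathcal{B}$, $x_{h_2}\succ\dots\succ x_{h_t}$ distinct in $\mathcal{B}$ ($h_1$ may equal one of $h_2,\dots,h_t$) and $3+m_2+\dots+m_t=n$. Then $$E_2^*\big((3,1^{(n-3)}),(h_1,h_2^{(m_2)},\dots,h_t^{(m_t)})\big)\cong\mathrm{Ind}_{\mathcal{S}_3\times\mathcal{S}_{m_2}\times\dots\times\mathcal{S}_{m_t}}^{\mathcal{S}_n}\big(V(2,1)\otimes V^{\epsilon(m_2,h_2)}\otimes\dots\otimes V^{\epsilon(m_t,h_t)}\big).$$ b) Let $n\ge4$, $x_{h_1}\in\mathcal{B}$, $x_{h_2}\succ\dots\succ x_{h_t}$ distinct in $\mathcal{B}$ ($h_1$ may equal one of $h_2,\dots,h_t$) and $4+m_2+\dots+m_t=n$. Then $E_2^*\big((2^{(2)},1^{(n-4)}),(h_1^{(2)},h_2^{(m_2)},\dots,h_t^{(m_t)})\big)$ is isomorphic to $$\mathrm{Ind}_{\mathcal{S}_4\times\mathcal{S}_{m_2}\times\dots\times\mathcal{S}_{m_t}}^{\mathcal{S}_n}\big(V(3,1)\otimes V^{\epsilon(m_2,h_2)}\otimes\dots\otimes V^{\epsilon(m_t,h_t)}\big)\quad\text{if }|x_{h_1}|\text{ is even},$$ $$\mathrm{Ind}_{\mathcal{S}_4\times\mathcal{S}_{m_2}\times\dots\times\mathcal{S}_{m_t}}^{\mathcal{S}_n}\big((V(4)\oplus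 V(2,2))\otimes V^{\epsilon(m_2,h_2)}\otimes\dots\otimes V^{\epsilon(m_t,h_t)}\big)\quad\text{if }|x_{h_1}|\text{ is odd}.$$ c) Let $n\ge4$, $x_{h_1}\succ x_{h_2}$ in $\mathcal{B}$, $x_{h_3}\succ\dots\succ x_{h_t}$ in $\mathcal{B}$ ($h_1,h_2$ not necessarily different from $h_3,\dots,h_t$) and $4+m_3+\dots+m_t=n$. Then $$E_2^*\big((2^{(2)},1^{(n-4)}),(h_1,h_2,h_3^{(m_3)},\dots,h_t^{(m_t)})\big)\cong\mathrm{Ind}_{\mathcal{S}_2\times\mathcal{S}_2\times\mathcal{S}_{m_3}\times\dots\times\mathcal{S}_{m_t}}^{\mathcal{S}_n}\big(V(2)\otimes V(2)\otimes V^{\epsilon(m_3,h_3)}\otimes\dots\otimes V^{\epsilon(m_t,h_t)}\big)$$ $$\cong\mathrm{Ind}_{\mathcal{S}_4\times\mathcal{S}_{m_3}\times\dots\times\mathcal{S}_{m_t}}^{\mathcal{S}_n}\big((V(4)\oplus V(3,1)\oplus V(2,2))\otimes V^{\epsilon(m_3,h_3)}\otimes\dots\otimes V^{\epsilon(m_t,h_t)}\big).$$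
   Context: $X$ is connected of complex dimension $m\ge1$, $H^*(X)=H^*(X;\mathbb{Q})$, and $\mathcal{B}=\{x_1=1\prec\dots\prec x_B=w\}$ is a fixed homogeneous ordered basis of $H^*(X)$ with nondecreasing degrees, $w\in H^{2m}(X)$ the fundamental class; $|x_h|=\deg x_h$. $p_i^*:H^*(X)\to H^*(X^n)$ is the pullback along the $i$-th projection. As a bigraded algebra, the Kriz model $E(X,n)$ is the graded-commutative algebra obtained from the exterior algebra with generators $G_{ij}$ ($1\le i\neq j\le n$) of degree $2m-1$ and coefficients in $H^*(X)^{\otimes n}$, modulo $G_{ji}=G_{ij}$; $p_j^*(x)G_{ij}=p_i^*(x)G_{ij}$ ($i<j$, $x\in H^*(X)$); $G_{ik}G_{jk}=G_{ij}G_{jk}-G_{ij}G_{ik}$ ($i<j<k$). $E_q^k(X,n)$ is the part with $q$ exterior generators and total degree $k$. $\mathcal{S}_n$ acts by algebra automorphisms with $\sigma(p_i^*(x))=p_{\sigma(i)}^*(x)$, $\sigma(G_{ij})=G_{\sigma(i)\sigma(j)}$. The canonical basis of $E(X,n)$ consists of the monomials $p_1^*(x_{a_1})\cdots p_n^*(x_{a_n})G_{i_1j_1}\cdots G_{i_qj_q}$ with $x_{a_l}\in\mathcal{B}$, $i_l<j_l$, $j_1<\dots<j_q$, and $x_{a_l}=1$ for $l\in\{j_1,\dots,j_q\}$. The marked graph of such a monomial has vertices $1,\dots,n$ and edges $\{i_l,j_l\}$ (it is a forest); the mark of a component with smallest vertex $i$ is $x_{a_i}$. For $L_*=(\lambda_1\ge\dots\ge\lambda_s)$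 a partition of $n$ and marks $H_*=(g_1,\dots,g_s)$ (indices of elements of $\mathcal B$), $E_*^*(L_*,H_* )$ is the linear span of the canonical basis monomials whose marked graph has $s$ components which can be numbered so that the $i$-th has $\lambda_i$ vertices and mark $x_{g_i}$. It lies in exterior degree $q=\sum(\lambda_i-1)$ (here $q=2$) and total degree $q(2m-1)+\sum_i|x_{g_i}|$ (denoted by $*$ in the claim). The notation $a^{(r)}$ means $a$ repeated $r$ times. $V(\lambda)$ is the irreducible module of the symmetric group attached to the partition $\lambda$ ($V(r)$ trivial, $V(1,\dots,1)$ sign), and for $r\geq 1$, $V^{\epsilon(r,h)}$ is the $\mathcal{S}_r$-module $V(r)$ if $r=1$ or $|x_h|$ is even, and $V(1,1,\dots,1)$ if $r\ge2$ and $|x_h|$ is odd. The inducing subgroups are the standard Young subgroups of $\mathcal{S}_n$. *)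

(* Defs.v *)
From HB Require Import structures.
From mathcomp Require Import all_boot all_order all_fingroup all_algebra.
From mathcomp Require Import all_solvable all_field all_character.
From mathcomp Require Import boolp.

Set Implicit Arguments.
Unset Strict Implicit.
Unset Printing Implicit Defensive.

Import GRing.Theory.
Local Open Scope ring_scope.

(* The structure carried by H^*(X; Q) for X a connected smooth projective     *)
(* variety of complex dimension m: a finite-dimensional graded-commutative    *)
(* connected Q-algebra, concentrated in degrees 0..2m, with fundamental class *)
(* coh_fund and Poincare duality.                                             *)
Record cohomology_algebra (m : nat) := CohomologyAlgebra {
  coh_alg :> falgType rat;
  coh : nat -> {vspace coh_alg};
  coh_fund : coh_alg;
  coh_mul : forall i j : nat, (coh i * coh j <= coh (i + j)%N)%VS;
  coh_direct : directv (\sum_(k < (2 * m).+1) coh k)%VS;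
  coh_sum : (\sum_(k < (2 * m).+1) coh k)%VS = fullv;
  coh_high : forall k, (2 * m < k)%N -> coh k = 0%VS;
  coh_comm : forall i j (x y : coh_alg), x \in coh i -> y \in coh j ->
    x * y = (-1) ^+ (i * j) *: (y * x);
  coh_connected : coh 0 = <[1]>%VS;
  coh_fund_neq0 : coh_fund != 0;
  coh_top : coh (2 * m) = <[coh_fund]>%VS;
  coh_poincare : forall k (x : coh_alg), (k <= 2 * m)%N -> x \in coh k ->
    x != 0 -> exists2 y, y \in coh (2 * m - k) & x * y = coh_fund
}.

(* The basis x_1 = 1 < ... < x_B = w is indexed from 0, and its order is the  *)
(* order of the indices.                                                      *)
Record ordered_basis (m : nat) (X : cohomology_algebra m) (B : nat) :=
  OrderedBasis {
  ob_val :> 'I_B.+1 -> X;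
  ob_deg : 'I_B.+1 -> nat;
  ob_basis : basis_of fullv (codom ob_val);
  ob_homog : forall a, ob_val a \in coh X (ob_deg a);
  ob_mono : forall a b : 'I_B.+1, (a <= b)%N -> (ob_deg a <= ob_deg b)%N;
  ob_first : ob_val ord0 = 1;
  ob_last : ob_val ord_max = coh_fund X
}.

(* The Kriz model E(X, n), as the quotient of the algebra of formal           *)
(* polynomial expressions in the p_i^*(x) and G_ij by the congruence keq      *)
(* generated by the axioms of an associative unital Q-algebra and by the      *)
(* defining relations. The relations on the p_i^*(x) present H^*(X)^(⊗ n) as  *)
(* a graded-commutative algebra; the letters G_ii, which the model does not   *)
(* have, are set to 0. In characteristic 0, G_ij ^ 2 = 0 follows from keq_GG. *)
Section KrizModel.

Variables (m : nat) (X : cohomology_algebra m) (n : nat).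

Inductive kterm : Type :=
  | KConst of rat
  | KPull of 'I_n & X
  | KG of 'I_n & 'I_n
  | KAdd of kterm & kterm
  | KMul of kterm & kterm.

HB.instance Definition _ := gen_eqMixin kterm.
HB.instance Definition _ := gen_choiceMixin kterm.

Inductive keq : kterm -> kterm -> Prop :=
  | keq_refl t : keq t t
  | keq_sym t u : keq t u -> keq u t
  | keq_trans t u v : keq t u -> keq u v -> keq t v
  | keq_add t t' u u' : keq t t' -> keq u u' -> keq (KAdd t u) (KAdd t' u')
  | keq_mul t t' u u' : keq t t' -> keq u u' -> keq (KMul t u) (KMul t' u')
  (* c *: t is KMul (KConst c) t and - t is KMul (KConst (-1)) t *)
  | keq_addA t u v : keq (KAdd t (KAdd u v)) (KAdd (KAdd t u) v)
  | keq_addC t u : keq (KAdd t u) (KAdd u t)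
  | keq_add0 t : keq (KAdd (KConst 0) t) t
  | keq_addN t : keq (KAdd (KMul (KConst (-1)) t) t) (KConst 0)
  | keq_mulA t u v : keq (KMul t (KMul u v)) (KMul (KMul t u) v)
  | keq_mul1 t : keq (KMul (KConst 1) t) t
  | keq_mulDl t u v : keq (KMul (KAdd t u) v) (KAdd (KMul t v) (KMul u v))
  | keq_mulDr t u v : keq (KMul t (KAdd u v)) (KAdd (KMul t u) (KMul t v))
  | keq_constD b c : keq (KConst (b + c)) (KAdd (KConst b) (KConst c))
  | keq_constM b c : keq (KConst (b * c)) (KMul (KConst b) (KConst c))
  | keq_constC c t : keq (KMul (KConst c) t) (KMul t (KConst c))
  | keq_pullD i x y : keq (KPull i (x + y)) (KAdd (KPull i x) (KPull i y))
  | keq_pullZ i c x : keq (KPull i (c *: x)) (KMul (KConst c) (KPull i x))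
  | keq_pullM i x y : keq (KPull i (x * y)) (KMul (KPull i x) (KPull i y))
  | keq_pull1 i : keq (KPull i 1) (KConst 1)
  (* |p_i^*(x)| = |x| and |G_ij| = 2m - 1 is odd *)
  | keq_pullC i j k l x y : x \in coh X k -> y \in coh X l ->
      keq (KMul (KPull i x) (KPull j y))
          (KMul (KConst ((-1) ^+ (k * l))) (KMul (KPull j y) (KPull i x)))
  | keq_pullG l i j k x : x \in coh X k ->
      keq (KMul (KPull l x) (KG i j))
          (KMul (KConst ((-1) ^+ k)) (KMul (KG i j) (KPull l x)))
  | keq_GG i j k l :
      keq (KMul (KG i j) (KG k l))
          (KMul (KConst (-1)) (KMul (KG k l) (KG i j)))
  | keq_Gdiag i : keq (KG i i) (KConst 0)
  | keq_Gsym i j : keq (KG j i) (KG i j)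
  | keq_Gpull (i j : 'I_n) x : (i < j)%N ->
      keq (KMul (KPull j x) (KG i j)) (KMul (KPull i x) (KG i j))
  | keq_arnold (i j k : 'I_n) : (i < j)%N -> (j < k)%N ->
      keq (KMul (KG i k) (KG j k))
          (KAdd (KMul (KG i j) (KG j k))
                (KMul (KConst (-1)) (KMul (KG i j) (KG i k)))).

Definition keqb : rel kterm := fun t u => `[< keq t u >].

Lemma keqb_refl : reflexive keqb.
Proof. by move=> t; apply/asboolP/keq_refl. Qed.

Lemma keqb_sym : symmetric keqb.
Proof. by move=> t u; apply/asboolP/asboolP => /keq_sym. Qed.

Lemma keqb_trans : transitive keqb.
Proof.
by move=> u t v /asboolP tu /asboolP uv; apply/asboolP/(keq_trans tu uv).
Qed.

Canonical keqb_equiv := EquivRel keqb keqb_refl keqb_sym keqb_trans.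

Definition kriz := {eq_quot keqb}%qT.

HB.instance Definition _ := Choice.on kriz.
HB.instance Definition _ := EqQuotient.on kriz.

Definition kcl (t : kterm) : kriz := (\pi_kriz t)%qT.

Lemma kpiP t u : keq t u <-> kcl t = kcl u.
Proof.
by split=> [tu|/eqmodP/asboolP //]; apply/eqmodP/asboolP.
Qed.

Definition krep (a : kriz) : kterm := generic_quotient.repr a.

Lemma krepK a : kcl (krep a) = a.
Proof. exact: reprK. Qed.

Lemma krepr t : keq (krep (kcl t)) t.
Proof. by apply/kpiP; rewrite krepK. Qed.

Definition kconst (c : rat) : kriz := kcl (KConst c).
Definition kpull (i : 'I_n) (x : X) : kriz := kcl (KPull i x).
Definition kG (i j : 'I_n) : kriz := kcl (KG i j).
Definition kadd (a b : kriz) : kriz := kcl (KAdd (krep a) (krep b)).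
Definition kmul (a b : kriz) : kriz := kcl (KMul (krep a) (krep b)).

Lemma kaddE t u : kadd (kcl t) (kcl u) = kcl (KAdd t u).
Proof. by apply/kpiP/keq_add; apply: krepr. Qed.

Lemma kmulE t u : kmul (kcl t) (kcl u) = kcl (KMul t u).
Proof. by apply/kpiP/keq_mul; apply: krepr. Qed.

Lemma kind (P : kriz -> Prop) : (forall t, P (kcl t)) -> forall a, P a.
Proof. by move=> Ppi a; rewrite -[a]krepK. Qed.

Lemma kaddA : associative kadd.
Proof.
elim/kind=> t; elim/kind=> u; elim/kind=> v.
by rewrite !kaddE; apply/kpiP/keq_addA.
Qed.

Lemma kaddC : commutative kadd.
Proof.
by elim/kind=> t; elim/kind=> u; rewrite !kaddE; apply/kpiP/keq_addC.
Qed.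

Lemma kadd0 : left_id (kconst 0) kadd.
Proof. by elim/kind=> t; rewrite kaddE; apply/kpiP/keq_add0. Qed.

Lemma kaddN : left_inverse (kconst 0) (kmul (kconst (-1))) kadd.
Proof. by elim/kind=> t; rewrite kmulE kaddE; apply/kpiP/keq_addN. Qed.

HB.instance Definition _ := GRing.isZmodule.Build kriz kaddA kaddC kadd0 kaddN.

Lemma kmulA : associative kmul.
Proof.
elim/kind=> t; elim/kind=> u; elim/kind=> v.
by rewrite !kmulE; apply/kpiP/keq_mulA.
Qed.

Lemma kmul1 : left_id (kconst 1) kmul.
Proof. by elim/kind=> t; rewrite kmulE; apply/kpiP/keq_mul1. Qed.

Lemma kconstC c a : kmul (kconst c) a = kmul a (kconst c).
Proof. by elim/kind: a => t; rewrite !kmulE; apply/kpiP/keq_constC. Qed.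

Lemma kmul1r : right_id (kconst 1) kmul.
Proof. by move=> a; rewrite -kconstC kmul1. Qed.

Lemma kmulDl : left_distributive kmul kadd.
Proof.
elim/kind=> t; elim/kind=> u; elim/kind=> v.
by rewrite !(kaddE, kmulE); apply/kpiP/keq_mulDl.
Qed.

Lemma kmulDr : right_distributive kmul kadd.
Proof.
elim/kind=> t; elim/kind=> u; elim/kind=> v.
by rewrite !(kaddE, kmulE); apply/kpiP/keq_mulDr.
Qed.

HB.instance Definition _ :=
  GRing.Zmodule_isPzRing.Build kriz kmulA kmul1 kmul1r kmulDl kmulDr.

Definition kscale (c : rat) (a : kriz) : kriz := kconst c * a.

Lemma kconstD b c : kconst (b + c) = kconst b + kconst c.
Proof. by rewrite [RHS]kaddE; apply/kpiP/keq_constD. Qed.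

Lemma kconstM b c : kconst (b * c) = kconst b * kconst c.
Proof. by rewrite [RHS]kmulE; apply/kpiP/keq_constM. Qed.

Lemma kscaleA b c a : kscale b (kscale c a) = kscale (b * c) a.
Proof. by rewrite /kscale mulrA kconstM. Qed.

Lemma kscale1 : left_id 1 kscale.
Proof. exact: kmul1. Qed.

Lemma kscaleDr : right_distributive kscale +%R.
Proof. by move=> c a b; rewrite /kscale mulrDr. Qed.

Lemma kscaleDl a : {morph kscale^~ a : b c / b + c}.
Proof. by move=> b c; rewrite /kscale kconstD mulrDl. Qed.

HB.instance Definition _ :=
  GRing.Zmodule_isLmodule.Build rat kriz kscaleA kscale1 kscaleDr kscaleDl.

Lemma kscaleAl (c : rat) (a b : kriz) : c *: (a * b) = (c *: a) * b.
Proof. exact: mulrA. Qed.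

Lemma kscaleAr (c : rat) (a b : kriz) : c *: (a * b) = a * (c *: b).
Proof.
have scaleE d (e : kriz) : d *: e = kconst d * e by [].
by rewrite !scaleE !mulrA; congr (_ * _); apply: kconstC.
Qed.

Lemma kpiD t u : kcl (KAdd t u) = kcl t + kcl u.
Proof. by rewrite [RHS]kaddE. Qed.

Lemma kpiM t u : kcl (KMul t u) = kcl t * kcl u.
Proof. by rewrite [RHS]kmulE. Qed.

Lemma kpiZ c t : kcl (KMul (KConst c) t) = c *: kcl t.
Proof. by rewrite kpiM. Qed.

Lemma kpi0 : kcl (KConst 0) = 0. Proof. by []. Qed.


Lemma kclZ c t : kcl (KMul (KConst c) t) = c *: kcl t.
Proof. by rewrite kpiM. Qed.

Lemma kpullD i x y : kpull i (x + y) = kpull i x + kpull i y.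
Proof. by rewrite -kpiD; apply/kpiP/keq_pullD. Qed.

Lemma kpullZ i c x : kpull i (c *: x) = c *: kpull i x.
Proof. by rewrite -kclZ; apply/kpiP/keq_pullZ. Qed.

Lemma kpullM i x y : kpull i (x * y) = kpull i x * kpull i y.
Proof. by rewrite -kpiM; apply/kpiP/keq_pullM. Qed.

Lemma kpull1 i : kpull i 1 = 1.
Proof. exact/kpiP/keq_pull1. Qed.

Lemma kpullC i j k l x y : x \in coh X k -> y \in coh X l ->
  kpull i x * kpull j y = (-1) ^+ (k * l) *: (kpull j y * kpull i x).
Proof. by move=> xk yl; rewrite -!kpiM -kclZ; apply/kpiP/keq_pullC. Qed.

Lemma kpullG l i j k x : x \in coh X k ->
  kpull l x * kG i j = (-1) ^+ k *: (kG i j * kpull l x).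
Proof. by move=> xk; rewrite -!kpiM -kclZ; apply/kpiP/keq_pullG. Qed.

Lemma kGC i j k l : kG i j * kG k l = - (kG k l * kG i j).
Proof. by rewrite -scaleN1r -!kpiM -kclZ; apply/kpiP/keq_GG. Qed.

Lemma kGdiag i : kG i i = 0.
Proof. exact/kpiP/keq_Gdiag. Qed.

Lemma kGsym i j : kG i j = kG j i.
Proof. exact/kpiP/keq_Gsym. Qed.

Lemma kGpull i j x : kpull j x * kG i j = kpull i x * kG i j.
Proof.
have lt_case (k l : 'I_n) :
  (k < l)%N -> kpull l x * kG k l = kpull k x * kG k l.
  by move=> ltkl; rewrite -!kpiM; apply/kpiP/keq_Gpull.
case: (ltngtP i j) => [/lt_case //|/lt_case|/val_inj-> //].
by rewrite [kG j i]kGsym.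
Qed.

Lemma karnold_lt (i j k : 'I_n) : (i < j)%N -> (j < k)%N ->
  kG i k * kG j k = kG i j * kG j k - kG i j * kG i k.
Proof.
move=> ltij ltjk; rewrite -scaleN1r -!kpiM -kclZ -kpiD.
exact/kpiP/keq_arnold.
Qed.

Lemma kGcyc_lt (i j k : 'I_n) : (i < j)%N -> (j < k)%N ->
  kG i j * kG j k + kG j k * kG k i + kG k i * kG i j = 0.
Proof.
move=> ltij ltjk; rewrite (kGC j k k i) (kGC k i i j) [kG k i]kGsym.
by rewrite karnold_lt // opprB addrA addrC !addrA addNr add0r subrr.
Qed.

Lemma kGG0 i j : kG i j * kG i j = 0.
Proof.
have: 2%:R *: (kG i j * kG i j) = 0.
  by rewrite scaler_nat mulr2n {1}kGC addNr.
move/(congr1 (fun a => (2%:R^-1 : rat) *: a)).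
by rewrite scalerA mulVf // scale1r scaler0.
Qed.

Lemma kGcyc i j k :
  i != j -> j != k -> i != k ->
  kG i j * kG j k + kG j k * kG k i + kG k i * kG i j = 0.
Proof.
pose C u v w := kG u v * kG v w + kG v w * kG w u + kG w u * kG u v.
have rot u v w : C u v w = 0 -> C v w u = 0.
  by rewrite /C => <-; rewrite addrC addrA.
have flip u v w : C u v w = 0 -> C w v u = 0.
  rewrite /C => e; rewrite -[LHS]opprK -[RHS]oppr0 -[in RHS]e; congr (- _).
  rewrite (kGsym w v) (kGsym v u) (kGsym u w) !opprD.
  by rewrite -(kGC u v) -(kGC w u) -(kGC v w) addrAC.
rewrite -/(C i j k) => ij jk ik.
have [lij|lij|/val_inj eij] := ltngtP i j; last by rewrite eij eqxx in ij.
  have [ljk|ljk|/val_inj e] := ltngtP j k; last by rewrite e eqxx in jk.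
    exact: kGcyc_lt.
  have [lik|lik|/val_inj e] := ltngtP i k; last by rewrite e eqxx in ik.
    exact: (rot _ _ _ (rot _ _ _ (flip _ _ _ (kGcyc_lt _ _)))).
  exact: (rot _ _ _ (kGcyc_lt _ _)).
have [ljk|ljk|/val_inj e] := ltngtP j k; last by rewrite e eqxx in jk.
  have [lik|lik|/val_inj e] := ltngtP i k; last by rewrite e eqxx in ik.
    exact: (flip _ _ _ (rot _ _ _ (rot _ _ _ (kGcyc_lt _ _)))).
  exact: (rot _ _ _ (rot _ _ _ (kGcyc_lt _ _))).
exact: (flip _ _ _ (kGcyc_lt _ _)).
Qed.

Lemma karnold i j k : i != j -> j != k -> i != k ->
  kG i k * kG j k = kG i j * kG j k - kG i j * kG i k.
Proof.
move=> ij jk ik; apply/esym/eqP; rewrite -subr_eq0; apply/eqP.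
rewrite -[RHS](kGcyc ij jk ik) (kGC j k k i) (kGC k i i j) [kG k i]kGsym.
by rewrite addrAC.
Qed.

(* The action of S_n: kren renames the letters, p_i^*(x) |-> p_(s i)^*(x) and *)
(* G_ij |-> G_(s i)(s j). Since (s * t) i = t (s i) for MathComp permutations,*)
(* kact (s * t) = kact t \o kact s.                                           *)
Fixpoint kren (s : 'S_n) (t : kterm) : kterm :=
  match t with
  | KConst c => KConst c
  | KPull i x => KPull (s i) x
  | KG i j => KG (s i) (s j)
  | KAdd t u => KAdd (kren s t) (kren s u)
  | KMul t u => KMul (kren s t) (kren s u)
  end.

Definition kact (s : 'S_n) (a : kriz) : kriz := kcl (kren s (krep a)).

Lemma kren_keq s t u : keq t u -> kcl (kren s t) = kcl (kren s u).
Proof.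
elim=> {t u} /=; try by move=> *; apply/kpiP; constructor.
- by move=> t u _ ->.
- by move=> t u v _ -> _ ->.
- by move=> t t' u u' _ et _ eu; rewrite !kpiD et eu.
- by move=> t t' u u' _ et _ eu; rewrite !kpiM et eu.
- by move=> i j x _; rewrite !kpiM; apply: kGpull.
- move=> i j k ltij ltjk; rewrite kpiD kclZ scaleN1r !kpiM.
  apply: karnold; rewrite (inj_eq perm_inj); apply/eqP => e.
  + by rewrite e ltnn in ltij.
  + by rewrite e ltnn in ltjk.
  + by have := ltn_trans ltij ltjk; rewrite e ltnn.
Qed.

Lemma kactE s t : kact s (kcl t) = kcl (kren s t).
Proof. exact/kren_keq/krepr. Qed.

Lemma kactD s : {morph kact s : a b / a + b}.
Proof.
by elim/kind=> t; elim/kind=> u; rewrite -kpiD !kactE -kpiD.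
Qed.

Lemma kactM s : {morph kact s : a b / a * b}.
Proof.
by elim/kind=> t; elim/kind=> u; rewrite -kpiM !kactE -kpiM.
Qed.

Lemma kactZ s c : {morph kact s : a / c *: a}.
Proof. by elim/kind=> t; rewrite -kclZ !kactE -kclZ. Qed.

Lemma kact_1 s : kact s 1 = 1.
Proof. exact: kactE. Qed.

Lemma kact_pull s i x : kact s (kpull i x) = kpull (s i) x.
Proof. exact: kactE. Qed.

Lemma kact_G s i j : kact s (kG i j) = kG (s i) (s j).
Proof. exact: kactE. Qed.

Lemma kactMperm s t a : kact (s * t)%g a = kact t (kact s a).
Proof.
elim/kind: a => u; rewrite !kactE; congr kcl.
by elim: u => //= [i x|i j|u -> v ->|u -> v ->] //; rewrite !permM.
Qed.

Lemma kact_id a : kact 1%g a = a.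
Proof.
elim/kind: a => u; rewrite kactE; congr kcl.
by elim: u => //= [i x|i j|u -> v ->|u -> v ->] //; rewrite !perm1.
Qed.

End KrizModel.

Arguments kact {m X n} s a.

Section CanonicalBasis.

Variables (m : nat) (X : cohomology_algebra m) (n : nat).
Variables (B : nat) (x : ordered_basis X B).

(* A monomial is given by the indices a_1, ..., a_n of the basis elements and *)
(* by the list of the pairs (i_l, j_l).                                       *)
Definition kmonomial (a : 'I_n -> 'I_B.+1) (es : seq ('I_n * 'I_n)) :
    kriz X n :=
  (\prod_(l < n) kpull l (x (a l))) * \prod_(e <- es) kG X e.1 e.2.

Definition canonical (a : 'I_n -> 'I_B.+1) (es : seq ('I_n * 'I_n)) : bool :=
  [&& all (fun e : 'I_n * 'I_n => e.1 < e.2)%N es,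
      sorted ltn [seq val e.2 | e : 'I_n * 'I_n <- es]
    & all (fun e : 'I_n * 'I_n => a e.2 == ord0) es].

Definition same_component (es : seq ('I_n * 'I_n)) : rel 'I_n :=
  connect [rel u v | ((u, v) \in es) || ((v, u) \in es)].

Definition smallest_vertex (es : seq ('I_n * 'I_n)) (v : 'I_n) : Prop :=
  forall u, same_component es v u -> (v <= u)%N.

(* The components of the marked graph can be numbered, by c, in such a way    *)
(* that the i-th one has L_i vertices and mark x_(g_i).                       *)
Definition has_marked_type (L : seq nat) (g : seq 'I_B.+1)
    (a : 'I_n -> 'I_B.+1) (es : seq ('I_n * 'I_n)) : Prop :=
  size g = size L /\
  exists c : 'I_n -> 'I_(size L),
    [/\ forall u v, (c u == c v) = same_component es u v,
        forall i, #|[set u | c u == i]| = nth 0%N L i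
      & forall v, smallest_vertex es v -> a v = nth ord0 g (c v)].

(* E_*^*(L, g), the linear span of the canonical monomials of type (L, g).    *)
Definition kblock (L : seq nat) (g : seq 'I_B.+1) (b : kriz X n) : Prop :=
  exists (N : nat) (lam : 'I_N -> rat)
         (a : 'I_N -> 'I_n -> 'I_B.+1) (es : 'I_N -> seq ('I_n * 'I_n)),
    (forall k, canonical (a k) (es k) /\ has_marked_type L g (a k) (es k)) /\
    b = \sum_(k < N) lam k *: kmonomial (a k) (es k).

End CanonicalBasis.

(* MathComp representations act on row vectors from the right; as the product *)
(* s * t of permutations is "s, then t", they are the left modules over S_n   *)
(* for the usual composition of permutations.                                 *)
Notation Srep r := (representation rat [set: 'S_r]).

(* The S_n-stable subspace S of E(X, n) is isomorphic to the S_n-module rho.  *)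
Definition iso_block (m : nat) (X : cohomology_algebra m) (n : nat)
    (S : kriz X n -> Prop) (rho : Srep n) : Prop :=
  exists phi : {linear 'rV[rat]_(rdegree rho) -> kriz X n},
    [/\ injective phi,
        forall b, S b <-> exists v, b = phi v
      & forall (s : 'S_n) v, phi (v *m rho s) = kact s (phi v)].

(* V(la) for la a partition of r: the right ideal of Q[S_r] generated by the  *)
(* Young symmetrizer of the tableau whose rows are filled with 0, ..., r - 1  *)
(* in order; (reshape_index la i, reshape_offset la i) is the cell of i.      *)
Section Specht.

Variables (r : nat) (la : seq nat).

Definition row_stab : {set 'S_r} :=
  [set s : 'S_r | [forall i, reshape_index la (s i) == reshape_index la i]].

Definition col_stab : {set 'S_r} :=
  [set s : 'S_r | [forall i, reshape_offset la (s i) == reshape_offset la i]].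

Definition young_symmetrizer : 'rV[rat]_(gcard [set: 'S_r]) :=
  \sum_(p in row_stab) \sum_(q in col_stab)
    (-1) ^+ q *: delta_mx 0 (gring_index [set: 'S_r] (q * p)%g).

Definition specht : Srep r :=
  Representation (submod_repr (cyclic_mx_module
    (regular_repr rat [set: 'S_r]) young_symmetrizer)).

End Specht.

(* Q[G] ⊗_(Q[H]) W, for W a representation of H and iota : H -> G: the        *)
(* quotient of W ⊗ Q[G] by the relations w h ⊗ y = w ⊗ (iota h) y.            *)
Section Induction.

Variables (gT hT : finGroupType) (iota : hT -> gT).
Variable W : representation rat [set: hT].

Let nG := gcard [set: gT].

Definition lregular_mx (y : gT) : 'M[rat]_nG :=
  \matrix_i delta_mx 0 (gring_index [set: gT] (y * enum_val i)%g).

Definition tensor_mx (y : gT) : 'M[rat]_(rdegree W * nG) :=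
  tprod (1%:M : 'M[rat]_(rdegree W)) (regular_repr rat [set: gT] y).

Lemma tensor_mx_repr : mx_repr [set: gT] tensor_mx.
Proof.
rewrite /tensor_mx; split=> [|y z yG zG]; first by rewrite repr_mx1 tprod1.
by rewrite -tprodE mul1mx repr_mxM.
Qed.

Definition tensor_repr := MxRepresentation tensor_mx_repr.

Definition ind_relations : 'M[rat]_(rdegree W * nG) :=
  (\sum_(h : hT) (tprod (W h) (1%:M : 'M_nG)
                  - tprod (1%:M : 'M_(rdegree W)) (lregular_mx (iota h))))%MS.

Lemma lregular_mxC y z :
  lregular_mx y *m regular_mx rat [set: gT] z =
  regular_mx rat [set: gT] z *m lregular_mx y.
Proof.
apply/row_matrixP=> i; rewrite !row_mul !rowK -!rowE !rowK.
by rewrite !gring_indexK ?inE // mulgA.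
Qed.

Lemma ind_relations_module : mxmodule tensor_repr ind_relations.
Proof.
apply: sumsmx_module => h _; apply/mxmoduleP => y _ /=.
suff -> (A D : 'M_(rdegree W * nG)) :
    A *m tensor_mx y = tensor_mx y *m A ->
    D *m tensor_mx y = tensor_mx y *m D ->
    (A - D) *m tensor_mx y = tensor_mx y *m (A - D).
- exact: submxMl.
- by rewrite /tensor_mx -!tprodE !mulmx1 !mul1mx.
- by rewrite /tensor_mx -!tprodE lregular_mxC.
- by move=> AT DT; rewrite mulmxBl mulmxBr AT DT.
Qed.

Definition induced : representation rat [set: gT] :=
  Representation (factmod_repr ind_relations_module).

End Induction.

Section ExternalTensor.

Variables (gT hT : finGroupType).
Variables (V : representation rat [set: gT]) (W : representation rat [set: hT]).

Definition xtensor_mx (g : gT * hT) : 'M[rat]_(rdegree V * rdegree W) :=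
  tprod (V g.1) (W g.2).

Lemma xtensor_mx_repr : mx_repr [set: gT * hT] xtensor_mx.
Proof.
split=> [|g h _ _]; rewrite /xtensor_mx.
  by rewrite !repr_mx1 tprod1.
by rewrite -tprodE !repr_mxM ?inE.
Qed.

Definition xtensor : representation rat [set: gT * hT] :=
  Representation (MxRepresentation xtensor_mx_repr).

End ExternalTensor.

(* For a list of modules V_1, ..., V_t over S_(k_1), ..., S_(k_t), the Young  *)
(* group S_(k_1) x ... x S_(k_t), its module V_1 ⊗ ... ⊗ V_t, and its         *)
(* embedding in S_n for n = k_1 + ... + k_t, where S_(k_1) acts on the first  *)
(* k_1 points, S_(k_2) on the next k_2 points, and so on (young_embedE).      *)
Record sym_module := SymModule { sm_arity : nat; sm_rep : Srep sm_arity }.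

Fixpoint young_group (Vs : seq sym_module) : finGroupType :=
  if Vs is V :: Vs' then ('S_(sm_arity V) * young_group Vs')%type else 'S_0.

Lemma triv_mx_repr : mx_repr [set: 'S_0] (fun _ => 1%:M : 'M[rat]_1).
Proof. by split=> // g h _ _; rewrite mulmx1. Qed.

Fixpoint young_tensor (Vs : seq sym_module) :
    representation rat [set: young_group Vs] :=
  if Vs is V :: Vs' then xtensor (sm_rep V) (young_tensor Vs')
  else Representation (MxRepresentation triv_mx_repr).

Fixpoint young_fun (Vs : seq sym_module) : young_group Vs -> nat -> nat :=
  if Vs is V :: Vs' then fun g i =>
    if insub i is Some j then val (g.1 j)
    else (sm_arity V + young_fun g.2 (i - sm_arity V))%N
  else fun _ i => i.

Definition young_size (Vs : seq sym_module) : nat :=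
  sumn [seq sm_arity V | V <- Vs].

(* insubd only plays a role when n is not young_size Vs. *)
Definition young_embed (Vs : seq sym_module) (n : nat) (g : young_group Vs) :
    'S_n :=
  insubd (1%g : 'S_n) [ffun i : 'I_n => insubd i (young_fun g i)].

Lemma young_fun_lt Vs (g : young_group Vs) i :
  (i < young_size Vs)%N -> (young_fun g i < young_size Vs)%N.
Proof.
rewrite /young_size; elim: Vs g i => [|V Vs IH] //= g i lti.
case: insubP => [j _ _|]; first by apply: ltn_addr; apply: ltn_ord.
by rewrite -leqNgt ltn_add2l => leVi; rewrite IH // ltn_subLR.
Qed.

Lemma young_funM Vs (g h : young_group Vs) i :
  young_fun (g * h)%g i = young_fun h (young_fun g i).
Proof.
elim: Vs g h i => [|V Vs IH] //= g h i.
case: (@insubP nat _ 'I_(sm_arity V) i) => [j ltj _|ltj].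
  by rewrite valK permM.
by rewrite insubN ?ltnNge ?leq_addr // addKn IH.
Qed.

Lemma young_fun1 Vs i : young_fun (1%g : young_group Vs) i = i.
Proof.
elim: Vs i => [|V Vs IH] //= i.
case: insubP => [j _ <-|]; first by rewrite perm1.
by rewrite -leqNgt IH => /subnKC.
Qed.

Lemma young_embedE Vs n (g : young_group Vs) (i : 'I_n) :
  young_size Vs = n -> young_embed n g i = young_fun g i :> nat.
Proof.
move=> sz; rewrite -{n}sz in i *.
have fE (j : 'I_(young_size Vs)) : val (insubd j (young_fun g j)) = young_fun g j.
  by rewrite insubdK // -topredE /= young_fun_lt.
rewrite /young_embed /insubd insubT /=.
  apply/injectiveP=> j k; rewrite !ffunE => /(congr1 val); rewrite !fE => e.
  apply: val_inj; rewrite -[LHS](@young_fun1 Vs) -[RHS](@young_fun1 Vs).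
  by rewrite -(mulgV g) !young_funM e.
by move=> inj_f; rewrite -pvalE /= ffunE fE.
Qed.

Lemma young_embedM Vs n (g h : young_group Vs) : young_size Vs = n ->
  young_embed n (g * h)%g = (young_embed n g * young_embed n h)%g.
Proof.
move=> sz; apply/permP=> i; apply: val_inj.
rewrite permM; change (young_embed n (g * h) i = young_embed n h (young_embed n g i) :> nat).
by rewrite !young_embedE // young_funM.
Qed.

(* Ind_(S_(k_1) x ... x S_(k_t))^(S_n) (V_1 ⊗ ... ⊗ V_t) *)
Definition young_ind (n : nat) (Vs : seq sym_module) : Srep n :=
  induced (@young_embed Vs n) (young_tensor Vs).

Definition Veps (d r : nat) : sym_module :=
  SymModule (specht r (if (r == 1)%N || ~~ odd d then [:: r] else nseq r 1%N)).

(* A list of pairs (h_i, m_i), with the h_i strictly decreasing and m_i >= 1, *)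
(* its list of marks h_i^(m_i) and its modules V^(epsilon(m_i, h_i)).         *)
Definition mult_list (B : nat) (hs : seq ('I_B * nat)) : bool :=
  sorted (fun p q : 'I_B * nat => q.1 < p.1)%N hs &&
  all (fun p : 'I_B * nat => 0 < p.2)%N hs.

Definition marks_of (B : nat) (hs : seq ('I_B * nat)) : seq 'I_B :=
  flatten [seq nseq p.2 p.1 | p <- hs].

Definition eps_modules (m : nat) (X : cohomology_algebra m) (B : nat)
    (x : ordered_basis X B) (hs : seq ('I_B.+1 * nat)) : seq sym_module :=
  [seq Veps (ob_deg x p.1) p.2 | p <- hs].

(* Main.v *)
(* Each of the subspaces is the span of the S_n-orbit of one monomial mu, with
   edges {1,2}, {1,3} resp. {1,2}, {3,4} and equal marks in consecutive blocks:
   S_n permutes the canonical monomials up to sign, except that trees on three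
   vertices also need an Arnold relation. The factors of the Young subgroup that
   permute equal marks x_h act on mu by sign^|x_h|, and the translates of mu
   under S_3 (S_4, or S_2 x S_2) span the first factor U of the inducing module;
   hence an equivariant map from the induced module onto the span.

   Its injectivity needs linear independence in E(X, n). This is detected by a
   linear form D with D(g mu) = 0 for g outside the Young subgroup. To define D,
   collapse the points of each component of the marked graph of mu and evaluate
   E(X, n) in a graded tensor power of the algebra of operators on
   H^*(X) ⊗ Λ(α), α odd: G_ij goes to multiplication by α in the slot max(i, j)
   if i and j are collapsed, and to 0 otherwise (all products in the Arnold
   relation vanish, except that it reads αjαk = αjαk when i < j < k are all
   collapsed, because αk² = 0); then read off a matrix entry. What remains is a
   finite computation in S_3 or S_4 with V(2,1), V(3,1), V(2,2) realised as
   functions on the symmetric group. *)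

From HB Require Import structures.
Require Import Defs.
From mathcomp Require Import all_boot all_fingroup all_algebra all_character.
From mathcomp Require Import all_field zify ring lra.

Set Implicit Arguments.
Unset Strict Implicit.
Unset Printing Implicit Defensive.
Import GRing.Theory.
Local Open Scope ring_scope.

(** * Kronecker products *)

(** The model is a quotient by the congruence [keq] with no normal form at hand, so nothing in it is
    known to be nonzero before it is mapped elsewhere; all independence below comes from one linear
    form per block. This form is far from injective on the block: it vanishes on the translates of
    mu outside the Young subgroup H, and it takes the same value on the two canonical trees on three
    vertices. Translation makes up for this. An element of the induced module has components indexed
    by the cosets of H; a translation carries any chosen coset onto H, the form then isolates its
    component, and the further translates by H separate the points of the inducing module.
    Independence in the whole block is thus reduced to the inducing module, where it is a small
    linear system over Q.

    The second isomorphism of c) is not obtained by comparing the two induced modules. Both are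
    realised on the same block, once with S_2 x S_2 and once with S_4 as first part of the inducing
    group, and two modules isomorphic to one block are similar. *)

Section Kronecker.

Variable F : fieldType.

Lemma tprodPl m1 n1 m2 n2 c (A1 A2 : 'M[F]_(m1, n1)) (C : 'M[F]_(m2, n2)) :
  tprod (c *: A1 + A2) C = c *: tprod A1 C + tprod A2 C.
Proof.
elim: m1 A1 A2 => [|m1 IH] /= A1 A2; first by rewrite scaler0 addr0.
by rewrite !linearP /= IH -!trowbE linearP /= scale_col_mx add_col_mx.
Qed.

Lemma tprodPr m1 n1 m2 n2 c (A : 'M[F]_(m1, n1)) (C1 C2 : 'M[F]_(m2, n2)) :
  tprod A (c *: C1 + C2) = c *: tprod A C1 + tprod A C2.
Proof.
elim: m1 A => [|m1 IH] /= A; first by rewrite scaler0 addr0.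
by rewrite linearP /= IH scale_col_mx add_col_mx.
Qed.

Lemma tprod0l m1 n1 m2 n2 (C : 'M[F]_(m2, n2)) : tprod (0 : 'M_(m1, n1)) C = 0.
Proof. by have := tprodPl (-1) 0 (0 : 'M_(m1, n1)) C; rewrite scaler0 addr0 scaleN1r addNr. Qed.

Lemma tprod0r m1 n1 m2 n2 (A : 'M[F]_(m1, n1)) : tprod A (0 : 'M_(m2, n2)) = 0.
Proof. by have := tprodPr (-1) A 0 (0 : 'M_(m2, n2)); rewrite scaler0 addr0 scaleN1r addNr. Qed.

Lemma tprodDl m1 n1 m2 n2 (A1 A2 : 'M[F]_(m1, n1)) (C : 'M[F]_(m2, n2)) :
  tprod (A1 + A2) C = tprod A1 C + tprod A2 C.
Proof. by rewrite -[A1]scale1r tprodPl !scale1r. Qed.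

Lemma tprodDr m1 n1 m2 n2 (A : 'M[F]_(m1, n1)) (C1 C2 : 'M[F]_(m2, n2)) :
  tprod A (C1 + C2) = tprod A C1 + tprod A C2.
Proof. by rewrite -[C1]scale1r tprodPr !scale1r. Qed.

Lemma tprodZl m1 n1 m2 n2 c (A : 'M[F]_(m1, n1)) (C : 'M[F]_(m2, n2)) :
  tprod (c *: A) C = c *: tprod A C.
Proof. by rewrite -[c *: A]addr0 tprodPl tprod0l addr0. Qed.

Lemma tprodZr m1 n1 m2 n2 c (A : 'M[F]_(m1, n1)) (C : 'M[F]_(m2, n2)) :
  tprod A (c *: C) = c *: tprod A C.
Proof. by rewrite -[c *: C]addr0 tprodPr tprod0r addr0. Qed.

Lemma tprod_suml m1 n1 m2 n2 I (r : seq I) (P : pred I)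
    (A : I -> 'M[F]_(m1, n1)) (C : 'M[F]_(m2, n2)) :
  tprod (\sum_(i <- r | P i) A i) C = \sum_(i <- r | P i) tprod (A i) C.
Proof.
apply: (big_morph (fun A => tprod A C)) => [A1 A2|].
  exact: tprodDl.
exact: tprod0l.
Qed.

Lemma tprod_sumr m1 n1 m2 n2 I (r : seq I) (P : pred I)
    (A : 'M[F]_(m1, n1)) (C : I -> 'M[F]_(m2, n2)) :
  tprod A (\sum_(i <- r | P i) C i) = \sum_(i <- r | P i) tprod A (C i).
Proof.
apply: (big_morph (fun C => tprod A C)) => [C1 C2|].
  exact: tprodDr.
exact: tprod0r.
Qed.

Definition cdelta n (i : 'I_n) : 'cV[F]_n := delta_mx i 0.
Definition rdelta n (i : 'I_n) : 'rV[F]_n := delta_mx 0 i.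

Lemma mx1_sum_delta n : \sum_i cdelta i *m rdelta i = 1%:M :> 'M[F]_n.
Proof.
rewrite mx1_sum_delta; apply: eq_bigr => i _.
by rewrite /cdelta /rdelta mul_delta_mx.
Qed.

Lemma col_sum_delta n (c : 'cV[F]_n) : c = \sum_i c i 0 *: cdelta i.
Proof.
by rewrite [LHS]matrix_sum_delta; apply: eq_bigr => i _; rewrite big_ord1.
Qed.

Lemma rdeltaE n (v : 'rV[F]_n) i : (v *m cdelta i) 0 0 = v 0 i.
Proof.
rewrite mxE (bigD1 i) //= big1 ?addr0 => [|j ne_ji]; rewrite !mxE ?eqxx ?mulr1 //.
by rewrite (negPf ne_ji) mulr0.
Qed.

Lemma mulmx_colrow n (v : 'rV[F]_n) (c : 'cV[F]_n) p (r : 'M[F]_(1, p)) :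
  v *m (c *m r) = (v *m c) 0 0 *: r.
Proof. by rewrite mulmxA [v *m c]mx11_scalar mul_scalar_mx !mxE mulr1n. Qed.

(** Contraction of the second tensor factor with the form [c]: an element v of Q^d ⊗ Q^n goes to (1
    ⊗ c)(v). For a coordinate form of the group algebra it extracts the component w_y of a sum of
    w_y ⊗ y. *)
Definition slice d n (c : 'cV[F]_n) (v : 'rV[F]_(d * n)) : 'rV[F]_d :=
  \row_i (v *m tprod (cdelta i) c) 0 0.

Lemma slice_is_linear d n (c : 'cV[F]_n) : linear (@slice d n c).
Proof.
move=> k u v; apply/rowP=> i.
by rewrite [LHS]mxE mulmxDl -scalemxAl !mxE; congr (_ * _ + _); rewrite mxE.
Qed.

Lemma sliceE d n (c : 'cV[F]_n) (v : 'rV[F]_(d * n)) (e : 'cV[F]_d) :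
  (v *m tprod e c) 0 0 = (slice c v *m e) 0 0.
Proof.
rewrite {1}[e]col_sum_delta tprod_suml mulmx_sumr summxE [RHS]mxE.
by apply: eq_bigr => i _; rewrite tprodZl -scalemxAr !mxE mulrC.
Qed.

Lemma slice_tprod d e n p (c : 'cV[F]_p) (v : 'rV[F]_(d * n))
    (A : 'M_(d, e)) (C : 'M_(n, p)) :
  slice c (v *m tprod A C) = slice (C *m c) v *m A.
Proof.
apply/rowP=> i; rewrite mxE -mulmxA -tprodE sliceE mulmxA.
by rewrite rdeltaE.
Qed.

Lemma slice_row d n (w : 'rV[F]_d) (u : 'rV[F]_n) (c : 'cV[F]_n) :
  slice c (tprod w u : 'rV_(d * n)) = (u *m c) 0 0 *: w.
Proof.
apply/rowP=> i; rewrite [LHS]mxE [RHS]mxE. rewrite -[_ *m _](tprodE w _ u).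
rewrite [w *m _]mx11_scalar [u *m c]mx11_scalar rdeltaE.
rewrite -[(w 0 i)%:M]scalemx1 -[(_ 0 0)%:M]scalemx1 tprodZl tprodZr tprod1 !mxE /= mulr1 mulrC.
by congr (_ * _); rewrite !mxE mulr1.
Qed.

(** Applies the resolution of the identity in the second factor. It is used with dual bases of the
    group algebra, and with a single pair when the second factor is a line. *)
Lemma slice_sum d n (v : 'rV[F]_(d * n)) (I : finType) (c : I -> 'cV[F]_n) r :
  \sum_i c i *m r i = 1%:M -> v = \sum_i tprod (slice (c i) v) (r i).
Proof.
move=> cr1; rewrite -{1}[v]mulmx1 -tprod1 -cr1 tprod_sumr mulmx_sumr.
apply: eq_bigr => i _; rewrite -mx1_sum_delta tprod_suml mulmx_sumr.
rewrite [slice _ _]row_sum_delta tprod_suml; apply: eq_bigr => j _.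
by rewrite tprodZl mxE tprodE mulmx_colrow.
Qed.

End Kronecker.

(** * Maps out of an induced module *)

Section LinearFunctions.

Variables (R : pzRingType) (U V : lmodType R) (g : U -> V).
Hypothesis g_lin : linear g.

Lemma lin_add a b : g (a + b) = g a + g b.
Proof. by have := g_lin 1 a b; rewrite !scale1r. Qed.

Lemma lin_0 : g 0 = 0.
Proof. by apply: (addIr (g 0)); rewrite -lin_add !add0r. Qed.

Lemma lin_scale c a : g (c *: a) = c *: g a.
Proof. by have := g_lin c a 0; rewrite lin_0 !addr0. Qed.

Lemma lin_sub a b : g (a - b) = g a - g b.
Proof. by rewrite -scaleN1r addrC g_lin scaleN1r addrC. Qed.

Lemma lin_sum I (r : seq I) (P : pred I) (a : I -> U) :
  g (\sum_(i <- r | P i) a i) = \sum_(i <- r | P i) g (a i).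
Proof. exact: (big_morph g lin_add lin_0). Qed.

End LinearFunctions.

(** * Coordinates in the group algebra *)

Section GroupBasis.

Variable gT : finGroupType.
Local Notation nG := (gcard [set: gT]).

Definition gcol (y : gT) : 'cV[rat]_nG := cdelta rat (gring_index [set: gT] y).
Definition grow (y : gT) : 'rV[rat]_nG := rdelta rat (gring_index [set: gT] y).

Lemma gindexK : cancel (gring_index [set: gT]) enum_val.
Proof. by move=> y; rewrite gring_indexK ?inE. Qed.

Lemma gcol_sum : \sum_y gcol y *m grow y = 1%:M.
Proof.
rewrite -mx1_sum_delta [RHS](reindex (gring_index [set: gT])) //.
by exists enum_val => i _; [apply: gindexK | apply: gring_valK].
Qed.

Lemma grow_col y z : (grow y *m gcol z) 0 0 = (y == z)%:R.
Proof.
by rewrite rdeltaE mxE eqxx /= (inj_eq (can_inj gindexK)) eq_sym.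
Qed.

Lemma gslice_sum d (v : 'rV[rat]_(d * nG)) :
  v = \sum_y tprod (slice (gcol y) v) (grow y).
Proof. exact: slice_sum gcol_sum. Qed.

(** The coefficient of z in y a is the coefficient of y^-1 z in a. Multiplication on the other side
    gives z y^-1 in [regular_gcol]. *)
Lemma lregular_gcol y z : lregular_mx y *m gcol z = gcol (y^-1 * z)%g.
Proof.
apply/colP=> i; rewrite -[i]gring_valK mxE.
rewrite (bigD1 (gring_index [set: gT] z)) //= big1 => [|j /negPf jz]; last first.
  by rewrite !mxE jz mulr0.
rewrite !mxE !eqxx /= !andbT mulr1 addr0 !gring_valK; congr (nat_of_bool _)%:R.
rewrite -[RHS](inj_eq enum_val_inj) !gindexK.
rewrite (inj_eq (can_inj gindexK)) -(inj_eq (mulgI y^-1)%g) mulKg.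
by rewrite eq_sym.
Qed.

Lemma regular_gcol y z :
  regular_repr rat [set: gT] y *m gcol z = gcol (z * y^-1)%g.
Proof.
apply/colP=> i; rewrite -[i]gring_valK mxE.
rewrite (bigD1 (gring_index [set: gT] z)) //= big1 => [|j /negPf jz]; last first.
  by rewrite !mxE jz mulr0.
rewrite !mxE !eqxx /= !andbT mulr1 addr0 !gring_valK; congr (nat_of_bool _)%:R.
rewrite -[RHS](inj_eq enum_val_inj) !gindexK.
rewrite (inj_eq (can_inj gindexK)) -(inj_eq (mulIg y^-1)%g) mulgK.
by rewrite eq_sym.
Qed.

Lemma grow_lregular y z : grow z *m lregular_mx y = grow (y * z)%g.
Proof. by rewrite /grow /rdelta -rowE rowK gindexK. Qed.

End GroupBasis.

Section InducedMap.

Variables (gT hT : finGroupType) (iota : hT -> gT).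
Variable W : representation rat [set: hT].
Variables (M : lmodType rat) (act : gT -> M -> M).
Variables (f : 'rV[rat]_(rdegree W) -> M).

Hypothesis iotaM : {morph iota : h k / (h * k)%g}.
Hypothesis iota_inj : injective iota.
Hypothesis act_lin : forall y, linear (act y).
Hypothesis actM : forall y z a, act (y * z)%g a = act z (act y a).
Hypothesis f_lin : linear f.
Hypothesis f_equiv : forall w h, f (w *m W h) = act (iota h) (f w).

Let d := rdegree W.
Let nG := gcard [set: gT].
Let gslice (y : gT) (v : 'rV[rat]_(d * nG)) : 'rV[rat]_d := slice (gcol y) v.

Let gslice_row (w : 'rV_d) y z : gslice z (tprod w (grow y)) = (y == z)%:R *: w.
Proof. by rewrite /gslice slice_row grow_col. Qed.

(** The map w ⊗ y |-> (f w) y of Frobenius reciprocity, on all of W ⊗ Q[G] before the relations are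
    divided out; by [actM] the group acts from the right. *)
Definition induced_lift (v : 'rV[rat]_(d * nG)) : M :=
  \sum_y act y (f (gslice y v)).

Lemma induced_lift_is_linear : linear induced_lift.
Proof.
move=> c u v; rewrite scaler_sumr -big_split; apply: eq_bigr => y _ /=.
by rewrite /gslice slice_is_linear f_lin act_lin.
Qed.

Lemma induced_lift_relation (v : 'rV_(d * nG)) h :
  induced_lift (v *m (tprod (W h) (1%:M : 'M_nG)
     - tprod (1%:M : 'M_d) (lregular_mx (iota h)))) = 0.
Proof.
have L := induced_lift_is_linear.
rewrite mulmxBr (lin_sub L); apply/eqP; rewrite subr_eq0; apply/eqP => /=.
rewrite /induced_lift [RHS](reindex_inj (mulgI (iota h))) /=.
apply: eq_bigr => y _; rewrite actM -f_equiv; congr (act y (f _)).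
by rewrite /gslice !slice_tprod !mul1mx mulmx1 lregular_gcol mulKg.
Qed.

Lemma induced_lift_equiv v y :
  induced_lift (v *m tensor_mx W y) = act y (induced_lift v).
Proof.
rewrite (lin_sum (act_lin y)) /induced_lift (reindex_inj (mulIg y)) /=.
apply: eq_bigr => z _; rewrite -actM; congr (act _ (f _)).
by rewrite /gslice slice_tprod mulmx1 regular_gcol mulgK.
Qed.

Lemma ind_relations0 (v : 'rV_(d * nG)) :
  (v <= ind_relations iota W)%MS -> induced_lift v = 0.
Proof.
have L := induced_lift_is_linear.
case/sub_sumsmxP=> u ->; rewrite (lin_sum L) big1 //= => h _.
exact: induced_lift_relation.
Qed.

Variable D : M -> rat.
Hypothesis D_lin : scalar D.
Hypothesis D0 : forall g w, (forall h, g <> iota h) -> D (act g (f w)) = 0.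
Hypothesis D_sep : forall w, (forall h, D (f (w *m W h)) = 0) -> w = 0.

Let D_linr : linear (D : M -> rat^o) := D_lin.

(** Translating by y^-1 h' brings the coset H y onto H, and [D0] kills the components of v in all
    other cosets. With h' running through H, [D_sep] shows that the components in H y, carried back
    to y, sum to zero. Modulo the relations these sums are all that is left of v. *)
Lemma induced_lift_ker (v : 'rV_(d * nG)) :
  induced_lift v = 0 -> (v <= ind_relations iota W)%MS.
Proof.
move=> v0.
have rel0 y : \sum_h gslice (iota h * y)%g v *m W h = 0.
  apply: D_sep => h'.
  have: D (act (y^-1 * iota h')%g (induced_lift v)) = 0.
    by rewrite v0 (lin_0 (act_lin _)) (lin_0 D_linr).
  rewrite (lin_sum (act_lin _)) (lin_sum D_linr) (reindex_inj (mulIg y)) /=.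
  rewrite (bigID (mem (codom iota))) /= [X in _ + X]big1 => [|z zH]; last first.
    rewrite -actM mulgA mulgK D0 // => h zh; case/negP: zH.
    apply/codomP; exists (h * h'^-1)%g; apply: (mulIg (iota h')).
    by rewrite zh -iotaM mulgKV.
  rewrite addr0 -big_uniq ?map_inj_uniq ?enum_uniq -?enumT ?enum_uniq //.
  rewrite /codom /image_mem big_map big_enum /= => <-.
  rewrite mulmx_suml (lin_sum f_lin) (lin_sum D_linr); apply: eq_bigr => h _ /=.
  by rewrite -mulmxA -repr_mxM ?inE // f_equiv -actM mulgA mulgK iotaM.
have cardH : (#|hT|%:R : rat) != 0.
  by rewrite Num.Theory.pnatr_eq0 -lt0n; apply/card_gt0P; exists 1%g.
have -> : v = #|hT|%:R^-1 *: (#|hT|%:R *: v) by rewrite scalerA mulVf // scale1r.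
rewrite scalemx_sub //.
(* Each element of G is h y for exactly |H| pairs (h, y), hence the factor |H|. Each summand is, up
   to sign, a defining relation, and its second terms sum to zero by [rel0]. *)
suff -> : #|hT|%:R *: v = \sum_(h : hT) \sum_y
    (tprod (gslice (iota h * y)%g v) (grow (iota h * y)%g)
     - tprod (gslice (iota h * y)%g v *m W h) (grow y)).
  rewrite summx_sub // => h _; rewrite summx_sub // => y _.
  rewrite -opprB eqmx_opp (submx_trans _ (sumsmx_sup h _ (submx_refl _))) //.
  apply/submxP; exists (tprod (gslice (iota h * y)%g v) (grow y)).
  rewrite mulmxBr; congr (_ - _).
    by rewrite -[RHS](tprodE (gslice (iota h * y)%g v) _ (grow y)) mulmx1.
  rewrite -[RHS](tprodE (gslice (iota h * y)%g v) _ (grow y)) mulmx1.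
  by rewrite grow_lregular.
under eq_bigr do rewrite sumrB.
rewrite sumrB [X in _ - X]exchange_big /= [X in _ - X]big1 ?subr0 => [|y _]; last first.
  have := tprod_suml (index_enum hT) xpredT
    (fun h => gslice (iota h * y)%g v *m W h) (grow y).
  by rewrite rel0 tprod0l => /esym.
rewrite [RHS](eq_bigr (fun=> v)) => [|h _].
  by rewrite sumr_const scaler_nat.
by rewrite [RHS]gslice_sum [RHS](reindex_inj (mulgI (iota h))).
Qed.

Theorem induced_iso : exists phi : {linear 'rV[rat]_(rdegree (induced iota W)) -> M},
  [/\ injective phi,
      forall b, (exists v, b = phi v) <->
                (exists w : gT -> 'rV_d, b = \sum_y act y (f (w y)))
    & forall y v, phi (v *m induced iota W y) = act y (phi v)].
Proof.
have L := induced_lift_is_linear.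
pose U := ind_relations iota W.
pose vf (v : 'rV[rat]_(rdegree (induced iota W))) := val_factmod (U := U) v.
have lift_in v : induced_lift (val_factmod (in_factmod U v)) = induced_lift v.
  apply/eqP; rewrite -subr_eq0 -(lin_sub L); apply/eqP/ind_relations0.
  by rewrite -in_factmod_eq0 linearB /= val_factmodK subrr.
have phi_lin : linear (fun v => induced_lift (vf v)).
  by move=> c u v; rewrite /vf linearP L.
pose phi : {linear 'rV[rat]_(rdegree (induced iota W)) -> M} :=
  HB.pack (fun v => induced_lift (vf v)) (GRing.isLinear.Build _ _ _ _ _ phi_lin).
exists phi; split=> /=.
- move=> u v /eqP; rewrite -subr_eq0 -(lin_sub L) -linearB /=.
  move/eqP/induced_lift_ker; rewrite -in_factmod_eq0 val_factmodK subr_eq0.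
  by move/eqP.
- move=> b; split=> [[v ->]|[w ->]].
    by exists (fun y => gslice y (vf v)).
  exists (in_factmod U (\sum_y tprod (w y) (grow y))).
  rewrite /vf lift_in; apply: eq_bigr => y _; congr (act y (f _)).
  have SL : linear (gslice y) := @slice_is_linear _ d nG (gcol y).
  rewrite (lin_sum SL) (bigD1 y) //= big1 ?addr0 => [|z /negPf zy].
    by rewrite gslice_row eqxx scale1r.
  by rewrite gslice_row zy scale0r.
- move=> y v; rewrite /vf -induced_lift_equiv -[in RHS]lift_in.
  by rewrite /induced /= val_factmodJ ?inE.
Qed.

End InducedMap.

(** W is a line on which the group acts through [eps]. The degree of a tensor product or of a Specht
    module is not convertible to 1, so being a line is expressed by the mutually inverse [chi] and
    [psi]. *)
Definition affords (gT : finGroupType) (W : representation rat [set: gT])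
    (eps : gT -> rat) : Prop :=
  exists (chi : 'cV[rat]_(rdegree W)) (psi : 'rV[rat]_(rdegree W)),
    [/\ chi *m psi = 1%:M, psi *m chi = 1%:M & forall g, W g *m chi = eps g *: chi].

Lemma affords_xtensor (gT hT : finGroupType) (V : representation rat [set: gT])
    (W : representation rat [set: hT]) e1 e2 :
  affords V e1 -> affords W e2 -> affords (xtensor V W) (fun g => e1 g.1 * e2 g.2).
Proof.
move=> [c1 [p1 [cp1 pc1 e1P]]] [c2 [p2 [cp2 pc2 e2P]]].
exists (tprod c1 c2), (tprod p1 p2); split.
- by rewrite -[LHS](tprodE c1 p1 c2 p2) cp1 cp2 tprod1.
- by rewrite -[LHS](tprodE p1 c1 p2 c2) pc1 pc2 tprod1.
- move=> [g h]; rewrite -[LHS](tprodE (V g) c1 (W h) c2) e1P e2P.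
  by rewrite tprodZl tprodZr scalerA.
Qed.

Section CyclicBlock.

Variables (gT kT hT : finGroupType) (iota : kT * hT -> gT).
Variables (U : representation rat [set: kT]) (E : representation rat [set: hT]).
Variables (M : lmodType rat) (act : gT -> M -> M) (D : M -> rat) (mu : M).
Variables (J : kT -> 'cV[rat]_(rdegree U)) (eps : hT -> rat).

Hypothesis iotaM : {morph iota : h k / (h * k)%g}.
Hypothesis iota_inj : injective iota.
Hypothesis act_lin : forall y, linear (act y).
Hypothesis actM : forall y z a, act (y * z)%g a = act z (act y a).
Hypothesis JM : forall s t, U t *m J s = J (s * t^-1)%g.
Hypothesis E_eps : affords E eps.
Hypothesis mu_eps : forall h, act (iota (1, h))%g mu = eps h *: mu.
Hypothesis D_lin : scalar D.
Hypothesis D_out : forall g, (forall h, g <> iota h) -> D (act g mu) = 0.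
Hypothesis D_sep : forall u : 'rV[rat]_(rdegree U),
  (forall t, \sum_s (u *m J s) 0 0 * D (act (iota (s * t, 1))%g mu) = 0) -> u = 0.
Hypothesis mu_cyc : exists u : 'rV[rat]_(rdegree U),
  \sum_s (u *m J s) 0 0 *: act (iota (s, 1))%g mu = mu.

(** A vector of U ⊗ E goes to the combination of the translates of [mu] under the first factor whose
    coefficients are read by the forms [J s]. The map is equivariant because the two factors commute
    inside G and [mu] is an eigenvector of the second one. By [mu_cyc] its image contains [mu], so
    that the induced map fills the span of the orbit. *)
Theorem cyclic_block_iso :
  exists phi : {linear 'rV[rat]_(rdegree (induced iota (xtensor U E))) -> M},
  [/\ injective phi,
      forall b, (exists v, b = phi v) <->
                (exists c : gT -> rat, b = \sum_y c y *: act y mu)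
    & forall y v, phi (v *m induced iota (xtensor U E) y) = act y (phi v)].
Proof.
have [chi [psi [cp pc chiP]]] := E_eps.
pose a (w : 'rV[rat]_(rdegree U * rdegree E)) s := (w *m tprod (J s) chi) 0 0.
pose f w := \sum_s a w s *: act (iota (s, 1))%g mu.
have a_lin c u v s : a (c *: u + v) s = c * a u s + a v s.
  by rewrite /a mulmxDl -scalemxAl !mxE.
have f_lin : linear f.
  move=> c u v; rewrite scaler_sumr -big_split; apply: eq_bigr => s _ /=.
  by rewrite a_lin scalerDl scalerA.
have iota_split t h : iota (t, h) = (iota (t, 1) * iota (1, h))%g.
  by rewrite -iotaM; congr iota; congr pair; rewrite ?mulg1 ?mul1g.
have iota_comm t h : (iota (t, 1) * iota (1, h) = iota (1, h) * iota (t, 1))%g.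
  by rewrite -!iotaM; congr iota; congr pair; rewrite ?mulg1 ?mul1g.
have iotaM1 s t : iota (s * t, 1)%g = (iota (s, 1) * iota (t, 1))%g.
  by rewrite -iotaM; congr iota; congr pair; rewrite mulg1.
have aM w s t h : a (w *m xtensor U E (t, h)) s = eps h * a w (s * t^-1)%g.
  rewrite /a /= /xtensor_mx /= -mulmxA -[_ *m tprod _ _](tprodE (U t) _ (E h)).
  by rewrite JM chiP tprodZr -scalemxAr !mxE.
have f_equiv w h : f (w *m xtensor U E h) = act (iota h) (f w).
  case: h => t h; rewrite (lin_sum (act_lin _)) [LHS](reindex_inj (mulIg t)).
  apply: eq_bigr => s _; rewrite aM mulgK (lin_scale (act_lin _)).
  rewrite iota_split iota_comm actM -(actM (iota (s, 1)%g)) iota_comm actM.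
  rewrite mu_eps !(lin_scale (act_lin _)) scalerA mulrC.
  by rewrite iotaM1 actM.
have f_span w : f w = \sum_s a w s *: act (iota (s, 1))%g mu by [].
pose Dr : M -> rat^o := D.
have Dr_lin : linear Dr by exact: D_lin.
have Df g w : D (act g (f w)) = \sum_s a w s * D (act (iota (s, 1) * g)%g mu).
  rewrite (lin_sum (act_lin _)) -/(Dr _) (lin_sum Dr_lin); apply: eq_bigr => s _.
  by rewrite (lin_scale (act_lin _)) (lin_scale Dr_lin) -actM.
have D0 g w : (forall h, g <> iota h) -> D (act g (f w)) = 0.
  (* Multiplying g by an element of the subgroup keeps it outside, so [D_out] extends from [mu] to
     every f w. *)
  move=> gH; rewrite Df big1 // => s _; rewrite D_out ?mulr0 // => h sgh.
  apply: (gH ((s^-1, 1) * h)%g); rewrite iotaM -sgh mulgA -iotaM.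
  have -> : ((s^-1, 1) * (s, 1) = 1 :> kT * hT)%g.
    by congr pair; rewrite ?mulVg ?mulg1.
  have -> : iota 1%g = 1%g by apply: (mulgI (iota 1%g)); rewrite -iotaM !mulg1.
  by rewrite mul1g.
have aE w s : a w s = (slice chi w *m J s) 0 0 by rewrite /a sliceE.
have Dsep w : (forall h, D (f (w *m xtensor U E h)) = 0) -> w = 0.
  move=> Dw0; have sl0 : slice chi w = 0.
    apply: D_sep => t; rewrite -[RHS](Dw0 (t, 1)%g) f_equiv Df.
    by apply: eq_bigr => s _; rewrite iotaM1 aE.
  have := slice_sum w (c := fun _ : 'I_1 => chi) (r := fun=> psi).
  by rewrite !big_ord1 => -> //; rewrite sl0 tprod0l.
have [phi [phi_inj phi_im phiM]] :=
  induced_iso (W := xtensor U E) iotaM iota_inj act_lin actM f_lin f_equiv D_lin D0 Dsep.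
exists phi; split=> // b; split=> [/phi_im [w ->]|[c ->]].
  (* The coefficient of g collects all factorisations g = iota (s, 1) y. *)
  exists (fun g => \sum_y \sum_(s | iota (s, 1)%g == (g * y^-1)%g) a (w y) s).
  under [RHS]eq_bigr do rewrite scaler_suml.
  rewrite exchange_big; apply: eq_bigr => y _ /=.
  rewrite f_span (lin_sum (act_lin _)).
  rewrite [RHS](eq_bigr (fun g => \sum_(s | iota (s, 1)%g == (g * y^-1)%g)
     a (w y) s *: act g mu)) => [|g _]; last by rewrite scaler_suml.
  rewrite (exchange_big_dep xpredT) //=; apply: eq_bigr => s _.
  rewrite (lin_scale (act_lin _)) -actM (big_pred1 (iota (s, 1) * y)%g) // => g.
  by rewrite /= -(inj_eq (mulIg y)) mulgKV eq_sym.
apply/phi_im; have [u u_mu] := mu_cyc.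
have f_u : f (tprod u psi) = mu.
  rewrite -u_mu; apply: eq_bigr => s _; congr (_ *: _); rewrite /a.
  rewrite -[_ *m _](tprodE u _ psi) pc [u *m J s]mx11_scalar.
  rewrite -[(_ 0 0)%:M]scalemx1 tprodZl tprod1 mxE [X in _ * X]mxE mulr1.
  by rewrite !mxE.
exists (fun y => c y *: tprod u psi); apply: eq_bigr => y _.
rewrite -(lin_scale (act_lin _)); congr (act y _).
transitivity (c y *: f (tprod u psi)); first by rewrite f_u.
by rewrite -(lin_scale f_lin).
Qed.

End CyclicBlock.

(** * Specht modules as functions on the symmetric group *)

Section SpechtCoefficients.

Variables (r : nat) (la : seq nat).

Local Notation reg := (regular_repr rat [set: 'S_r]).
Local Notation R := (row_stab r la).
Local Notation C := (col_stab r la).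
Local Notation c := (young_symmetrizer r la).

(* (u *m specht_coef s) 0 0 is the coefficient of s in u, an element of Q[S_r]. *)
Definition specht_coef (s : 'S_r) : 'cV[rat]_(rdegree (specht r la)) :=
  row_base (cyclic_mx reg c) *m gcol s.

(** The coefficient of s in the product of the Young symmetrizer and the element a of Q[S_r]: a is
    summed over the row group, then antisymmetrised over the column group. *)
Definition column_antisym (a : 'S_r -> rat) (s : 'S_r) : rat :=
  \sum_(q in C) (-1) ^+ q * \sum_(p in R) a (p * q * s)%g.

Lemma row_stabV p : (p^-1 \in R)%g = (p \in R).
Proof.
rewrite !inE; apply/forallP/forallP => H i.
  by have := H (p i); rewrite permK eq_sym.
by have := H (p^-1 i)%g; rewrite permKV eq_sym.
Qed.

Lemma col_stabV p : (p^-1 \in C)%g = (p \in C).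
Proof.
rewrite !inE; apply/forallP/forallP => H i.
  by have := H (p i); rewrite permK eq_sym.
by have := H (p^-1 i)%g; rewrite permKV eq_sym.
Qed.

(** The product q p y equals s for y = p^-1 q^-1 s. Both stabilizers and the sign are invariant
    under inversion, so p and q may be replaced by their inverses. *)
Lemma young_symmetrizer_coef (a : 'S_r -> rat) s :
  (c *m (\sum_y a y *: reg y) *m gcol s) 0 0 = column_antisym a s.
Proof.
have regE y : (c *m reg y *m gcol s) 0 0 =
    \sum_(q in C) \sum_(p in R) (-1) ^+ q * (q * p == s * y^-1)%g%:R.
  rewrite -mulmxA regular_gcol /young_symmetrizer exchange_big.
  rewrite mulmx_suml summxE; apply: eq_bigr => q _.
  rewrite mulmx_suml summxE; apply: eq_bigr => p _.
  by rewrite -scalemxAl mxE; congr (_ * _); apply: grow_col.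
rewrite mulmx_sumr mulmx_suml summxE.
under eq_bigr => y _.
  rewrite -scalemxAr -scalemxAl mxE regE mulr_sumr.
  under eq_bigr do rewrite mulr_sumr.
  over.
rewrite exchange_big /column_antisym (reindex_inj invg_inj) /=.
apply: eq_big => [q|q _]; first exact: col_stabV.
rewrite exchange_big mulr_sumr (reindex_inj invg_inj) /=.
apply: eq_big => [p|p _]; first exact: row_stabV.
rewrite (bigD1 (p * q * s)%g) //= big1 ?addr0 => [|y ne_y].
  rewrite !invMg !mulgA mulgV mul1g eqxx mulr1 odd_permV mulrC.
  by [].
have -> : ((q^-1 * p^-1)%g == (s * y^-1)%g) = false.
  apply: contraNF ne_y => /eqP/(congr1 (fun z => (z^-1 * s)%g)).
  by rewrite !invMg !invgK mulgKV => ->.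
by rewrite !mulr0.
Qed.

Lemma specht_coefP (u : 'rV[rat]_(rdegree (specht r la))) : exists a : 'S_r -> rat,
  forall s, (u *m specht_coef s) 0 0 = column_antisym a s.
Proof.
have: (u *m row_base (cyclic_mx reg c) <= cyclic_mx reg c)%MS.
  by rewrite (submx_trans (submxMl _ _)) // eq_row_base.
case/cyclic_mxP=> A /envelop_mxP[a ->] def_u; exists a => s.
rewrite -young_symmetrizer_coef mulmxA def_u.
by congr ((_ *m _ *m _) _ _); apply: eq_bigl => y; rewrite inE.
Qed.

Lemma specht_coef_ex (a : 'S_r -> rat) :
  exists u : 'rV[rat]_(rdegree (specht r la)),
  forall s, (u *m specht_coef s) 0 0 = column_antisym a s.
Proof.
have: (c *m (\sum_y a y *: reg y) <= row_base (cyclic_mx reg c))%MS.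
  rewrite eq_row_base; apply/cyclic_mxP; exists (\sum_y a y *: reg y) => //.
  by apply/envelop_mxP; exists a; apply: eq_bigl => y; rewrite inE.
case/submxP=> u def_u; exists u => s.
by rewrite -young_symmetrizer_coef mulmxA -def_u.
Qed.

Lemma specht_coef_inj (u : 'rV[rat]_(rdegree (specht r la))) :
  (forall s, (u *m specht_coef s) 0 0 = 0) -> u = 0.
Proof.
move=> u0; apply/eqP.
rewrite -(mulmx_free_eq0 _ (row_base_free (cyclic_mx reg c))); apply/eqP/rowP=> i; rewrite -[LHS]rdeltaE -[i]gring_valK.
by rewrite -mulmxA u0 mxE.
Qed.

Lemma specht_coefM s t : specht r la t *m specht_coef s = specht_coef (s * t^-1)%g.
Proof.
rewrite /specht_coef -regular_gcol mulmxA [RHS]mulmxA; congr (_ *m _).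
have := val_submodJ (cyclic_mx_module reg c) 1%:M (in_setT t).
rewrite /val_submod /= !mul1mx. exact.
Qed.

(** All coefficients of an element are multiples of its coefficient at 1. That single form is
    therefore injective by [specht_coef_inj], and [u] shows that it is not zero. *)
Lemma affords_specht (e : 'S_r -> rat)
    (u : 'rV[rat]_(rdegree (specht r la))) :
  (forall s, specht_coef s = e s *: specht_coef 1%g) ->
  (u *m specht_coef 1%g) 0 0 = 1 ->
  affords (specht r la) (fun s => e s^-1%g).
Proof.
move=> eP u1; exists (specht_coef 1%g), u.
have uc1 : u *m specht_coef 1%g = 1%:M by rewrite [LHS]mx11_scalar u1.
split=> // [|s]; last by rewrite specht_coefM mul1g eP.
have J_free (v : 'rV[rat]_(rdegree (specht r la))) :
    v *m specht_coef 1%g = 0 -> v = 0.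
  by move=> v0; apply: specht_coef_inj => s; rewrite eP -scalemxAr v0 scaler0 mxE.
apply/row_matrixP=> i; apply/eqP; rewrite -subr_eq0; apply/eqP/J_free.
by rewrite mulmxBl -!row_mul -mulmxA uc1 mulmx1 mul1mx subrr.
Qed.

End SpechtCoefficients.

(** * Permutations in one-line notation *)

Definition one_line n (s : 'S_n) : seq nat := [seq val (s i) | i <- enum 'I_n].

Lemma nth_one_line n (s : 'S_n) (i : 'I_n) : nth 0%N (one_line s) i = s i.
Proof. by rewrite (nth_map i) ?size_enum_ord // nth_ord_enum. Qed.

Lemma one_line_inj n : injective (@one_line n).
Proof.
by move=> s t e; apply/permP=> i; apply: val_inj; rewrite /= -!nth_one_line e.
Qed.

Lemma mem_one_line n (s : 'S_n) : one_line s \in permutations (iota 0 n).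
Proof.
rewrite mem_permutations uniq_perm ?iota_uniq //.
  by rewrite map_inj_uniq ?enum_uniq // => i j /val_inj/perm_inj.
move=> k; rewrite mem_iota add0n /=; apply/mapP/idP => [[i _ ->]|ltkn]; first exact: ltn_ord.
by exists (s^-1 (Ordinal ltkn))%g; rewrite ?mem_enum ?permKV.
Qed.

Lemma one_line_ex n l : l \in permutations (iota 0 n) ->
  exists s : 'S_n, l = one_line s.
Proof.
rewrite mem_permutations => e.
have sz : size l = n by rewrite (perm_size e) size_iota.
have lt_l (i : 'I_n) : (nth 0 l i < n)%N.
  have: nth 0%N l i \in l by rewrite mem_nth ?sz.
  by rewrite (perm_mem e) mem_iota.
have f_inj : injective (fun i => Ordinal (lt_l i)).
  move=> i j /(congr1 val) /= /eqP.
  by rewrite nth_uniq ?sz ?(perm_uniq e) ?iota_uniq // => /eqP/val_inj.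
exists (perm f_inj); apply: (@eq_from_nth _ 0%N) => [|i].
  by rewrite size_map size_enum_ord.
rewrite sz => lt_in; have := nth_one_line (perm f_inj) (Ordinal lt_in).
by rewrite permE /= => ->.
Qed.

(** Replaces the enumeration of ['S_n], which is opaque to evaluation, by a concrete list of lists.
    This makes the later sums over S_3 and S_4 explicit. *)
Lemma sum_one_line n (V : nmodType) (G : seq nat -> V) :
  \sum_(s : 'S_n) G (one_line s) = \sum_(l <- permutations (iota 0 n)) G l.
Proof.
rewrite -(big_map (@one_line n) xpredT); apply/perm_big/uniq_perm.
- by rewrite map_inj_uniq ?index_enum_uniq //; apply: one_line_inj.
- exact: permutations_uniq.
move=> l; apply/mapP/idP => [[s _ ->]|/one_line_ex[s ->]]; first exact: mem_one_line.
by exists s; rewrite ?mem_index_enum.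
Qed.

Lemma one_lineM n (s t : 'S_n.+1) :
  one_line (s * t)%g = [seq val (t (inord k)) | k <- one_line s].
Proof.
rewrite /one_line -map_comp; apply: eq_map => i /=.
by rewrite permM inord_val.
Qed.

Lemma reshape_index_cons k ks i :
  reshape_index (k :: ks) i = if (i < k)%N then 0%N else (reshape_index ks (i - k)).+1.
Proof.
rewrite /reshape_index /= subn_eq0; case: ltnP => // leki.
by rewrite subSn.
Qed.

Lemma reshape_offset_cons k ks i :
  reshape_offset (k :: ks) i = if (i < k)%N then i else reshape_offset ks (i - k).
Proof.
rewrite /reshape_offset reshape_index_cons; case: ltnP => [_|leki] /=.
  by rewrite subn0.
by rewrite subnDA.
Qed.

(** * The trivial and the sign module *)

Section OneDimensional.

Variable r : nat.

Lemma row_stab_row : row_stab r [:: r] = [set: 'S_r].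
Proof.
apply/setP=> p; rewrite !inE; apply/forallP=> i.
by rewrite !reshape_index_cons !ltn_ord.
Qed.

Lemma col_stab_row : col_stab r [:: r] = [set 1%g].
Proof.
apply/setP=> p; rewrite !inE; apply/forallP/eqP=> [H|-> i]; last by rewrite perm1.
apply/permP=> i; apply/val_inj/eqP; rewrite perm1.
by have := H i; rewrite !reshape_offset_cons !ltn_ord.
Qed.

Lemma reshape_index_ones n i : (i < n)%N -> reshape_index (nseq n 1%N) i = i.
Proof.
elim: n i => // n IH [|i] lti; rewrite reshape_index_cons //=.
by rewrite subn1 IH.
Qed.

Lemma reshape_offset_ones n i : (i < n)%N -> reshape_offset (nseq n 1%N) i = 0%N.
Proof.
elim: n i => // n IH [|i] lti; rewrite reshape_offset_cons //=.
by rewrite subn1 IH.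
Qed.

Lemma row_stab_column : row_stab r (nseq r 1%N) = [set 1%g].
Proof.
apply/setP=> p; rewrite !inE; apply/forallP/eqP=> [H|-> i]; last by rewrite perm1.
apply/permP=> i; apply/val_inj/eqP; rewrite perm1.
by have := H i; rewrite !reshape_index_ones.
Qed.

Lemma col_stab_column : col_stab r (nseq r 1%N) = [set: 'S_r].
Proof.
apply/setP=> p; rewrite !inE; apply/forallP=> i.
by rewrite !reshape_offset_ones.
Qed.

Lemma column_antisym_row a s : column_antisym [:: r] a s = \sum_(p : 'S_r) a p.
Proof.
rewrite /column_antisym col_stab_row big_set1 odd_perm1 mul1r row_stab_row.
rewrite [RHS](reindex_inj (mulIg s)) /=.
by apply: eq_big => p; rewrite ?inE // mulg1.
Qed.

Lemma column_antisym_column a s :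
  column_antisym (nseq r 1%N) a s = (-1) ^+ s * \sum_(q : 'S_r) (-1) ^+ q * a q.
Proof.
rewrite /column_antisym col_stab_column [X in _ * X](reindex_inj (mulIg s)) /=.
rewrite mulr_sumr; apply: eq_big => q; rewrite ?inE // => _.
rewrite row_stab_column big_set1 mul1g mulrA odd_permM signr_addb; congr (_ * _).
by rewrite mulrC -mulrA -expr2 sqrr_sign mulr1.
Qed.

Lemma specht_row_coefP (u : 'rV[rat]_(rdegree (specht r [:: r]))) :
  exists k, forall s, (u *m specht_coef [:: r] s) 0 0 = k.
Proof.
have [a aP] := specht_coefP u; exists (\sum_p a p) => s.
by rewrite aP column_antisym_row.
Qed.

Lemma specht_row_coef_ex k : exists u : 'rV[rat]_(rdegree (specht r [:: r])),
  forall s, (u *m specht_coef [:: r] s) 0 0 = k.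
Proof.
have [u uP] := specht_coef_ex [:: r] (fun s : 'S_r => (s == 1%g)%:R * k).
exists u => s; rewrite uP column_antisym_row (bigD1 1%g) //= eqxx mul1r.
by rewrite big1 ?addr0 // => p /negPf->; rewrite mul0r.
Qed.

Lemma affords_row : affords (specht r [:: r]) (fun=> 1).
Proof.
have [u uP] := specht_row_coef_ex 1.
have := affords_specht (e := fun=> 1) (u := u) _ (uP 1%g); apply=> s.
apply/row_matrixP=> i; rewrite scale1r !rowE; apply/rowP=> j; rewrite !ord1.
by have [k kP] := specht_row_coefP (delta_mx 0 i); rewrite !kP.
Qed.

Lemma affords_column : affords (specht r (nseq r 1%N)) (fun s => (-1) ^+ s).
Proof.
have [u uP] := specht_coef_ex (nseq r 1%N) (fun s : 'S_r => (s == 1%g)%:R).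
have u1 : (u *m specht_coef (nseq r 1%N) 1%g) 0 0 = 1.
  rewrite uP column_antisym_column odd_perm1 mul1r (bigD1 1%g) //= eqxx odd_perm1.
  by rewrite mulr1 big1 ?addr0 // => p /negPf->; rewrite mulr0.
have eP s : specht_coef (nseq r 1%N) s =
    (-1) ^+ s *: specht_coef (nseq r 1%N) (1%g : 'S_r).
  apply/row_matrixP=> i; rewrite linearZ /= !rowE; apply/rowP=> j; rewrite !ord1.
  have [a aP] := specht_coefP (delta_mx 0 i).
  by rewrite [RHS]mxE !aP !column_antisym_column odd_perm1 mul1r.
have [chi [psi [cp pc chiP]]] := affords_specht eP u1.
by exists chi, psi; split=> // g; rewrite chiP odd_permV.
Qed.

End OneDimensional.

Lemma affords_ext (gT : finGroupType) (W : representation rat [set: gT]) e1 e2 :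
  e1 =1 e2 -> affords W e1 -> affords W e2.
Proof.
move=> e12 [chi [psi [cp pc chiP]]]; exists chi, psi; split=> // g.
by rewrite chiP e12.
Qed.

Lemma affords_Veps d r :
  affords (sm_rep (Veps d r)) (fun s : 'S_r => (-1) ^+ (odd d && s)).
Proof.
rewrite /Veps /=; case: eqVneq => [-> /=|_] /=.
  (* For r = 1 the shape is a row whatever the parity of d; on S_1 the sign is trivial as well. *)
  apply: affords_ext (affords_row 1) => s.
  suff -> : s = 1%g by rewrite odd_perm1 andbF.
  by apply/permP=> i; rewrite !ord1.
case: (odd d) => /=; first exact: affords_column.
exact: affords_row.
Qed.

Lemma row_stab1 r la : 1%g \in row_stab r la.
Proof. by rewrite inE; apply/forallP=> i; rewrite perm1. Qed.

Lemma row_stabM r la p q :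
  p \in row_stab r la -> q \in row_stab r la -> (p * q)%g \in row_stab r la.
Proof.
rewrite !inE => /forallP Hp /forallP Hq; apply/forallP=> i.
by rewrite permM (eqP (Hq (p i))) Hp.
Qed.

Definition row_sum r la (a : 'S_r -> rat) (s : 'S_r) : rat :=
  \sum_(p in row_stab r la) a (p * s)%g.

Lemma row_sum_row r la a (p s : 'S_r) :
  p \in row_stab r la -> row_sum la a (p * s)%g = row_sum la a s.
Proof.
move=> Rp; rewrite /row_sum [RHS](reindex_inj (mulIg p)) /=.
apply: eq_big => [q|q _]; last by rewrite mulgA.
apply/idP/idP => [Rq|Rqp]; first exact: row_stabM.
by rewrite -(mulgK p q) row_stabM ?row_stabV.
Qed.

(** A function that is constant on the coset R s agrees there with its average over R; this realises
    prescribed invariant functions as row sums. *)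
Lemma row_sum_inv r la a (s : 'S_r) :
  (forall p, p \in row_stab r la -> a (p * s)%g = a s) ->
  row_sum la (fun s => #|row_stab r la|%:R^-1 * a s) s = a s.
Proof.
move=> aR; have card_R : #|row_stab r la|%:R != 0 :> rat.
  rewrite Num.Theory.pnatr_eq0 -lt0n; apply/card_gt0P; exists 1%g.
  exact: row_stab1.
rewrite /row_sum (eq_bigr (fun=> #|row_stab r la|%:R^-1 * a s)) => [|p Rp].
  by rewrite sumr_const -[LHS]mulr_natl mulVKf.
by rewrite aR.
Qed.

(** * The shapes (n+1, 1) *)

Section Hook.

Variable n : nat.
Local Notation la := [:: n.+1; 1%N].

Lemma row_stab_hook (p : 'S_n.+2) : (p \in row_stab _ la) = (p ord_max == ord_max).
Proof.
have idx (i : 'I_n.+2) : reshape_index la i = (i == ord_max).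
  rewrite !reshape_index_cons -val_eqE /=; have := ltn_ord i; rewrite ltnS leq_eqVlt.
  case: eqP => [-> _|_ /= ->] //; first by rewrite ltnn subnn.
rewrite inE; apply/forallP/eqP => [/(_ ord_max)|fixp i].
  by rewrite !idx eqxx; case: (p ord_max =P ord_max).
by rewrite !idx -{1}fixp (inj_eq perm_inj).
Qed.

Lemma col_stab_hook : col_stab _ la = [set 1%g; tperm (ord0 : 'I_n.+2) ord_max].
Proof.
have off (i : 'I_n.+2) : reshape_offset la i = if i == ord_max then 0%N else i.
  rewrite !reshape_offset_cons -val_eqE /=; have := ltn_ord i; rewrite ltnS leq_eqVlt.
  case: eqP => [-> _|_ /= ->] //; first by rewrite ltnn subnn.
apply/setP=> p; rewrite inE in_set2; apply/forallP/orP => [H|[]/eqP-> i]; last first.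
- by rewrite !off; case: tpermP => [->|->|]; rewrite ?eqxx.
- by rewrite perm1.
have fixp i : i != ord0 -> i != ord_max -> p i = i.
  move=> i0 im; have := H i; rewrite !off (negPf im); case: ifP => _ /eqP e.
    by case/eqP: i0; apply: val_inj.
  exact: val_inj.
have p0m i : (i == ord0) || (i == ord_max) -> (p i == ord0) || (p i == ord_max).
  move=> i0m; have := H i; rewrite !off.
  have [-> _|_] := eqVneq (p i) ord_max; first by rewrite orbT.
  move/eqP => e; apply/orP; left; apply/eqP/val_inj; rewrite [LHS]e.
  by case/orP: i0m => /eqP->; rewrite ?eqxx //=.
have /orP[/eqP p0|/eqP p0] := p0m ord0 isT.
  have pm : p ord_max = ord_max.
    have := p0m ord_max (introT orP (or_intror (eqxx _))); rewrite -[X in (_ == X) || _]p0.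
    by rewrite (inj_eq perm_inj) /= => /eqP.
  left; apply/eqP/permP=> i; rewrite perm1.
  have [-> //|i0] := eqVneq i ord0; have [-> //|im] := eqVneq i ord_max.
  exact: fixp.
have pm : p ord_max = ord0.
  have := p0m ord_max (introT orP (or_intror (eqxx _))); rewrite -[X in _ || (_ == X)]p0.
  by rewrite (inj_eq perm_inj) orbF => /eqP.
right; apply/eqP/permP=> i; case: tpermP => [->|->|] //.
by move=> /eqP i0 /eqP im; rewrite fixp.
Qed.

(* V(n+1,1) is the space of the functions s |-> hook_fun t (one_line s). *)
Definition hook_fun (t : nat -> rat) (l : seq nat) : rat :=
  t (nth 0%N l n.+1) - t (nth 0%N l 0).

Lemma column_antisym_hook a s :
  column_antisym la a s =
  row_sum la a s - row_sum la a (tperm (ord0 : 'I_n.+2) ord_max * s)%g.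
Proof.
rewrite /column_antisym col_stab_hook big_setU1 ?big_set1 /=; last first.
  rewrite inE eq_sym; apply/eqP=> /permP/(_ ord0); rewrite tpermL perm1.
  by move/(congr1 val).
rewrite odd_perm1 odd_tperm mul1r mulN1r.
under eq_bigr do rewrite mulg1.
by congr (_ - _); apply: eq_bigr => p _; rewrite mulgA.
Qed.

Lemma hook_coefP (u : 'rV[rat]_(rdegree (specht n.+2 la))) :
  exists t, forall s, (u *m specht_coef la s) 0 0 = hook_fun t (one_line s).
Proof.
have [a aP] := specht_coefP u.
(* The row group is the stabilizer of the last point, so a row sum depends only on the image j of
   that point; the transposition of j with the last point represents its coset. *)
exists (fun j => row_sum la a (tperm ord_max (inord j))) => s.
have tE s' : row_sum la a s' = row_sum la a (tperm ord_max (s' ord_max)).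
  rewrite -[s' in LHS](mulgKV (tperm ord_max (s' ord_max))) row_sum_row //.
  by rewrite row_stab_hook tpermV permM tpermR.
rewrite aP column_antisym_hook /hook_fun [in LHS]tE.
rewrite [X in _ - X = _]tE permM tpermR.
rewrite (nth_one_line s ord_max) (nth_one_line s ord0).
by rewrite !inord_val.
Qed.

Lemma hook_coef_ex t : exists u : 'rV[rat]_(rdegree (specht n.+2 la)),
  forall s, (u *m specht_coef la s) 0 0 = hook_fun t (one_line s).
Proof.
pose b (s : 'S_n.+2) := t (s ord_max).
have [u uP] := specht_coef_ex la (fun s => #|row_stab n.+2 la|%:R^-1 * b s).
exists u => s; rewrite uP column_antisym_hook !row_sum_inv /b.
- rewrite permM tpermR /hook_fun.
  by rewrite (nth_one_line s ord_max) (nth_one_line s ord0).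
- by move=> p; rewrite row_stab_hook permM => /eqP->.
- by move=> p; rewrite row_stab_hook permM => /eqP->.
Qed.

End Hook.

(** * The shape (2, 2) *)

Section Square.

Local Notation la := [:: 2%N; 2%N].
Local Notation i0 := (@Ordinal 4 0 isT).
Local Notation i1 := (@Ordinal 4 1 isT).
Local Notation i2 := (@Ordinal 4 2 isT).
Local Notation i3 := (@Ordinal 4 3 isT).

Lemma ord4P (P : 'I_4 -> Prop) : P i0 -> P i1 -> P i2 -> P i3 -> forall i, P i.
Proof.
move=> P0 P1 P2 P3 [[|[|[|[|//]]]] lti];
  by rewrite (bool_irrelevance lti isT).
Qed.

Lemma row_stab_square (p : 'S_4) :
  (p \in row_stab 4 la) = ((p i0 < 2)%N && (p i1 < 2)%N).
Proof.
have idx (i : 'I_4) : (reshape_index la i == 0%N) = (i < 2)%N.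
  by elim/ord4P: i.
have idx1 (i : 'I_4) : (reshape_index la i == 1%N) = (1 < i)%N.
  by elim/ord4P: i.
rewrite inE; apply/forallP/andP => [H|[]].
  by have := H i0; have := H i1; rewrite -!idx /= => /eqP-> /eqP->.
have n01 : p i0 != p i1 by rewrite (inj_eq perm_inj).
have n02 : p i0 != p i2 by rewrite (inj_eq perm_inj).
have n12 : p i1 != p i2 by rewrite (inj_eq perm_inj).
have n03 : p i0 != p i3 by rewrite (inj_eq perm_inj).
have n13 : p i1 != p i3 by rewrite (inj_eq perm_inj).
move=> l0 l1; elim/ord4P; rewrite [X in _ == X]/=; rewrite ?idx ?idx1 //;
  move: n01 n02 n12 n03 n13 l0 l1; rewrite -!val_eqE /=; lia.
Qed.

Lemma col_stab_square : col_stab 4 la =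
  [set 1%g; tperm i0 i2; tperm i1 i3; (tperm i0 i2 * tperm i1 i3)%g].
Proof.
have off (i : 'I_4) : reshape_offset la i = odd i by elim/ord4P: i.
apply/setP=> p; rewrite inE !inE; apply/forallP/idP => [H|]; last first.
  rewrite -!orbA => /or4P[] /eqP-> i; rewrite !off; elim/ord4P: i;
    by rewrite ?permM !permE.
have n02 : p i0 != p i2 :> nat by rewrite val_eqE (inj_eq perm_inj).
have n13 : p i1 != p i3 :> nat by rewrite val_eqE (inj_eq perm_inj).
have := H i0; have := H i1; have := H i2; have := H i3; rewrite !off /=.
have pE (q : 'S_4) : [/\ p i0 = q i0 :> nat, p i1 = q i1 :> nat,
    p i2 = q i2 :> nat & p i3 = q i3 :> nat] -> p = q.
  by case=> *; apply/permP; elim/ord4P; apply: val_inj.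
have := ltn_ord (p i0); have := ltn_ord (p i1).
have := ltn_ord (p i2); have := ltn_ord (p i3).
move=> b3 b2 b1 b0 o3 o2 o1 o0.
case: (posnP (p i0)) => [v0|v0]; case: (ltnP (p i1) 2) => v1; rewrite -!orbA; apply/or4P.
- by constructor 1; apply/eqP; apply: pE; rewrite !perm1 /=; split; lia.
- by constructor 3; apply/eqP; apply: pE; rewrite !permE /=; split; lia.
- by constructor 2; apply/eqP; apply: pE; rewrite !permE /=; split; lia.
- by constructor 4; apply/eqP; apply: pE; rewrite !permM !permE /=; split; lia.
Qed.

(* V(2,2) is the space of the functions s |-> square_fun t (one_line s), for
   symmetric t. *)
Definition square_fun (t : nat -> nat -> rat) (l : seq nat) : rat :=
  t (nth 0%N l 0) (nth 0%N l 1) - t (nth 0%N l 2) (nth 0%N l 1)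
  - t (nth 0%N l 0) (nth 0%N l 3) + t (nth 0%N l 2) (nth 0%N l 3).

Lemma column_antisym_square a (s : 'S_4) :
  column_antisym la a s =
  row_sum la a s - row_sum la a (tperm i0 i2 * s)%g
  - row_sum la a (tperm i1 i3 * s)%g
  + row_sum la a (tperm i0 i2 * tperm i1 i3 * s)%g.
Proof.
rewrite /column_antisym col_stab_square.
have val_neq (q1 q2 : 'S_4) i : q1 i != q2 i -> q1 != q2.
  by apply: contraNneq => ->.
rewrite setUC big_setU1 /=; last first.
  by rewrite !inE !negb_or -!andbA; apply/and3P; split;
    [apply: (@val_neq _ _ i0)|apply: (@val_neq _ _ i1)|apply: (@val_neq _ _ i0)];
    rewrite ?permM !permE.
rewrite setUC big_setU1 /=; last first.
  by rewrite !inE !negb_or; apply/andP; split;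
    [apply: (@val_neq _ _ i1)|apply: (@val_neq _ _ i1)]; rewrite !permE.
rewrite setUC big_setU1 ?big_set1 /=; last first.
  by rewrite !inE; apply: (@val_neq _ _ i0); rewrite !permE.
rewrite odd_permM !odd_tperm odd_perm1 /= !mul1r !mulN1r.
have rs q : \sum_(p in row_stab 4 la) a (p * q * s)%g = row_sum la a (q * s)%g.
  by apply: eq_bigr => p _; rewrite mulgA.
by rewrite !rs mul1g; ring.
Qed.

Lemma row_sum_square_eq a (s s' : 'S_4) :
  (s i0 = s' i0 /\ s i1 = s' i1) \/ (s i0 = s' i1 /\ s i1 = s' i0) ->
  row_sum la a s = row_sum la a s'.
Proof.
move=> e; rewrite -[s](mulgKV s') row_sum_row // row_stab_square !permM.
by case: e => [[-> ->]|[-> ->]]; rewrite !permK.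
Qed.

Lemma square_coefP (u : 'rV[rat]_(rdegree (specht 4 la))) :
  exists2 t, (forall i j, t i j = t j i) &
    forall s, (u *m specht_coef la s) 0 0 = square_fun t (one_line s).
Proof.
have [a aP] := specht_coefP u.
(* A row sum depends only on the unordered pair of images of the first two points. Pairs that no
   permutation realises, such as i = j, get 0, which keeps [t] symmetric. *)
pose t i j := if [pick s : 'S_4 | (s i0 == i :> nat) && (s i1 == j :> nat)] is Some s
  then row_sum la a s else 0.
have tE (s : 'S_4) : t (s i0) (s i1) = row_sum la a s.
  rewrite /t; case: pickP => [s' /andP[/eqP/val_inj e0 /eqP/val_inj e1]|].
    by apply: row_sum_square_eq; left.
  by move/(_ s); rewrite !eqxx.
exists t => [i j|s].
  have swap i' j' (s : 'S_4) : s i0 = i' :> nat -> s i1 = j' :> nat -> t i' j' = t j' i'.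
    move=> <- <-; have := tE (tperm i0 i1 * s)%g; rewrite !permM tpermL tpermR => ->.
    rewrite tE; apply: row_sum_square_eq; right.
    by rewrite !permM tpermL tpermR.
  rewrite {1}/t; case: pickP => [s /andP[/eqP e0 /eqP e1]|no1].
    by rewrite -(swap _ _ s e0 e1) -e0 -e1 tE.
  rewrite /t; case: pickP => // s /andP[/eqP e0 /eqP e1].
  by have := no1 (tperm i0 i1 * s)%g; rewrite !permM tpermL tpermR e0 e1 !eqxx.
rewrite aP column_antisym_square -!tE !permM !permE /=.
by rewrite /square_fun -!nth_one_line.
Qed.

Lemma square_coef_ex t : (forall i j, t i j = t j i) ->
  exists u : 'rV[rat]_(rdegree (specht 4 la)),
  forall s, (u *m specht_coef la s) 0 0 = square_fun t (one_line s).
Proof.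
move=> tC; pose b (s : 'S_4) := t (s i0) (s i1).
have [u uP] := specht_coef_ex la (fun s => #|row_stab 4 la|%:R^-1 * b s).
have bR p s : p \in row_stab 4 la -> b (p * s)%g = b s.
  rewrite row_stab_square /b !permM => /andP[l0 l1].
  have : p i0 != p i1 by rewrite (inj_eq perm_inj).
  by move: l0 l1; elim/ord4P: (p i0) => //; elim/ord4P: (p i1).
exists u => s; rewrite uP column_antisym_square !row_sum_inv /b => [||||] *;
  try exact: bR.
rewrite !permM !permE /=.
by rewrite /square_fun -!nth_one_line.
Qed.

End Square.

(** * Finite computations in S_3 and S_4 *)

Ltac expand_perms n :=
  let l := eval vm_compute in (permutations (iota 0 n)) in
  rewrite (_ : permutations (iota 0 n) = l); [rewrite !big_cons !big_nil /= | by vm_compute].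

(** Replacing s by s t moves the translation from [g] to the coefficient function, where it relabels
    the values of the list. Each choice of [l0] then yields one explicit linear equation. *)
Lemma translates_one_line k (a : 'S_k.+1 -> rat) (f g : seq nat -> rat) :
  (forall s, a s = f (one_line s)) ->
  (forall t : 'S_k.+1, \sum_s a s * g (one_line (s * t)%g) = 0) ->
  forall l0, l0 \in permutations (iota 0 k.+1) ->
  \sum_(l <- permutations (iota 0 k.+1)) f [seq nth 0%N l0 j | j <- l] * g l = 0.
Proof.
move=> aE H l0 /one_line_ex[t ->]; rewrite -[RHS](H t^-1%g) -sum_one_line.
rewrite [RHS](reindex_inj (mulIg t)); apply: eq_bigr => s _.
rewrite mulgK aE one_lineM; congr (f _ * _); apply/eq_in_map => j.
rewrite (perm_mem (_ : perm_eq _ (iota 0 k.+1))) -?mem_permutations ?mem_one_line //.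
rewrite mem_iota add0n /= => ltj; rewrite -nth_one_line inordK //.
Qed.

Ltac perm_cases s :=
  let H := fresh in
  have H := mem_one_line s; move: H;
  match type of s with context [ordinal ?n] =>
    let l := eval vm_compute in (permutations (iota 0 n)) in
    rewrite (_ : permutations (iota 0 n) = l); [|by vm_compute]
  end;
  rewrite !inE; repeat (case/predU1P => [->|]); [..|move/eqP->].

(* g (one_line s) stands for D(s mu). *)
Definition separates k (U : representation rat [set: 'S_k])
    (J : 'S_k -> 'cV[rat]_(rdegree U)) (g : seq nat -> rat) : Prop :=
  forall u : 'rV[rat]_(rdegree U),
  (forall t, \sum_s (u *m J s) 0 0 * g (one_line (s * t)%g) = 0) -> u = 0.

Definition sg21 (l : seq nat) : rat := if (nth 0%N l 1 < nth 0%N l 2)%N then 1 else -1.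

(* The coordinates of p_i^*(h) G_ij G_ik, for l = [i; j; k], on
   p_0^*(h) G_01 G_02 and p_1^*(h) G_10 G_12. *)
Definition c21 (m : nat) (l : seq nat) : rat :=
  if m == 0%N then sg21 l * ((nth 0%N l 0 == 0%N)%:R - (nth 0%N l 0 == 2%N)%:R)
  else sg21 l * ((nth 0%N l 0 == 1%N)%:R + (nth 0%N l 0 == 2%N)%:R).

(** The two coordinates are added because D takes the same value on both basis elements. The two
    equations chosen, as many as the dimension of V(2,1), force [t] to be constant, and then
    [hook_fun t] vanishes. *)
Lemma separates21 : separates (U := specht 3 [:: 2; 1]%N)
  (specht_coef [:: 2; 1]%N) (fun l => c21 0 l + c21 1 l).
Proof.
move=> u H; apply: specht_coef_inj => s; have [t tE] := hook_coefP u.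
rewrite tE; have {}H := translates_one_line (g := fun l => c21 0 l + c21 1 l) tE H.
have /H : [:: 0; 1; 2]%N \in permutations (iota 0 3) by vm_compute.
have /H : [:: 1; 2; 0]%N \in permutations (iota 0 3) by vm_compute.
expand_perms 3%N; rewrite /hook_fun /c21 /sg21 /= => e1 e2.
have t01 : t 0%N = t 1%N by lra.
have t02 : t 0%N = t 2%N by lra.
by perm_cases s; rewrite /=; lra.
Qed.

Definition pair_at (a b : nat) (l : seq nat) : rat :=
  ((nth 0%N l 0 == a) && (nth 0%N l 1 == b) || (nth 0%N l 0 == b) && (nth 0%N l 1 == a))%N%:R.

(** The coordinate on the perfect matching of {0, 1, 2, 3} that contains the edge p, written with p
    first; [eta] is the sign of exchanging the two marked edges. *)
Definition matching (eta : rat) (p : nat * nat) (l : seq nat) : rat :=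
  pair_at p.1 p.2 l + eta * pair_at p.1 p.2 (drop 2 l).

Lemma separates31 : separates (U := specht 4 [:: 3; 1]%N)
  (specht_coef [:: 3; 1]%N) (matching (-1) (0, 1)%N).
Proof.
move=> u H; apply: specht_coef_inj => s; have [t tE] := hook_coefP u.
rewrite tE; have {}H := translates_one_line (g := matching (-1) (0, 1)%N) tE H.
have /H : [:: 0; 1; 2; 3]%N \in permutations (iota 0 4) by vm_compute.
have /H : [:: 0; 2; 1; 3]%N \in permutations (iota 0 4) by vm_compute.
have /H : [:: 0; 3; 2; 1]%N \in permutations (iota 0 4) by vm_compute.
expand_perms 4%N; rewrite /hook_fun /matching /pair_at /= => e1 e2 e3.
have t01 : t 0%N = t 1%N by lra.
have t02 : t 0%N = t 2%N by lra.
have t03 : t 0%N = t 3%N by lra.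
by perm_cases s; rewrite /=; lra.
Qed.

Section DirectSum.

Variables (k : nat) (U V : representation rat [set: 'S_k]).
Variables (J1 : 'S_k -> 'cV[rat]_(rdegree U)) (J2 : 'S_k -> 'cV[rat]_(rdegree V)).

Definition dadd_coef (s : 'S_k) : 'cV[rat]_(rdegree (dadd_grepr U V)) :=
  col_mx (J1 s) (J2 s).

Lemma dadd_coefM :
  (forall s t, U t *m J1 s = J1 (s * t^-1)%g) ->
  (forall s t, V t *m J2 s = J2 (s * t^-1)%g) ->
  forall s t, dadd_grepr U V t *m dadd_coef s = dadd_coef (s * t^-1)%g.
Proof.
move=> J1M J2M s t; rewrite /dadd_coef -J1M -J2M.
by rewrite /= (mul_block_col (U t)) !mul0mx addr0 add0r.
Qed.

Lemma dadd_coefE (u : 'rV[rat]_(rdegree (dadd_grepr U V))) s :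
  (u *m dadd_coef s) 0 0 =
  (lsubmx u *m J1 s) 0 0 + (rsubmx (u : 'rV_(_ + _)) *m J2 s) 0 0.
Proof.
by rewrite -[u in LHS](@hsubmxK _ 1 (rdegree U) (rdegree V)) mul_row_col mxE.
Qed.

Lemma dadd_coef_row (u : 'rV[rat]_(rdegree U)) (v : 'rV[rat]_(rdegree V)) s :
  (row_mx u v *m dadd_coef s) 0 0 = (u *m J1 s) 0 0 + (v *m J2 s) 0 0.
Proof. by rewrite dadd_coefE row_mxKl row_mxKr. Qed.

Lemma dadd_row_eq0 (u : 'rV[rat]_(rdegree (dadd_grepr U V))) :
  lsubmx u = 0 :> 'rV_(rdegree U) -> rsubmx (u : 'rV_(_ + _)) = 0 :> 'rV_(rdegree V) ->
  u = 0.
Proof.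
by move=> l0 r0; rewrite -[u](@hsubmxK _ 1 (rdegree U) (rdegree V)) l0 r0 row_mx0.
Qed.

End DirectSum.

Definition coefs_4_22 := dadd_coef (specht_coef (r := 4) [:: 4]%N) (specht_coef [:: 2; 2]%N).
Definition coefs_4_31_22 := dadd_coef (specht_coef (r := 4) [:: 4]%N)
   (dadd_coef (specht_coef (r := 4) [:: 3; 1]%N) (specht_coef [:: 2; 2]%N)).

Lemma separates_4_22 : separates coefs_4_22 (matching 1 (0, 1)%N).
Proof.
move=> u H; have [k kE] := specht_row_coefP (lsubmx u).
have [t tC tE] := square_coefP (rsubmx (u : 'rV_(_ + _))).
have uE s : (u *m coefs_4_22 s) 0 0 = k + square_fun t (one_line s).
  by rewrite dadd_coefE kE tE.
have {}H := translates_one_line (f := fun l => k + square_fun t l)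
   (g := matching 1 (0, 1)%N) uE H.
(* [square_fun] is a difference of two of the three sums of t over perfect matchings, so the
   equality of these sums is what kills the V(2,2) part. Three equations match the dimension 1 +
   2. *)
have [k0 [t1 t2]] : k = 0 /\ (t 0%N 1%N + t 2%N 3%N = t 0%N 2%N + t 1%N 3%N /\ t 0%N 1%N + t 2%N 3%N = t 0%N 3%N + t 1%N 2%N).
  have /H : [:: 0; 1; 2; 3]%N \in permutations (iota 0 4) by vm_compute.
  have /H : [:: 0; 2; 1; 3]%N \in permutations (iota 0 4) by vm_compute.
  have /H : [:: 0; 3; 2; 1]%N \in permutations (iota 0 4) by vm_compute.
  expand_perms 4%N; rewrite /square_fun /matching /pair_at /=.
  rewrite (tC 1%N 0%N) (tC 2%N 0%N) (tC 3%N 0%N) (tC 2%N 1%N) (tC 3%N 1%N) (tC 3%N 2%N) => e1 e2 e3.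
  by split; [|split]; lra.
apply: dadd_row_eq0; apply: specht_coef_inj => s; first by rewrite kE.
rewrite tE; perm_cases s; rewrite /square_fun /=;
  rewrite ?(tC 1%N 0%N) ?(tC 2%N 0%N) ?(tC 3%N 0%N) ?(tC 2%N 1%N) ?(tC 3%N 1%N) ?(tC 3%N 2%N); lra.
Qed.

Lemma separates_4_31_22 : separates coefs_4_31_22 (pair_at 0 1).
Proof.
move=> u H; have [k kE] := specht_row_coefP (lsubmx u).
pose u' : 'rV_(_ + _) := rsubmx (u : 'rV_(_ + _)).
have [t tE] := hook_coefP (lsubmx u').
have [t' tC tE'] := square_coefP (rsubmx u').
have uE s : (u *m coefs_4_31_22 s) 0 0 =
    k + (hook_fun 2 t (one_line s) + square_fun t' (one_line s)).
  by rewrite dadd_coefE dadd_coefE kE tE tE'.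
have {}H := translates_one_line (f := fun l => k + (hook_fun 2 t l + square_fun t' l))
   (g := pair_at 0 1) uE H.
(* The six equations match the dimension 1 + 3 + 2; besides the conditions on k and t' they make the
   hook function t constant. *)
have [k0 [t1 t2] [t3 t4 t5]] : [/\ k = 0, (t' 0%N 1%N + t' 2%N 3%N = t' 0%N 2%N + t' 1%N 3%N /\
    t' 0%N 1%N + t' 2%N 3%N = t' 0%N 3%N + t' 1%N 2%N) & [/\ t 0%N = t 1%N, t 0%N = t 2%N & t 0%N = t 3%N]].
  have /H : [:: 0; 1; 2; 3]%N \in permutations (iota 0 4) by vm_compute.
  have /H : [:: 0; 2; 1; 3]%N \in permutations (iota 0 4) by vm_compute.
  have /H : [:: 0; 3; 2; 1]%N \in permutations (iota 0 4) by vm_compute.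
  have /H : [:: 2; 3; 0; 1]%N \in permutations (iota 0 4) by vm_compute.
  have /H : [:: 1; 3; 0; 2]%N \in permutations (iota 0 4) by vm_compute.
  have /H : [:: 2; 1; 0; 3]%N \in permutations (iota 0 4) by vm_compute.
  expand_perms 4%N; rewrite /hook_fun /square_fun /pair_at /=.
  rewrite (tC 1%N 0%N) (tC 2%N 0%N) (tC 3%N 0%N) (tC 2%N 1%N) (tC 3%N 1%N) (tC 3%N 2%N) => e1 e2 e3 e4 e5 e6.
  by split; [|split|split]; lra.
apply: dadd_row_eq0; first by apply: specht_coef_inj => s; rewrite kE.
apply: dadd_row_eq0; apply: specht_coef_inj => s.
  by rewrite tE; perm_cases s; rewrite /hook_fun /=; lra.
rewrite tE'; perm_cases s; rewrite /square_fun /=;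
  rewrite ?(tC 1%N 0%N) ?(tC 2%N 0%N) ?(tC 3%N 0%N) ?(tC 2%N 1%N) ?(tC 3%N 1%N) ?(tC 3%N 2%N); lra.
Qed.

Ltac eval_perms n :=
  let l := eval vm_compute in (permutations (iota 0 n)) in
  rewrite (_ : permutations (iota 0 n) = l); [|by vm_compute];
  rewrite /= !big_cons !big_nil; vm_compute.

(* U contains an element mapped to mu = e m0, where c m (one_line s) is the
   coordinate of s mu on e m. *)
Definition generates k (U : representation rat [set: 'S_k])
    (J : 'S_k -> 'cV[rat]_(rdegree U)) (I : eqType) (ms : seq I)
    (c : I -> seq nat -> rat) (m0 : I) : Prop :=
  forall (M : lmodType rat) (E : 'S_k -> M) (e : I -> M),
  (forall s, E s = \sum_(m <- ms) c m (one_line s) *: e m) ->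
  exists u : 'rV[rat]_(rdegree U), \sum_s (u *m J s) 0 0 *: E s = e m0.

(** The element with coefficient function [f] is mapped to the combination of the e m with weights
    the sums of f times c m. It remains to check that the weight is 1 at [m0] and 0 elsewhere, a
    finite computation. *)
Lemma generates_coef k (U : representation rat [set: 'S_k])
    (J : 'S_k -> 'cV[rat]_(rdegree U)) (I : eqType) (ms : seq I)
    (c : I -> seq nat -> rat) (m0 : I) (f : seq nat -> rat)
    (u : 'rV[rat]_(rdegree U)) :
  (forall s, (u *m J s) 0 0 = f (one_line s)) ->
  uniq ms -> m0 \in ms ->
  all (fun m => \sum_(l <- permutations (iota 0 k)) f l * c m l == (m == m0)%:R) ms ->
  generates J ms c m0.
Proof.
move=> fE ms_uniq m0ms /allP fP M E e EE; exists u.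
under eq_bigr do rewrite fE EE scaler_sumr.
rewrite exchange_big /= (bigD1_seq m0) //=.
have sumE m : m \in ms -> \sum_(s : 'S_k) f (one_line s) *: (c m (one_line s) *: e m) =
    (m == m0)%:R *: e m.
  move=> /fP/eqP <-; rewrite -sum_one_line scaler_suml.
  by apply: eq_bigr => s _; rewrite scalerA.
rewrite sumE // eqxx scale1r big_seq_cond big1 ?addr0 // => m /andP[mms /negPf m0m].
by rewrite sumE // m0m scale0r.
Qed.

Lemma generates21 : generates (U := specht 3 [:: 2; 1]%N)
  (specht_coef [:: 2; 1]%N) [:: 0; 1]%N c21 0%N.
Proof.
(* The weights of [c21 0] and [c21 1] are t 0 - 2 t 1 + t 2 and t 1 + t 2 - 2 t 0; setting them to 1
   and 0 determines t up to a constant. *)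
pose t i : rat := if i is 0%N then 1 / 3%:R else if i is 1%N then 0 else 2%:R / 3%:R.
have [u uE] := hook_coef_ex 1 t; apply: (generates_coef uE); [by []|by []|].
by eval_perms 3%N.
Qed.

Definition matchings : seq (nat * nat) := [:: (0, 1); (0, 2); (0, 3)]%N.
Definition pairs4 : seq (nat * nat) := [:: (0, 1); (0, 2); (0, 3); (1, 2); (1, 3); (2, 3)]%N.

Lemma generates31 : generates (U := specht 4 [:: 3; 1]%N)
  (specht_coef [:: 3; 1]%N) matchings (matching (-1)) (0, 1)%N.
Proof.
(* Like the monomial with edges 01 and 23, this t is invariant inside each pair and changes sign
   when the pairs are exchanged. Eight orderings contribute 1/8 each to the coordinate (0, 1),
   whence 1/16. *)
pose t i : rat := if (i < 2)%N then - 1 / 16%:R else 1 / 16%:R.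
have [u uE] := hook_coef_ex 2 t; apply: (generates_coef uE); [by []|by []|].
by eval_perms 4%N.
Qed.

Lemma generates_4_22 : generates coefs_4_22 matchings (matching 1) (0, 1)%N.
Proof.
(* On each of the eight orderings of the matching 01|23 the two summands give 1/24 and 2/24, in
   total 1; over the orderings of another matching they sum to zero. *)
pose t i j : rat := if (i < 2)%N == (j < 2)%N then 1 / 24%:R else 0.
have [v vE] := specht_row_coef_ex 4 (1 / 24%:R).
have tC i j : t i j = t j i by rewrite /t eq_sym.
have [w wE] := square_coef_ex tC.
pose f l : rat := 1 / 24%:R + square_fun t l.
pose u : 'rV[rat]_(rdegree (dadd_grepr (specht 4 [:: 4]) (specht 4 [:: 2; 2])))%N :=
  row_mx v w.
have uE s : (u *m coefs_4_22 s) 0 0 = f (one_line s).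
  by rewrite dadd_coef_row vE wE.
apply: (generates_coef uE); [by []|by []|].
by eval_perms 4%N.
Qed.

Lemma generates_4_31_22 :
  generates coefs_4_31_22 pairs4 (fun p => pair_at p.1 p.2) (0, 1)%N.
Proof.
(* The functions of the two cases of equal marks are added. Each has weight 1/2 at the pair (0, 1);
   at (2, 3) the weights are 1/2 and -1/2 and cancel. *)
pose t i j : rat := if (i < 2)%N == (j < 2)%N then 1 / 24%:R else 0.
pose t1 i : rat := if (i < 2)%N then - 1 / 16%:R else 1 / 16%:R.
have [v vE] := specht_row_coef_ex 4 (1 / 24%:R).
have tC i j : t i j = t j i by rewrite /t eq_sym.
have [w wE] := square_coef_ex tC.
have [w1 w1E] := hook_coef_ex 2 t1.
pose f l : rat := 1 / 24%:R + (hook_fun 2 t1 l + square_fun t l).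
pose u : 'rV[rat]_(rdegree (dadd_grepr (specht 4 [:: 4])
    (dadd_grepr (specht 4 [:: 3; 1]) (specht 4 [:: 2; 2]))))%N :=
  row_mx v (row_mx w1 w).
have uE s : (u *m coefs_4_31_22 s) 0 0 = f (one_line s).
  by rewrite dadd_coef_row vE dadd_coef_row wE w1E.
apply: (generates_coef uE); [by []|by []|].
by eval_perms 4%N.
Qed.

Lemma separates_2 : separates (U := specht 2 [:: 2]%N) (specht_coef [:: 2]%N) (fun=> 1).
Proof.
move=> u H; apply: specht_coef_inj => s; have [k kE] := specht_row_coefP u.
have := H 1%g; under eq_bigr do rewrite kE mulr1.
rewrite sumr_const card_Sn kE (_ : 2`! = 2)%N // => /eqP.
by rewrite -mulr_natr mulf_eq0 orbF => /eqP.
Qed.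

Lemma generates_2 : generates (U := specht 2 [:: 2]%N) (specht_coef [:: 2]%N)
  [:: (0, 1)]%N (fun _ _ => 1) (0, 1)%N.
Proof.
have [u uE] := specht_row_coef_ex 2 (1 / 2%:R).
apply: (@generates_coef _ _ _ _ _ _ _ (fun=> 1 / 2%:R) _ uE); [by []|by []|].
by eval_perms 2%N.
Qed.

(** * A graded tensor power of a matrix algebra *)

Section SuperKronecker.

Variables (N : nat) (P : 'M[rat]_N) (vac : 'rV[rat]_N).
Hypothesis PP : P *m P = 1%:M.
Hypothesis vacP : vac *m P = vac.

Fixpoint sdim (n : nat) : nat := if n is n'.+1 then (N * sdim n')%N else 1%N.

Fixpoint spar n : 'M[rat]_(sdim n) :=
  if n is n'.+1 then tprod P (spar n') else 1%:M.

Definition evenp (A : 'M[rat]_N) := 2%:R^-1 *: (A + P *m A *m P).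
Definition oddp (A : 'M[rat]_N) := 2%:R^-1 *: (A - P *m A *m P).

(* A on the l-th factor; the Koszul signs come from the parity operator spar on
   the next factors, applied with the odd part of A. *)
Fixpoint slot n (l : nat) (A : 'M[rat]_N) : 'M[rat]_(sdim n) :=
  match n return 'M[rat]_(sdim n) with
  | 0 => 0
  | n'.+1 => if l is l'.+1 then tprod (1%:M : 'M_N) (slot n' l' A)
             else tprod (evenp A) (1%:M : 'M_(sdim n')) + tprod (oddp A) (spar n')
  end.

Fixpoint svac n : 'rV[rat]_(sdim n) :=
  if n is n'.+1 then tprod vac (svac n') else 1%:M.

Fixpoint scol n (f : nat -> 'cV[rat]_N) : 'cV[rat]_(sdim n) :=
  if n is n'.+1 then tprod (f 0%N) (scol n' (f \o succn)) else 1%:M.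

Definition homog (a : bool) (A : 'M[rat]_N) := P *m A *m P = (-1) ^+ a *: A.

Lemma spar2 n : spar n *m spar n = 1%:M.
Proof. by elim: n => [|n IH] /=; rewrite ?mulmx1 // -tprodE PP IH tprod1. Qed.

Lemma even_oddp A : evenp A + oddp A = A.
Proof.
rewrite -scalerDr addrACA subrr addr0 -mulr2n -scaler_nat scalerA.
by rewrite mulVf // scale1r.
Qed.

Lemma half_double (A : 'M[rat]_N) : 2%:R^-1 *: (A + A) = A.
Proof. by rewrite -mulr2n -scaler_nat scalerA mulVf // scale1r. Qed.

Lemma homogE a A : homog a A ->
  evenp A = (if a then 0 else A) /\ oddp A = (if a then A else 0).
Proof.
rewrite /homog /evenp /oddp => ->; case: a; rewrite ?expr1 ?expr0 ?scale1r; split.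
- by rewrite scaleN1r subrr scaler0.
- by rewrite scaleN1r opprK half_double.
- by rewrite half_double.
- by rewrite subrr scaler0.
Qed.

Lemma slotD n l : {morph slot n l : A B / A + B}.
Proof.
elim: n l => [|n IH] [|l] A B /=; rewrite ?addr0 ?IH ?tprodDr //.
have -> : evenp (A + B) = evenp A + evenp B.
  by rewrite /evenp -scalerDr mulmxDr mulmxDl addrACA.
have -> : oddp (A + B) = oddp A + oddp B.
  by rewrite /oddp -scalerDr mulmxDr mulmxDl opprD addrACA.
by rewrite !tprodDl addrACA.
Qed.

Lemma slotZ n l c A : slot n l (c *: A) = c *: slot n l A.
Proof.
elim: n l => [|n IH] [|l] /=; rewrite ?scaler0 ?IH ?tprodZr //.
have -> : evenp (c *: A) = c *: evenp A.
  by rewrite /evenp -scalemxAr -scalemxAl -scalerDr !scalerA mulrC.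
have -> : oddp (c *: A) = c *: oddp A.
  by rewrite /oddp -scalemxAr -scalemxAl -scalerBr !scalerA mulrC.
by rewrite !tprodZl scalerDr.
Qed.

Lemma slot1 n l : (l < n)%N -> slot n l 1%:M = 1%:M.
Proof.
elim: n l => [|n IH] [|l] //= ltl; last by rewrite IH // tprod1.
have [-> ->] : evenp 1%:M = 1%:M /\ oddp 1%:M = 0.
  by apply: (@homogE false); rewrite /homog mulmx1 PP expr0 scale1r.
by rewrite tprod0l addr0 tprod1.
Qed.

Lemma PAP_M A B : P *m (A *m B) *m P = (P *m A *m P) *m (P *m B *m P).
Proof. by rewrite !mulmxA -(mulmxA (P *m A) P P) PP mulmx1. Qed.

Lemma even_suboddp A : evenp A - oddp A = P *m A *m P.
Proof.
by rewrite -scalerBr opprB addrC addrA subrK half_double.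
Qed.

Lemma evenpM A B : evenp (A *m B) = evenp A *m evenp B + oddp A *m oddp B.
Proof.
rewrite {1}/evenp PAP_M -!even_suboddp -{1}(even_oddp A) -{1}(even_oddp B).
move: (evenp A) (oddp A) (evenp B) (oddp B) => E O F G.
rewrite -[RHS]half_double; congr (_ *: _).
rewrite !(mulmxBl, mulmxBr, mulmxDl, mulmxDr).
move: (E *m F) (E *m G) (O *m F) (O *m G) => EF EG OF OG.
by apply/matrixP=> i j; rewrite !mxE; ring.
Qed.

Lemma oddpM A B : oddp (A *m B) = evenp A *m oddp B + oddp A *m evenp B.
Proof.
rewrite {1}/oddp PAP_M -!even_suboddp -{1}(even_oddp A) -{1}(even_oddp B).
move: (evenp A) (oddp A) (evenp B) (oddp B) => E O F G.
rewrite -[RHS]half_double; congr (_ *: _).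
rewrite !(mulmxBl, mulmxBr, mulmxDl, mulmxDr).
move: (E *m F) (E *m G) (O *m F) (O *m G) => EF EG OF OG.
by apply/matrixP=> i j; rewrite !mxE; ring.
Qed.

Lemma slotM n l A B : slot n l (A *m B) = slot n l A *m slot n l B.
Proof.
elim: n l => [|n IH] [|l] /=; rewrite ?mulmx0 // -?tprodE ?mulmx1 ?IH //.
rewrite mulmxDl !mulmxDr -!tprodE !mulmx1 mul1mx spar2.
rewrite evenpM oddpM !tprodDl.
by rewrite -!addrA; congr (_ + _); rewrite addrCA; congr (_ + _); rewrite addrC.
Qed.
Lemma slot0E n a A : homog a A ->
  slot n.+1 0 A = tprod A (if a then spar n else 1%:M).
Proof.
move=> /homogE[eA oA]; rewrite /= eA oA.
by case: a {eA oA}; rewrite tprod0l ?add0r ?addr0.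
Qed.

Lemma spar_slot n l a A : homog a A ->
  spar n *m slot n l A = (-1) ^+ a *: (slot n l A *m spar n).
Proof.
move=> hA; elim: n l => [|n IH] [|l]; rewrite ?[slot 0 _ _]/= ?mulmx0 ?mul0mx ?scaler0 //.
  rewrite (slot0E _ hA) /= -!tprodE.
  have -> : P *m A = (-1) ^+ a *: (A *m P).
    by rewrite -[P *m A]mulmx1 -PP mulmxA hA -scalemxAl.
  by rewrite tprodZl; case: (a); rewrite ?mulmx1 ?mul1mx.
by rewrite /= -!tprodE mulmx1 mul1mx IH tprodZr.
Qed.

(** The operator in the earlier slot carries a parity operator on the later ones if it is odd;
    commuting this past the operator in the later slot gives the Koszul sign. *)
Lemma slotC n l k a b A C : homog a A -> homog b C -> l != k ->
  slot n l A *m slot n k C = (-1) ^+ (a && b) *: (slot n k C *m slot n l A).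
Proof.
move=> hA hC; elim: n l k => [|n IH] [|l] [|k] // lk.
- by rewrite !mulmx0 scaler0.
- by rewrite !mulmx0 scaler0.
- by rewrite !mulmx0 scaler0.
- rewrite (slot0E _ hA) /= -!tprodE mulmx1 mul1mx.
  by case: (a) => /=; rewrite ?mulmx1 ?mul1mx ?scale1r // (spar_slot _ _ hC) tprodZr.
- rewrite (slot0E _ hC) /= -!tprodE mulmx1 mul1mx.
  case: (b) => /=; rewrite ?andbF ?mulmx1 ?mul1mx ?scale1r // andbT.
  by rewrite (spar_slot _ _ hA) tprodZr scalerA -expr2 sqrr_sign scale1r.
- by rewrite /= -!tprodE !mulmx1 IH // tprodZr.
Qed.

Lemma svacP n : svac n *m spar n = svac n.
Proof.
elim: n => [|n IH] /=; first by rewrite mulmx1.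
by rewrite -[LHS](tprodE vac P (svac n)) vacP IH.
Qed.

Lemma slot_prod1 n m (Z : nat -> 'M[rat]_N) :
  \prod_(l < m) slot n.+1 l.+1 (Z l) = tprod (1%:M : 'M_N) (\prod_(l < m) slot n l (Z l)).
Proof.
elim: m => [|m IH]; first by rewrite !big_ord0; apply: (esym (tprod1 _ _ _)).
by rewrite !big_ord_recr /= IH -!mulmxE -tprodE mulmx1.
Qed.

(** The row [vac] is fixed by P, so the parity operators that odd factors spread over later slots
    act trivially on it; no sign remains and the entry factors over the slots. *)
Lemma slot_prod_eval n (Z : nat -> 'M[rat]_N) (f : nat -> 'cV[rat]_N) :
  (svac n *m (\prod_(l < n) slot n l (Z l)) *m scol n f) 0 0 =
  \prod_(l < n) (vac *m Z l *m f l) 0 0.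
Proof.
elim: n Z f => [|n IH] Z f; first by rewrite !big_ord0 !mulmx1 mxE.
rewrite !big_ord_recl -(IH (Z \o succn) (f \o succn)) -mulmxE mulmxA.
rewrite (slot_prod1 n n (Z \o succn)).
have -> : svac n.+1 *m slot n.+1 0 (Z 0%N) = tprod (vac *m Z 0%N) (svac n).
  rewrite /= mulmxDr -![_ *m tprod _ _](tprodE vac _ (svac n)) mulmx1 svacP.
  apply: (etrans (esym (tprodDl (vac *m evenp (Z 0%N)) (vac *m oddp (Z 0%N)) (svac n)))).
  by rewrite -mulmxDr even_oddp.
rewrite -[_ *m tprod _ _](tprodE (vac *m Z 0%N) _ (svac n)) mulmx1.
rewrite [scol _ _]/=.
have e := tprodE (vac *m Z 0%N) (f 0%N)
  (svac n *m \prod_(l < n) slot n l (Z l.+1)) (scol n (f \o succn)).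
apply: (etrans (congr1 (fun A : 'M_(1 * 1) => A 0 0) (esym e))).
rewrite [vac *m _ *m _]mx11_scalar [svac n *m _ *m _]mx11_scalar.
rewrite -[X in tprod X _]scalemx1 -[X in tprod _ X]scalemx1 tprodZl tprodZr tprod1.
by rewrite mxE [X in _ * X]mxE [X in _ * (_ * X)]mxE mulr1 !mxE !mulr1n.
Qed.

End SuperKronecker.

(** * Evaluating the Kriz model *)

Section KrizEvaluation.

Variables (m : nat) (X : cohomology_algebra m) (n : nat).
Variables (N : nat) (P : 'M[rat]_N) (L : X -> 'M[rat]_N) (alpha : 'M[rat]_N).
Hypothesis PP : P *m P = 1%:M.
Hypothesis L_lin : linear L.
Hypothesis LM : forall y z, L (y * z) = L y *m L z.
Hypothesis L1 : L 1 = 1%:M.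
Hypothesis L_homog : forall k y, y \in coh X k -> homog P (odd k) (L y).
Hypothesis alpha_homog : homog P true alpha.
Hypothesis alpha2 : alpha *m alpha = 0.
Hypothesis L_alpha : forall k y, y \in coh X k ->
  L y *m alpha = (-1) ^+ k *: (alpha *m L y).

Variable beta : 'I_n -> 'I_n.

(** The slot is the larger end itself and not its image under [beta], so that the edges of a
    canonical monomial, whose larger ends are distinct, never share a slot. *)
Definition keval_G (i j : 'I_n) : 'M[rat]_(sdim N n) :=
  if (i != j) && (beta i == beta j) then slot P n (maxn i j) alpha else 0.

Fixpoint keval (t : kterm X n) : 'M[rat]_(sdim N n) :=
  match t with
  | KConst c => c%:M
  | KPull i y => slot P n (beta i) (L y)
  | KG i j => keval_G i j
  | KAdd t u => keval t + keval u
  | KMul t u => keval t *m keval u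
  end.

Lemma slot0 l : slot P n l 0 = 0.
Proof. by rewrite -(scale0r 0) slotZ scale0r. Qed.

Lemma keval_keq t u : keq t u -> keval t = keval u.
Proof.
have lt_ord i : (nat_of_ord (beta i) < n)%N by [].
elim=> {t u} //=.
- by move=> t u v _ -> _ ->.
- by move=> t t' u u' _ -> _ ->.
- by move=> t t' u u' _ -> _ ->.
- by move=> *; rewrite addrA.
- by move=> *; rewrite addrC.
- by move=> t; rewrite raddf0 add0r.
- by move=> t; rewrite mul_scalar_mx scaleN1r addNr raddf0.
- by move=> *; rewrite mulmxA.
- by move=> t; rewrite mul1mx.
- by move=> *; rewrite mulmxDl.
- by move=> *; rewrite mulmxDr.
- by move=> b c; rewrite raddfD.
- by move=> b c; rewrite scalar_mxM.
- by move=> c t; rewrite scalar_mxC.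
- by move=> i y z; rewrite (lin_add L_lin) slotD.
- by move=> i c y; rewrite (lin_scale L_lin) slotZ mul_scalar_mx.
- by move=> i y z; rewrite LM slotM.
- by move=> i; rewrite L1 slot1.
- move=> i j k l y z yk zl; rewrite mul_scalar_mx.
  (* In different slots the sign is the Koszul sign; in the same slot it is graded commutativity of
     the cohomology. *)
  have [e|ne] := eqVneq (beta i) (beta j); last first.
    rewrite (slotC PP n (L_homog yk) (L_homog zl)) //.
    by rewrite -oddM signr_odd.
  by rewrite e -!slotM // -!LM (coh_comm yk zl) (lin_scale L_lin) slotZ.
- move=> l i j k y yk; rewrite mul_scalar_mx /keval_G.
  case: ifP => _; last by rewrite mulmx0 mul0mx scaler0.
  have [e|ne] := eqVneq (beta l : nat) (maxn i j).
    by rewrite e -!slotM // (L_alpha yk) slotZ.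
  rewrite (slotC PP n (L_homog yk) alpha_homog) //.
  by rewrite andbT signr_odd.
- move=> i j k l; rewrite mul_scalar_mx /keval_G.
  case: ifP => _; last by rewrite mulmx0 mul0mx scaler0.
  case: ifP => _; last by rewrite mulmx0 mul0mx scaler0.
  have [e|ne] := eqVneq (maxn i j) (maxn k l).
    by rewrite e -!slotM // alpha2 slot0 scaler0.
  by rewrite (slotC PP n alpha_homog alpha_homog) // expr1.
- by move=> i; rewrite /keval_G eqxx raddf0.
- by move=> i j; rewrite /keval_G eq_sym (eq_sym (beta j)) maxnC.
(* Either i and j are collapsed and both pullbacks lie in one slot, or the edge is 0. *)
- move=> i j y ltij; rewrite /keval_G; case: ifP => [/andP[_ /eqP->] //|_].
  by rewrite !mulmx0.
- move=> i j k ltij ltjk; rewrite mul_scalar_mx scaleN1r /keval_G.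
  have -> : i != j by rewrite -val_eqE /= neq_ltn ltij.
  have -> : j != k by rewrite -val_eqE /= neq_ltn ltjk.
  have -> : i != k by rewrite -val_eqE /= neq_ltn (ltn_trans ltij ltjk).
  have -> : maxn i k = k by apply/maxn_idPr/ltnW/(ltn_trans ltij).
  have -> : maxn j k = k by apply/maxn_idPr/ltnW.
  (* Two equalities among the images of i, j, k imply the third; if at most one holds, each product
     has a zero factor. *)
  rewrite /=; case: eqP => eik; case: eqP => ejk; case: eqP => eij;
    rewrite ?(mul0mx, mulmx0) ?subrr // -?slotM ?alpha2 ?slot0 ?subrr //;
    by exfalso; congruence.
Qed.

Definition kphi (a : kriz X n) : 'M[rat]_(sdim N n) := keval (krep a).

Lemma kphiE t : kphi (kcl t) = keval t.
Proof. exact/keval_keq/krepr. Qed.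

Lemma kphiD : {morph kphi : a b / a + b}.
Proof. by elim/kind=> t; elim/kind=> u; rewrite -kpiD !kphiE. Qed.

Lemma kphiM : {morph kphi : a b / a * b}.
Proof. by elim/kind=> t; elim/kind=> u; rewrite -kpiM !kphiE. Qed.

Lemma kphiZ c a : kphi (c *: a) = c *: kphi a.
Proof. by elim/kind: a => t; rewrite -kclZ !kphiE /= mul_scalar_mx. Qed.

Lemma kphi1 : kphi 1 = 1%:M.
Proof. exact: (kphiE (KConst _ _ 1)). Qed.

Lemma kphi_pull i y : kphi (kpull i y) = slot P n (beta i) (L y).
Proof. exact: (kphiE (KPull _ _)). Qed.

Lemma kphi_G i j : kphi (kG X i j) = keval_G i j.
Proof. exact: (kphiE (KG _ _ _)). Qed.

End KrizEvaluation.

(** * The algebra of operators on one slot *)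

Section SlotAlgebra.

Variables (m : nat) (X : cohomology_algebra m) (B : nat) (x : ordered_basis X B).

Definition bcoord (j : 'I_B.+1) (z : X) : rat :=
  coord (codom_tuple x) (enum_rank j) z.

Lemma bcoord_linear j : scalar (bcoord j).
Proof. by move=> c y z; rewrite /bcoord linearP. Qed.

Lemma bcoord_sum z : z = \sum_j bcoord j z *: x j.
Proof.
rewrite {1}(coord_basis (ob_basis x) (memvf z)).
rewrite (reindex_onto enum_rank enum_val) => [|i _]; last exact: enum_valK.
by apply: eq_big => [j|j _]; rewrite ?enum_rankK ?eqxx // nth_codom enum_rankK.
Qed.

Lemma bcoord_basis i j : bcoord j (x i) = (i == j)%:R.
Proof.
have free_x : free (codom_tuple x) := basis_free (ob_basis x).
have -> : x i = (codom_tuple x)`_(enum_rank i) by rewrite nth_codom enum_rankK.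
by rewrite /bcoord coord_free // (inj_eq enum_rank_inj).
Qed.

Lemma basis_neq0 i : x i != 0.
Proof.
apply/eqP=> /(congr1 (bcoord i)); rewrite bcoord_basis eqxx.
rewrite (_ : bcoord i 0 = 0) => [/eqP|]; first by rewrite oner_eq0.
by rewrite /bcoord linear0.
Qed.

Lemma ob_deg_le i : (ob_deg x i < (2 * m).+1)%N.
Proof.
rewrite ltnS leqNgt; apply/negP => /(@coh_high _ X) e0.
by have := ob_homog x i; rewrite e0 memv0 (negPf (basis_neq0 i)).
Qed.

(** Grouping the expansion of z by the degrees of the basis elements gives its decomposition into
    homogeneous parts. By [coh_direct] this is unique, so only the part of degree d survives. *)
Lemma bcoord_deg d z j : z \in coh X d -> bcoord j z != 0 -> ob_deg x j = d.
Proof.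
move=> zd; have [ltd|led] := ltnP d (2 * m).+1; last first.
  move: zd; rewrite coh_high // memv0 => /eqP ->.
  by rewrite /bcoord linear0 eqxx.
apply: contraNeq => jd.
pose part (e : 'I_(2 * m).+1) := \sum_(i | ob_deg x i == e :> nat) bcoord i z *: x i.
pose only (e : 'I_(2 * m).+1) := if e == Ordinal ltd then z else 0.
have : (\sum_e part e == \sum_e only e).
  apply/eqP; rewrite /only -big_mkcond big_pred1_eq.
  rewrite [RHS]bcoord_sum (partition_big (fun i => Ordinal (ob_deg_le i)) xpredT) //=.
rewrite (directv_sum_unique (coh_direct X)).
- move/forall_inP/(_ (Ordinal (ob_deg_le j)) isT)/eqP; rewrite /only -val_eqE /= (negPf jd).
  move/(congr1 (bcoord j)); rewrite /part {1 3}/bcoord linear_sum linear0 /=.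
  rewrite (bigD1 j) //= big1 ?addr0 => [|i /andP[_ ij]].
    by rewrite linearZ /= -!/(bcoord _ _) bcoord_basis eqxx mulr1 => ->.
  by rewrite linearZ /= -!/(bcoord _ _) bcoord_basis (negPf ij) mulr0.
- move=> e _; apply: memv_suml => i /eqP ie; rewrite memvZ //.
  by rewrite -ie ob_homog.
- by move=> e _; rewrite /only; case: eqP => [->|_]; rewrite ?mem0v.
Qed.

Lemma ob_deg0 : ob_deg x ord0 = 0%N.
Proof.
apply: (@bcoord_deg 0 1); first by rewrite coh_connected memv_line.
by rewrite -(ob_first x) bcoord_basis eqxx oner_eq0.
Qed.

(** Right multiplication, since matrices act on row vectors from the right; this makes the map
    multiplicative rather than antimultiplicative. *)
Definition rmul_mx (y : X) : 'M[rat]_B.+1 := \matrix_(i, j) bcoord j (x i * y).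
Definition deg_mx : 'M[rat]_B.+1 := diag_mx (\row_i (-1) ^+ ob_deg x i).
Definition exterior_mx : 'M[rat]_2 := delta_mx 0 1.
Definition exterior_par : 'M[rat]_2 := diag_mx (\row_i (-1) ^+ i).

Definition slotL (y : X) : 'M[rat]_(B.+1 * 2) := tprod (rmul_mx y) 1%:M.
Definition slotP : 'M[rat]_(B.+1 * 2) := tprod deg_mx exterior_par.
(** [exterior_mx] sends 1 to α and α to 0; the factor [deg_mx] is the sign of moving the odd α past
    the cohomology class. *)
Definition slot_alpha : 'M[rat]_(B.+1 * 2) := tprod deg_mx exterior_mx.
(** The element 1 ⊗ 1. The columns [slot_read j] and [slot_read_alpha] extract the coefficients of
    x_j ⊗ 1 and of 1 ⊗ α. *)
Definition slot_vac : 'rV[rat]_(B.+1 * 2) := tprod (rdelta rat (ord0 : 'I_B.+1)) (rdelta rat (0 : 'I_2)).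
Definition slot_read (j : 'I_B.+1) : 'cV[rat]_(B.+1 * 2) := tprod (cdelta rat j) (cdelta rat (0 : 'I_2)).
Definition slot_read_alpha : 'cV[rat]_(B.+1 * 2) := tprod (cdelta rat (ord0 : 'I_B.+1)) (cdelta rat (1 : 'I_2)).

Lemma rmul_mx_linear : linear rmul_mx.
Proof.
move=> c y z; apply/matrixP=> i j; rewrite !mxE.
have -> : x i * (c *: y + z) = c *: (x i * y) + x i * z by rewrite mulrDr scalerAr.
exact: bcoord_linear.
Qed.

Lemma rmul_mxM y z : rmul_mx (y * z) = rmul_mx y *m rmul_mx z.
Proof.
apply/matrixP=> i j; rewrite !mxE mulrA [x i * y]bcoord_sum mulr_suml.
rewrite /bcoord linear_sum /=; apply: eq_bigr => k _.
by rewrite -scalerAl linearZ /= !mxE.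
Qed.

Lemma rmul_mx1 : rmul_mx 1 = 1%:M.
Proof. by apply/matrixP=> i j; rewrite !mxE mulr1 bcoord_basis. Qed.

Lemma deg_mx2 : deg_mx *m deg_mx = 1%:M.
Proof.
apply/matrixP=> i j; rewrite mul_diag_mx !mxE mulrnAr -expr2 sqrr_sign //.
Qed.

Lemma exterior_par2 : exterior_par *m exterior_par = 1%:M.
Proof.
apply/matrixP=> i j; rewrite mul_diag_mx !mxE mulrnAr -expr2 sqrr_sign //.
Qed.

Lemma deg_rmul k y : y \in coh X k -> rmul_mx y *m deg_mx = (-1) ^+ k *: (deg_mx *m rmul_mx y).
Proof.
move=> yk; apply/matrixP=> i j; rewrite mul_mx_diag mul_diag_mx !mxE.
have [->|nz] := eqVneq (bcoord j (x i * y)) 0; first by rewrite mul0r !mulr0.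
have := subvP (coh_mul X (ob_deg x i) k) _ (memv_mul (ob_homog x i) yk).
move/bcoord_deg/(_ nz) => ->; rewrite exprD.
by rewrite mulrC -mulrA mulrCA.
Qed.

Lemma slotPP : slotP *m slotP = 1%:M.
Proof. by rewrite /slotP -tprodE deg_mx2 exterior_par2 tprod1. Qed.

Lemma slotL_linear : linear slotL.
Proof. by move=> c y z; rewrite /slotL rmul_mx_linear tprodPl. Qed.

Lemma slotLM y z : slotL (y * z) = slotL y *m slotL z.
Proof. by rewrite /slotL rmul_mxM -tprodE mulmx1. Qed.

Lemma slotL1 : slotL 1 = 1%:M.
Proof. by rewrite /slotL rmul_mx1 tprod1. Qed.

Lemma slotL_homog k y : y \in coh X k -> homog slotP (odd k) (slotL y).
Proof.
move=> yk; rewrite /homog /slotP /slotL -!tprodE mulmx1 exterior_par2.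
rewrite -mulmxA (deg_rmul yk) -scalemxAr mulmxA deg_mx2 mul1mx.
by rewrite tprodZl signr_odd.
Qed.

Lemma slot_alpha_homog : homog slotP true slot_alpha.
Proof.
rewrite /homog /slotP /slot_alpha -!tprodE deg_mx2 mul1mx expr1 -tprodZr.
congr (tprod _ _); apply/matrixP=> i j; rewrite mul_mx_diag mxE mul_diag_mx !mxE.
by case: i => [[|[|]]] //; case: j => [[|[|]]] // *; rewrite /= ?mulr0 ?mul0r // expr0 expr1 mul1r.
Qed.

Lemma slot_alpha2 : slot_alpha *m slot_alpha = 0.
Proof. by rewrite /slot_alpha -tprodE mul_delta_mx_0 ?tprod0r. Qed.

Lemma slotL_alpha k y : y \in coh X k ->
  slotL y *m slot_alpha = (-1) ^+ k *: (slot_alpha *m slotL y).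
Proof.
by move=> yk; rewrite /slotL /slot_alpha -!tprodE mul1mx mulmx1 (deg_rmul yk) tprodZl.
Qed.

Lemma slot_vacP : slot_vac *m slotP = slot_vac.
Proof.
have e1 : rdelta rat ord0 *m deg_mx = rdelta rat (ord0 : 'I_B.+1).
  apply/matrixP=> i j; rewrite mul_mx_diag !mxE.
  by case: (j =P ord0) => [->|_]; rewrite ?ob_deg0 ?expr0 ?mulr1 // andbF mul0r.
have e2 : rdelta rat 0 *m exterior_par = rdelta rat (0 : 'I_2).
  apply/matrixP=> i j; rewrite mul_mx_diag !mxE.
  by case: (j =P 0) => [->|_]; rewrite ?expr0 ?mulr1 // andbF mul0r.
by rewrite /slot_vac /slotP -[LHS](tprodE (rdelta rat ord0) _ (rdelta rat 0)) e1 e2.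
Qed.

Lemma tprod11 (A C : 'M[rat]_1) : (tprod A C : 'M_1) 0 0 = A 0 0 * C 0 0.
Proof.
rewrite [A]mx11_scalar [C]mx11_scalar -[X in tprod X _]scalemx1 -[X in tprod _ X]scalemx1.
by rewrite tprodZl tprodZr tprod1 mxE [X in _ * X]mxE [X in _ * (_ * X)]mxE mulr1 !mxE !mulr1n.
Qed.

Lemma slot_readL j y : (slot_vac *m slotL y *m slot_read j) 0 0 = bcoord j y.
Proof.
rewrite /slot_vac /slotL -[X in X *m _](tprodE (rdelta rat ord0) _ (rdelta rat 0)) mulmx1.
have e := tprodE (rdelta rat ord0 *m rmul_mx y) (cdelta rat j) (rdelta rat (0 : 'I_2)) (cdelta rat 0).
apply: (etrans (congr1 (fun A : 'M_(1 * 1) => A 0 0) (esym e))).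
rewrite tprod11 !rdeltaE -rowE !mxE eqxx mulr1.
by rewrite (ob_first x) mul1r.
Qed.

Lemma slot_readA : (slot_vac *m slot_alpha *m slot_read_alpha) 0 0 = 1.
Proof.
rewrite /slot_vac /slot_alpha -[X in X *m _](tprodE (rdelta rat ord0) _ (rdelta rat 0)).
have e := tprodE (rdelta rat ord0 *m deg_mx) (cdelta rat ord0)
  (rdelta rat (0 : 'I_2) *m exterior_mx) (cdelta rat 1).
apply: (etrans (congr1 (fun A : 'M_(1 * 1) => A 0 0) (esym e))).
by rewrite tprod11 !rdeltaE -!rowE !mxE eqxx ob_deg0 mulr1n mul1r.
Qed.

End SlotAlgebra.

(** * Monomials up to sign and their detection *)

(** Equality up to sign is enough for the vanishing of D and for membership in a span. Exact signs
    are computed only where they decide which module occurs. *)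
Definition pm_eq (V : zmodType) (a b : V) : Prop := a = b \/ a = - b.

Section PlusMinus.

Lemma pm_refl (V : zmodType) (a : V) : pm_eq a a. Proof. by left. Qed.

Lemma pm_sym (V : zmodType) (a b : V) : pm_eq a b -> pm_eq b a.
Proof. by case=> ->; [left | right; rewrite opprK]. Qed.

Lemma pm_trans (V : zmodType) (b a c : V) : pm_eq a b -> pm_eq b c -> pm_eq a c.
Proof. by case=> -> [->|->]; rewrite ?opprK; [left|right|right|left]. Qed.

Lemma pm_sign (V : lmodType rat) k (a : V) : pm_eq ((-1) ^+ k *: a) a.
Proof.
by rewrite -signr_odd; case: odd; rewrite ?scaleN1r ?scale1r; [right|left].
Qed.

Lemma pmM (R : pzRingType) (a b c d : R) : pm_eq a b -> pm_eq c d -> pm_eq (a * c) (b * d).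
Proof.
by case=> -> [->|->]; rewrite ?mulrN ?mulNr ?opprK; [left|right|right|left].
Qed.

Lemma pm_comm_prod (R : pzRingType) (I : eqType) (y : I -> R) a s :
  (forall i j, pm_eq (y i * y j) (y j * y i)) ->
  pm_eq ((\prod_(i <- s) y i) * y a) (y a * \prod_(i <- s) y i).
Proof.
move=> yC; elim: s => [|i s IH]; first by rewrite big_nil mulr1 mul1r; left.
rewrite big_cons -mulrA; apply: (pm_trans (b := y i * (y a * \prod_(j <- s) y j))).
  by apply: pmM => //; left.
by rewrite mulrA [X in pm_eq _ X]mulrA; apply: pmM; [apply: yC|left].
Qed.

Lemma pm_prod_perm (R : pzRingType) (I : eqType) (y : I -> R) s t :
  (forall i j, pm_eq (y i * y j) (y j * y i)) ->
  perm_eq s t -> pm_eq (\prod_(i <- s) y i) (\prod_(i <- t) y i).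
Proof.
move=> yC; elim: s t => [|a s IH] t st.
  by rewrite (perm_nilP (etrans (perm_sym _ _) st)); left.
have at_ : a \in t by rewrite -(perm_mem st) mem_head.
case/splitPr: at_ st => t1 t2 st.
rewrite big_cons big_cat big_cons /=.
have st12 : perm_eq s (t1 ++ t2).
  by rewrite -(perm_cons a) (perm_trans st) // perm_sym -cat1s perm_catCA.
apply: (pm_trans (b := y a * \prod_(i <- t1 ++ t2) y i)).
  by apply: pmM; [left|apply: IH].
rewrite big_cat /= !mulrA; apply: pmM; last by left.
exact/pm_sym/pm_comm_prod.
Qed.

Lemma pm_prod_reindex (R : pzRingType) n (y : 'I_n -> R) (g : 'S_n) :
  (forall i j, pm_eq (y i * y j) (y j * y i)) ->
  pm_eq (\prod_i y (g i)) (\prod_i y i).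
Proof.
move=> yC; rewrite -(big_map g xpredT) /=; apply: pm_prod_perm => //.
apply: uniq_perm; rewrite ?map_inj_uniq ?index_enum_uniq //; first exact: perm_inj.
move=> i; rewrite mem_index_enum; apply/mapP; exists (g^-1 i)%g.
  by rewrite mem_index_enum.
by rewrite permKV.
Qed.

End PlusMinus.

Section KrizMonomials.

Variables (m : nat) (X : cohomology_algebra m) (n : nat) (B : nat) (x : ordered_basis X B).

Lemma pm_pull i j a b :
  pm_eq (kpull i (x a) * kpull j (x b) : kriz X n) (kpull j (x b) * kpull i (x a)).
Proof. by rewrite (kpullC _ _ (ob_homog x a) (ob_homog x b)); apply: pm_sign. Qed.

Lemma kact_prod (g : 'S_n) (I : Type) (s : seq I) (y : I -> kriz X n) :
  kact g (\prod_(i <- s) y i) = \prod_(i <- s) kact g (y i).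
Proof. exact: (big_morph (kact g) (kactM g) (kact_1 X g)). Qed.

Lemma kact_monomial (g : 'S_n) a es :
  kact g (kmonomial x a es) =
  (\prod_l kpull (g l) (x (a l))) * \prod_(e <- es) kG X (g e.1) (g e.2).
Proof.
rewrite kactM !kact_prod; congr (_ * _); apply: eq_bigr => *.
  exact: kact_pull.
exact: kact_G.
Qed.

Definition ren_edges (g : 'S_n) (es : seq ('I_n * 'I_n)) :=
  [seq (g e.1, g e.2) | e <- es].

(** The action permutes the pullback factors; restoring the order of the points costs only a
    sign. *)
Lemma pm_kact_monomial (g : 'S_n) a es :
  pm_eq (kact g (kmonomial x a es)) (kmonomial x (a \o g^-1)%g (ren_edges g es)).
Proof.
rewrite kact_monomial /kmonomial big_map; apply: pmM; last by left.
have := @pm_prod_reindex _ _ (fun l => kpull l (x (a (g^-1 l)%g)) : kriz X n) g.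
by under eq_bigr do rewrite permK; apply=> i j; apply: pm_pull.
Qed.

End KrizMonomials.

Section Insertion.

Variables (N : nat) (P : 'M[rat]_N) (n : nat).
Hypothesis PP : P *m P = 1%:M.

Lemma homogM a b A C : homog P a A -> homog P b C -> homog P (a (+) b) (A *m C).
Proof.
move=> hA hC; rewrite /homog PAP_M // hA hC -scalemxAl -scalemxAr scalerA.
by rewrite signr_addb.
Qed.

Lemma pm_slotC l k a b A C : homog P a A -> homog P b C -> l != k ->
  pm_eq (slot P n l A * slot P n k C) (slot P n k C * slot P n l A).
Proof. by move=> hA hC lk; rewrite -!mulmxE (slotC PP n hA hC lk); apply: pm_sign. Qed.

Lemma slot_insert (F : nat -> 'M[rat]_N) b C s k :
  (forall l, exists a, homog P a (F l)) -> homog P b C -> (s < k)%N ->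
  pm_eq ((\prod_(l < k) slot P n l (F l)) * slot P n s C)
        (\prod_(l < k) slot P n l (if l == s :> nat then F l *m C else F l)).
Proof.
move=> hF hC; elim: k => // k IH; rewrite ltnS leq_eqVlt !big_ord_recr /=.
case/predU1P => [->|ltsk].
  rewrite eqxx slotM // mulmxE mulrA -[X in pm_eq X _]mulrA; left.
  rewrite mulrA; congr (_ * _ * _); apply: eq_bigr => i _.
  by rewrite ltn_eqF.
rewrite gtn_eqF // -mulrA; have [a ha] := hF k.
apply: (pm_trans (b := (\prod_(l < k) slot P n l (F l)) * (slot P n s C * slot P n k (F k)))).
  by apply: pmM; [left|apply: pm_slotC ha hC _; rewrite gtn_eqF].
by rewrite mulrA; apply: pmM; [apply: IH|left].
Qed.

End Insertion.

(** * The linear form attached to a collapse *)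

Section Detector.

Variables (m : nat) (X : cohomology_algebra m) (B : nat) (x : ordered_basis X B).
Variables (n : nat) (beta : 'I_n -> 'I_n) (f : nat -> 'cV[rat]_(B.+1 * 2)).

Local Notation Phi := (kphi (slotP x) (slotL x) (slot_alpha x) beta).
Local Notation slotx := (slot (slotP x) n).

Definition detector (a : kriz X n) : rat :=
  (svac (slot_vac B) n *m Phi a *m scol n f) 0 0.

Let PhiD := kphiD (slotPP x) (@slotL_linear _ _ _ x) (@slotLM _ _ _ x) (slotL1 x)
  (@slotL_homog _ _ _ x) (slot_alpha_homog x) (slot_alpha2 x) (@slotL_alpha _ _ _ x) beta.
Let PhiZ := kphiZ (slotPP x) (@slotL_linear _ _ _ x) (@slotLM _ _ _ x) (slotL1 x)
  (@slotL_homog _ _ _ x) (slot_alpha_homog x) (slot_alpha2 x) (@slotL_alpha _ _ _ x) beta.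
Let PhiM := kphiM (slotPP x) (@slotL_linear _ _ _ x) (@slotLM _ _ _ x) (slotL1 x)
  (@slotL_homog _ _ _ x) (slot_alpha_homog x) (slot_alpha2 x) (@slotL_alpha _ _ _ x) beta.
Let Phi1 := kphi1 (slotPP x) (@slotL_linear _ _ _ x) (@slotLM _ _ _ x) (slotL1 x)
  (@slotL_homog _ _ _ x) (slot_alpha_homog x) (slot_alpha2 x) (@slotL_alpha _ _ _ x) beta.
Let Phi_pull := kphi_pull (slotPP x) (@slotL_linear _ _ _ x) (@slotLM _ _ _ x) (slotL1 x)
  (@slotL_homog _ _ _ x) (slot_alpha_homog x) (slot_alpha2 x) (@slotL_alpha _ _ _ x) beta.
Let Phi_G := kphi_G (slotPP x) (@slotL_linear _ _ _ x) (@slotLM _ _ _ x) (slotL1 x)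
  (@slotL_homog _ _ _ x) (slot_alpha_homog x) (slot_alpha2 x) (@slotL_alpha _ _ _ x) beta.

Lemma detector_scalar : scalar detector.
Proof.
move=> c a b; rewrite /detector PhiD PhiZ mulmxDr mulmxDl -scalemxAr -scalemxAl.
by rewrite !mxE.
Qed.

Lemma detector_pm a b : pm_eq a b -> detector a = 0 -> detector b = 0.
Proof.
have Dl : linear (detector : kriz X n -> rat^o) by exact: detector_scalar.
move=> /pm_sym[->|->] // Da; rewrite -scaleN1r.
by rewrite [LHS](lin_scale Dl) Da; apply: mulr0.
Qed.

Lemma Phi_prod (I : Type) (s : seq I) (y : I -> kriz X n) :
  Phi (\prod_(i <- s) y i) = \prod_(i <- s) Phi (y i).
Proof. exact: (big_morph Phi PhiM Phi1). Qed.

Lemma Phi_monomial b e1 e2 : Phi (kmonomial x b [:: e1; e2]) =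
  (\prod_l slotx (beta l) (slotL x (x (b l)))) *
  (keval_G (slotP x) (slot_alpha x) beta e1.1 e1.2 *
   keval_G (slotP x) (slot_alpha x) beta e2.1 e2.2).
Proof.
rewrite /kmonomial PhiM !Phi_prod !big_cons big_nil mulr1 !Phi_G; congr (_ * _).
by apply: eq_bigr => l _; rewrite Phi_pull.
Qed.

Lemma detector_edge b (e1 e2 : 'I_n * 'I_n) :
  detector (kmonomial x b [:: e1; e2]) != 0 ->
  [&& e1.1 != e1.2, beta e1.1 == beta e1.2, e2.1 != e2.2 & beta e2.1 == beta e2.2].
Proof.
rewrite /detector Phi_monomial /keval_G.
case: ifP => [/andP[-> ->]|_]; last by rewrite mul0r mulr0 mulmx0 mul0mx mxE eqxx.
by case: ifP => // _; rewrite !mulr0 mulmx0 mul0mx mxE eqxx.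
Qed.

(** [F] is the content of the slots once collapsed pullbacks are gathered. Inserting the two edge
    operators one after the other brings the product into the order of the slots, where
    [slot_prod_eval] applies. *)
Lemma detector_eval b (e1 e2 : 'I_n * 'I_n) (F : nat -> 'M[rat]_(B.+1 * 2)) :
  (forall l, exists a, homog (slotP x) a (F l)) ->
  \prod_l slotx (beta l) (slotL x (x (b l))) = \prod_(l < n) slotx l (F l) ->
  [&& e1.1 != e1.2, beta e1.1 == beta e1.2, e2.1 != e2.2 & beta e2.1 == beta e2.2] ->
  let F1 l := if l == maxn e1.1 e1.2 then F l *m slot_alpha x else F l in
  let F2 l := if l == maxn e2.1 e2.2 then F1 l *m slot_alpha x else F1 l in
  pm_eq (detector (kmonomial x b [:: e1; e2]))
        (\prod_(l < n) (slot_vac B *m F2 l *m f l) 0 0).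
Proof.
move=> hF FE /and4P[n1 b1 n2 b2] F1 F2.
rewrite /detector Phi_monomial FE /keval_G n1 b1 n2 b2 /= mulrA.
have PP := slotPP x; have hA := slot_alpha_homog x.
have lt_max (e : 'I_n * 'I_n) : (maxn e.1 e.2 < n)%N by rewrite gtn_max !ltn_ord.
have hF1 l : exists a, homog (slotP x) a (F1 l).
  have [a ha] := hF l; rewrite /F1; case: ifP => _; last by exists a.
  by exists (a (+) true); apply: homogM.
have i1 := slot_insert n PP hF hA (lt_max e1).
have i2 := slot_insert n PP hF1 hA (lt_max e2).
rewrite -(slot_prod_eval (slot_vacP x)).
have := pm_trans (pmM i1 (pm_refl (slotx (maxn e2.1 e2.2) (slot_alpha x)))) i2.
by case=> ->; [left|right]; rewrite // mulmxN mulNmx mxE.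
Qed.

Lemma detector_relabel (i j k h i' j' k' h' : 'I_n) y q (l l' : 'I_n) :
  beta l = beta l' ->
  keval_G (slotP x) (slot_alpha x) beta i j = keval_G (slotP x) (slot_alpha x) beta i' j' ->
  keval_G (slotP x) (slot_alpha x) beta k h = keval_G (slotP x) (slot_alpha x) beta k' h' ->
  detector (kpull l y * (kG X i j * kG X k h) * q) =
  detector (kpull l' y * (kG X i' j' * kG X k' h') * q).
Proof.
move=> el e1 e2; rewrite /detector !PhiM !Phi_pull !Phi_G.
by rewrite el e1 e2.
Qed.

Lemma detector_cut (i j k h : 'I_n) p q :
  beta i != beta j -> detector (p * (kG X i j * kG X k h) * q) = 0.
Proof.
move=> /negPf ne; rewrite /detector !PhiM !Phi_G /keval_G ne andbF.
by rewrite mul0r mulr0 mul0r mulmx0 mul0mx mxE.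
Qed.

End Detector.

Local Arguments slot : simpl never.

(** * Collapsing three points, or two pairs of points *)

Definition beta3 (l : nat) : nat := if (l < 3)%N then 0%N else l.

Definition beta22 (l : nat) : nat :=
  if (l < 2)%N then 0%N else if (l < 4)%N then 2%N else l.

Section Merging.

Variables (N : nat) (P : 'M[rat]_N) (A : nat -> 'M[rat]_N).
Hypothesis PP : P *m P = 1%:M.

(** The slots 1 and 2 are emptied by the collapse and hold the identity, ready to receive the edge
    operators. *)
Definition merge3 (l : nat) : 'M[rat]_N :=
  if l == 0%N then A 0%N *m A 1%N *m A 2%N else if (l < 3)%N then 1%:M else A l.

Definition merge22 (l : nat) : 'M[rat]_N :=
  if l == 0%N then A 0%N *m A 1%N else if l == 2%N then A 2%N *m A 3%N
  else if (l < 4)%N then 1%:M else A l.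

Lemma prod_beta3 r : \prod_(l < r.+3) slot P r.+3 (beta3 l) (A l) =
  \prod_(l < r.+3) slot P r.+3 l (merge3 l).
Proof.
rewrite !big_ord_recl /beta3 /merge3 /= !(slotM PP) !(slot1 PP) //.
by rewrite !mulmxE !mul1r !mulrA.
Qed.

Lemma prod_beta22 r : \prod_(l < r.+4) slot P r.+4 (beta22 l) (A l) =
  \prod_(l < r.+4) slot P r.+4 l (merge22 l).
Proof.
rewrite !big_ord_recl /beta22 /merge22 /= !(slotM PP) !(slot1 PP) //.
by rewrite !mulmxE !mul1r !mulrA.
Qed.

End Merging.

Section Detectors.

Variables (m : nat) (X : cohomology_algebra m) (B : nat) (x : ordered_basis X B).

Lemma pm_neq0 (V : zmodType) (a b : V) : pm_eq a b -> (a != 0) = (b != 0).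
Proof. by case=> ->; rewrite ?oppr_eq0. Qed.

Lemma homog_slotL a : exists e, homog (slotP x) e (slotL x (x a)).
Proof. by exists (odd (ob_deg x a)); apply/slotL_homog/ob_homog. Qed.

Lemma homog_slot1 : homog (slotP x) false 1%:M.
Proof. by rewrite /homog mulmx1 slotPP scale1r. Qed.

Lemma homog_slotM A C : (exists e, homog (slotP x) e A) -> (exists e, homog (slotP x) e C) ->
  exists e, homog (slotP x) e (A *m C).
Proof. by move=> [e1 h1] [e2 h2]; exists (e1 (+) e2); apply: (homogM (slotPP x) h1 h2). Qed.

Lemma slot_read_basis j a :
  (slot_vac B *m slotL x (x a) *m slot_read j) 0 0 = (a == j)%:R.
Proof. by rewrite slot_readL bcoord_basis. Qed.

Section Triple.

Variables (r : nat) (b0 : 'I_r.+3 -> 'I_B.+1).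

Definition ord_beta3 (l : 'I_r.+3) : 'I_r.+3 := inord (beta3 l).
Definition read3 (l : nat) : 'cV[rat]_(B.+1 * 2) :=
  if (0 < l < 3)%N then slot_read_alpha B else slot_read (b0 (inord l)).

Definition slot_of3 (b : 'I_r.+3 -> 'I_B.+1) (l : nat) := slotL x (x (b (inord l))).

Lemma ord_beta3E l : ord_beta3 l = beta3 l :> nat.
Proof. by rewrite inordK // /beta3; case: ifP. Qed.

Lemma merge3P b :
  \prod_l slot (slotP x) r.+3 (ord_beta3 l) (slotL x (x (b l))) =
  \prod_(l < r.+3) slot (slotP x) r.+3 l (merge3 (slot_of3 b) l).
Proof.
rewrite -(prod_beta3 (slot_of3 b) (slotPP x)); apply: eq_bigr => l _.
by rewrite ord_beta3E /slot_of3 inord_val.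
Qed.

Lemma homog_merge3 b l : exists a, homog (slotP x) a (merge3 (slot_of3 b) l).
Proof.
rewrite /merge3; case: ifP => _; last case: ifP => _.
- by do !apply: homog_slotM; apply: homog_slotL.
- by exists false; apply: homog_slot1.
- exact: homog_slotL.
Qed.

Lemma beta3_edge (i j : 'I_r.+3) : i != j -> ord_beta3 i == ord_beta3 j ->
  (i < 3)%N && (j < 3)%N.
Proof.
rewrite -!val_eqE /= !ord_beta3E /beta3.
by case: (ltnP i 3) => ?; case: (ltnP j 3) => ?; lia.
Qed.

Definition detector3 := detector x ord_beta3 read3.

(** Beyond the collapsed points a slot holds only the mark of its own point, so its factor in the
    entry is a Kronecker symbol comparing that mark with the one in [b0]. *)
Lemma detector3_neq0 b e1 e2 : detector3 (kmonomial x b [:: e1; e2]) != 0 ->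
  [/\ (e1.1 < 3)%N, (e1.2 < 3)%N, (e2.1 < 3)%N, (e2.2 < 3)%N &
      forall l : 'I_r.+3, (2 < l)%N -> b l = b0 l].
Proof.
move=> nz; have e := detector_edge nz; have /and4P[n1 c1 n2 c2] := e.
have /andP[l1 l2] := beta3_edge n1 c1; have /andP[l3 l4] := beta3_edge n2 c2.
split=> // l ltl; move: nz; rewrite /detector3.
rewrite (pm_neq0 (detector_eval _ (homog_merge3 b) (merge3P b) e)) => /prodf_neq0/(_ l isT).
rewrite /read3 (ltnNge l 3) ltl andbF.
have -> : (l == maxn e2.1 e2.2 :> nat) = false by apply/eqP; lia.
have -> : (l == maxn e1.1 e1.2 :> nat) = false by apply/eqP; lia.
rewrite /merge3 ltnNge ltl /= (_ : (l == 0 :> nat)%N = false); last by apply/eqP; lia.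
by rewrite /slot_of3 !inord_val slot_read_basis; case: (b l =P b0 l) => // _; rewrite /= mulr0n eqxx.
Qed.

Lemma detector3_base : b0 (inord 1) = ord0 -> b0 (inord 2) = ord0 ->
  detector3 (kmonomial x b0 [:: (inord 0, inord 1); (inord 0, inord 2)]) != 0.
Proof.
move=> b1 b2; rewrite /detector3.
have e : [&& (inord 0 : 'I_r.+3) != inord 1, ord_beta3 (inord 0) == ord_beta3 (inord 1),
   (inord 0 : 'I_r.+3) != inord 2 & ord_beta3 (inord 0) == ord_beta3 (inord 2)].
  by rewrite -!val_eqE /= !ord_beta3E !inordK.
rewrite (pm_neq0 (detector_eval (e1 := (inord 0, inord 1)) (e2 := (inord 0, inord 2))
   _ (homog_merge3 b0) (merge3P b0) e)) /= !inordK // /maxn /=.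
apply/prodf_neq0 => l _; rewrite /read3 /merge3 /slot_of3.
case: l => [[|[|[|l]]] ltl] /=.
- by rewrite b1 b2 (ob_first x) slotL1 !mulmx1 slot_read_basis eqxx oner_eq0.
- by rewrite mul1mx slot_readA oner_eq0.
- by rewrite mul1mx slot_readA oner_eq0.
- by rewrite slot_read_basis eqxx oner_eq0.
Qed.

End Triple.

Section TwoPairs.

Variables (r : nat) (b0 : 'I_r.+4 -> 'I_B.+1).

Definition ord_beta22 (l : 'I_r.+4) : 'I_r.+4 := inord (beta22 l).
Definition read22 (l : nat) : 'cV[rat]_(B.+1 * 2) :=
  if (l == 1%N) || (l == 3%N) then slot_read_alpha B else slot_read (b0 (inord l)).

Definition slot_of4 (b : 'I_r.+4 -> 'I_B.+1) (l : nat) := slotL x (x (b (inord l))).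

Lemma ord_beta22E l : ord_beta22 l = beta22 l :> nat.
Proof. by rewrite inordK // /beta22; case: ifP => // _; case: ifP. Qed.

Lemma merge22P b :
  \prod_l slot (slotP x) r.+4 (ord_beta22 l) (slotL x (x (b l))) =
  \prod_(l < r.+4) slot (slotP x) r.+4 l (merge22 (slot_of4 b) l).
Proof.
rewrite -(prod_beta22 (slot_of4 b) (slotPP x)); apply: eq_bigr => l _.
by rewrite ord_beta22E /slot_of4 inord_val.
Qed.

Lemma homog_merge22 b l : exists a, homog (slotP x) a (merge22 (slot_of4 b) l).
Proof.
rewrite /merge22; case: ifP => _; last (case: ifP => _; last case: ifP => _).
- by do !apply: homog_slotM; apply: homog_slotL.
- by do !apply: homog_slotM; apply: homog_slotL.
- by exists false; apply: homog_slot1.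
- exact: homog_slotL.
Qed.

Lemma beta22_edge (i j : 'I_r.+4) : i != j -> ord_beta22 i == ord_beta22 j ->
  (i < 2)%N && (j < 2)%N || (1 < i < 4)%N && (1 < j < 4)%N.
Proof.
rewrite -!val_eqE /= !ord_beta22E /beta22.
by case: (ltnP i 2) => ?; case: (ltnP j 2) => ?; case: (ltnP i 4) => ?;
  case: (ltnP j 4) => ?; lia.
Qed.

Definition detector22 := detector x ord_beta22 read22.

(** Slot 0 is never the larger end of an edge, so its factor is a coordinate of the product of the
    marks at 0 and 1. This last condition will tell the two pairs apart when their marks differ. *)
Lemma detector22_neq0 b e1 e2 : detector22 (kmonomial x b [:: e1; e2]) != 0 ->
  [/\ (e1.1 < 2)%N && (e1.2 < 2)%N || (1 < e1.1 < 4)%N && (1 < e1.2 < 4)%N,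
      (e2.1 < 2)%N && (e2.2 < 2)%N || (1 < e2.1 < 4)%N && (1 < e2.2 < 4)%N,
      forall l : 'I_r.+4, (3 < l)%N -> b l = b0 l
    & bcoord x (b0 (inord 0)) (x (b (inord 0)) * x (b (inord 1))) != 0].
Proof.
move=> nz; have e := detector_edge nz; have /and4P[n1 c1 n2 c2] := e.
have l1 := beta22_edge n1 c1; have l2 := beta22_edge n2 c2.
have nz_l : forall l : 'I_r.+4, l != maxn e1.1 e1.2 :> nat -> l != maxn e2.1 e2.2 :> nat ->
    (slot_vac B *m merge22 (slot_of4 b) l *m read22 l) 0 0 != 0.
  move=> l m1 m2; move: nz; rewrite /detector22.
  rewrite (pm_neq0 (detector_eval _ (homog_merge22 b) (merge22P b) e)).
  by move=> /prodf_neq0/(_ l isT); rewrite (negPf m1) (negPf m2).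
split=> // [l ltl|].
  have m1 : l != maxn e1.1 e1.2 :> nat by lia.
  have m2 : l != maxn e2.1 e2.2 :> nat by lia.
  have := nz_l l m1 m2; rewrite /merge22 /read22.
  have -> : (l == 0 :> nat)%N = false by lia.
  have -> : (l == 2 :> nat)%N = false by lia.
  have -> : (l < 4)%N = false by lia.
  have -> : (l == 1 :> nat)%N || (l == 3 :> nat)%N = false by lia.
  by rewrite /slot_of4 !inord_val slot_read_basis; case: (b l =P b0 l) => // _; rewrite /= mulr0n eqxx.
move: n1 n2; rewrite -!val_eqE /= => n1 n2.
have := nz_l ord0; rewrite /merge22 /read22 /slot_of4 /= -(slotLM x) slot_readL; apply; lia.
Qed.

Lemma detector22_base : b0 (inord 1) = ord0 -> b0 (inord 3) = ord0 ->
  detector22 (kmonomial x b0 [:: (inord 0, inord 1); (inord 2, inord 3)]) != 0.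
Proof.
move=> b1 b3; rewrite /detector22.
have e : [&& (inord 0 : 'I_r.+4) != inord 1, ord_beta22 (inord 0) == ord_beta22 (inord 1),
   (inord 2 : 'I_r.+4) != inord 3 & ord_beta22 (inord 2) == ord_beta22 (inord 3)].
  by rewrite -!val_eqE /= !ord_beta22E !inordK.
rewrite (pm_neq0 (detector_eval (e1 := (inord 0, inord 1)) (e2 := (inord 2, inord 3))
   _ (homog_merge22 b0) (merge22P b0) e)) /= !inordK // /maxn /=.
apply/prodf_neq0 => l _; rewrite /read22 /merge22 /slot_of4.
case: l => [[|[|[|[|l]]]] ltl] /=.
- by rewrite b1 (ob_first x) slotL1 !mulmx1 slot_read_basis eqxx oner_eq0.
- by rewrite mul1mx slot_readA oner_eq0.
- by rewrite b3 (ob_first x) slotL1 !mulmx1 slot_read_basis eqxx oner_eq0.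
- by rewrite mul1mx slot_readA oner_eq0.
- by rewrite slot_read_basis eqxx oner_eq0.
Qed.

End TwoPairs.

End Detectors.

(** * Signs of permutations of equal marks *)

Section SignedProducts.

Variables (R : pzRingType) (e : bool).

Definition sign_commute r (y : 'I_r -> R) :=
  forall i j, i != j -> y i * y j = (-1) ^+ e * (y j * y i).

(** The factor y j passes the j factors before it, hence the parity of j. *)
Lemma prod_move_front r (y : 'I_r.+1 -> R) (j : 'I_r.+1) : sign_commute y ->
  \prod_i y i = (-1) ^+ (e && odd j) * (y j * \prod_i y (lift j i)).
Proof.
elim: r y j => [|r IH] y j yC.
  by rewrite !ord1 big_ord_recl /= andbF mul1r.
case: (unliftP ord0 j) => [j'|] ->; last by rewrite andbF mul1r big_ord_recl.
rewrite big_ord_recl (IH (fun i => y (lift ord0 i)) j') => [|i i' ne]; last first.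
  by apply: yC; rewrite (inj_eq lift_inj).
rewrite [in RHS]big_ord_recl.
have -> : lift (lift ord0 j') ord0 = ord0 by apply: val_inj.
have -> : \prod_i y (lift (lift ord0 j') (lift ord0 i)) = \prod_i y (lift ord0 (lift j' i)).
  by apply: eq_bigr => i _; congr y; apply: val_inj; rewrite /= /bump; lia.
rewrite !mulrA [y ord0 * _]commr_sign -!mulrA [y ord0 * _]mulrA.
rewrite (yC ord0 (lift ord0 j')) ?neq_lift // !mulrA -signr_addb; congr (_ * _ * _ * _).
by rewrite lift0 /=; case: e; case: (odd j').
Qed.

(** Removing 0 from the source and its image from the target leaves a permutation of r points; this
    carries the induction on r for signs of reordered products. *)
Lemma perm_lift_perm r (s : 'S_r.+1) : exists t, s = lift_perm ord0 (s ord0) t.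
Proof.
have h k : {k' | s (lift ord0 k) = lift (s ord0) k'}.
  have ne : s ord0 != s (lift ord0 k) by rewrite (inj_eq perm_inj) neq_lift.
  by have [k' ek _] := unlift_some ne; exists k'.
pose f k := sval (h k); have fE k : s (lift ord0 k) = lift (s ord0) (f k) := svalP (h k).
have f_inj : injective f.
  move=> k k' /(congr1 (lift (s ord0))); rewrite -!fE.
  by move/perm_inj/lift_inj.
exists (perm f_inj); apply/permP=> k; case: (unliftP ord0 k) => [k'|] ->.
  by rewrite fE (lift_perm_lift ord0 (s ord0) (perm f_inj) k') permE.
by rewrite lift_perm_id.
Qed.

Lemma prod_sign_perm r (y : 'I_r -> R) (s : 'S_r) : sign_commute y ->
  \prod_i y (s i) = (-1) ^+ (e && odd_perm s) * \prod_i y i.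
Proof.
elim: r y s => [|r IH] y s yC.
  rewrite !big_ord0 mulr1 (_ : s = 1%g) ?odd_perm1 ?andbF //.
  by apply/permP => -[].
have [t ->] := perm_lift_perm s; set j := s ord0.
rewrite (prod_move_front j yC) big_ord_recl lift_perm_id.
have -> : \prod_(i < r) y (lift_perm ord0 j t (lift ord0 i)) = \prod_(i < r) y (lift j (t i)).
  by apply: eq_bigr => i _; congr y; apply: lift_perm_lift.
rewrite (IH (fun i => y (lift j i))) => [|i i' ne]; last first.
  by apply: yC; rewrite (inj_eq lift_inj).
rewrite odd_lift_perm /= !mulrA [y j * _]commr_sign -[in RHS]signr_addb.
congr (_ * _ * _); congr (_ ^+ _).
by case: e; case: (odd j); case: (odd_perm t).
Qed.

End SignedProducts.

Section SignedBlocks.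

Variables (m : nat) (X : cohomology_algebra m) (n : nat) (B : nat) (x : ordered_basis X B).
Implicit Types (hs : seq ('I_B.+1 * nat)).

Definition pull_at (l : nat) (y : X) : kriz X n.+1 := kpull (inord l) y.

Fixpoint mark_prod (o : nat) hs : kriz X n.+1 :=
  if hs is p :: hs' then
    (\prod_(i < p.2) pull_at (o + i) (x p.1)) * mark_prod (o + p.2) hs'
  else 1.

Fixpoint eps_sign hs : young_group (eps_modules x hs) -> rat :=
  match hs with
  | [::] => fun _ => 1
  | p :: hs' => fun g =>
      (-1) ^+ (odd (ob_deg x p.1) && odd_perm (g.1 : 'S_p.2)) * @eps_sign hs' g.2
  end.

Lemma affords_eps hs : affords (young_tensor (eps_modules x hs)) (@eps_sign hs).
Proof.
elim: hs => [|p hs IH] /=.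
  exists 1%:M, 1%:M; split; rewrite ?mulmx1 //.
  by move=> g; rewrite mulmx1 scale1r.
exact: (affords_xtensor (affords_Veps (ob_deg x p.1) p.2) IH).
Qed.

Lemma sign_scale k (a : kriz X n.+1) : (-1) ^+ k *: a = (-1) ^+ k * a.
Proof.
by rewrite -signr_odd -[in RHS]signr_odd; case: odd; rewrite ?scaleN1r ?mulN1r ?scale1r ?mul1r.
Qed.

(** In each block of equal marks the factors commute or anticommute according to the parity of the
    degree, so reordering them costs the sign of the permutation exactly when the degree is odd.
    Only the action of t on the positions from o on matters. *)
Lemma kact_mark_prod hs o (t : 'S_n.+1) (g : young_group (eps_modules x hs)) :
  (forall i, (i < young_size (eps_modules x hs))%N ->
     t (inord (o + i)) = inord (o + young_fun g i)) ->
  kact t (mark_prod o hs) = eps_sign g *: mark_prod o hs.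
Proof.
elim: hs o g => [|p hs IH] o g tE /=; first by rewrite kact_1 scale1r.
rewrite kactM (IH _ g.2) => [|i lti]; last first.
  rewrite -addnA tE; last by rewrite /young_size /= ltn_add2l.
  by rewrite /= insubN ?addKn ?addnA // -leqNgt leq_addr.
rewrite kact_prod -kscaleAr mulrC -scalerA; congr (_ *: _).
rewrite kscaleAl sign_scale; congr (_ * _).
pose y (i : 'I_p.2) := pull_at (o + i) (x p.1).
have yC : sign_commute (odd (ob_deg x p.1)) y.
  move=> i j _; rewrite /y /pull_at (kpullC _ _ (ob_homog x _) (ob_homog x _)).
  by rewrite sign_scale -signr_odd oddM andbb.
rewrite -(prod_sign_perm g.1 yC); apply: eq_bigr => i _.
rewrite kact_pull tE /=; last by rewrite /young_size /= ltn_addr.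
by rewrite /y /pull_at valK.
Qed.

Lemma young_size_eps hs : young_size (eps_modules x hs) = (\sum_(p <- hs) p.2)%N.
Proof. by rewrite /young_size /eps_modules -map_comp sumnE big_map. Qed.

Lemma size_marks_of hs : size (marks_of hs) = (\sum_(p <- hs) p.2)%N.
Proof.
rewrite /marks_of size_flatten /shape -map_comp sumnE big_map.
by apply: eq_bigr => p _; rewrite /= size_nseq.
Qed.

Lemma mark_prodE hs o :
  mark_prod o hs =
  \prod_(l < size (marks_of hs)) pull_at (o + l) (x (nth ord0 (marks_of hs) l)).
Proof.
elim: hs o => [|p hs IH] o /=; first by rewrite big_ord0.
rewrite [marks_of _]/(nseq p.2 p.1 ++ marks_of hs) size_cat size_nseq big_split_ord /= IH.
congr (_ * _); apply: eq_bigr => l _.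
  by rewrite nth_cat size_nseq ltn_ord nth_nseq ltn_ord.
by rewrite nth_cat size_nseq ltnNge leq_addr /= addKn addnA.
Qed.

(** A product of two generators has even degree. *)
Lemma pullGG l a (i j k h : 'I_n.+1) :
  kpull l (x a) * (kG X i j * kG X k h) = kG X i j * kG X k h * kpull l (x a).
Proof.
rewrite mulrA (kpullG _ _ _ (ob_homog x a)) -kscaleAl -mulrA.
by rewrite (kpullG _ _ _ (ob_homog x a)) -kscaleAr scalerA -expr2 sqrr_sign scale1r mulrA.
Qed.

Lemma mark_prodGG o hs (i j k h : 'I_n.+1) :
  mark_prod o hs * (kG X i j * kG X k h) = kG X i j * kG X k h * mark_prod o hs.
Proof.
rewrite mark_prodE; elim/big_rec: _ => [|l y _ IH]; first by rewrite mul1r mulr1.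
by rewrite -mulrA IH mulrA pullGG mulrA.
Qed.

End SignedBlocks.

(** * The generating monomials *)

Section Embedding.

Variables (V : sym_module) (Vs : seq sym_module) (n : nat).
Hypothesis size_n : young_size (V :: Vs) = n.+1.

Local Notation iota := (@young_embed (V :: Vs) n.+1).

Lemma young_embed_at (g : young_group (V :: Vs)) i : (i < n.+1)%N ->
  iota g (inord i) = inord (young_fun g i).
Proof.
move=> lti; have := @young_fun_lt _ g i; rewrite size_n => /(_ lti) ltf.
by apply: val_inj; rewrite /= young_embedE // !inordK.
Qed.

Lemma young_embed_inj : injective iota.
Proof.
suff inj Vs' (g h : young_group Vs') :
    (forall i, (i < young_size Vs')%N -> young_fun g i = young_fun h i) -> g = h.
  move=> g h /permP e; apply: inj => i; rewrite size_n => lti.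
  have := congr1 val (e (inord i)); rewrite /= !young_embedE // inordK //.
elim: Vs' g h => [|V' Vs' IH] g h e; first by rewrite (permS0 g) (permS0 h).
case: g h e => g1 g2 [h1 h2] e; congr pair.
  apply/permP=> i; apply: val_inj; have := e i; rewrite /= valK; apply.
  by rewrite /young_size /= ltn_addr.
apply: IH => i lti; have := e (sm_arity V' + i)%N.
rewrite /young_size /= ltn_add2l => /(_ lti).
by rewrite insubN ?addKn -?leqNgt ?leq_addr // => /addnI.
Qed.

Lemma young_fun_left (s : 'S_(sm_arity V)) (i : 'I_(sm_arity V)) :
  young_fun ((s, 1%g) : young_group (V :: Vs)) i = s i.
Proof. by rewrite /= valK. Qed.

Lemma young_fun_fixed (s : 'S_(sm_arity V)) i : (sm_arity V <= i)%N ->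
  young_fun ((s, 1%g) : young_group (V :: Vs)) i = i.
Proof. by move=> le; rewrite /= insubN -?leqNgt // young_fun1 subnKC. Qed.

Lemma young_fun_right (h : young_group Vs) i :
  young_fun ((1%g, h) : young_group (V :: Vs)) (sm_arity V + i) =
  (sm_arity V + young_fun h i)%N.
Proof. by rewrite /= insubN -?leqNgt ?leq_addr // addKn. Qed.

Lemma young_fun_right_fixed (h : young_group Vs) i : (i < sm_arity V)%N ->
  young_fun ((1%g, h) : young_group (V :: Vs)) i = i.
Proof. by move=> lti; rewrite /= insubT /= perm1. Qed.

End Embedding.

Section BaseElements.

Variables (m : nat) (X : cohomology_algebra m) (B : nat) (x : ordered_basis X B).
Variables (hs : seq ('I_B.+1 * nat)) (r : nat).
Hypothesis size_r : size (marks_of hs) = r.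

Lemma eps_sign1 : eps_sign (1%g : young_group (eps_modules x hs)) = 1.
Proof.
elim: (hs) => //= p hs' IH.
by rewrite [X in X * _](_ : _ = 1) ?mul1r // odd_perm1 andbF.
Qed.

Section Triple.

Variable h1 : 'I_B.+1.

Definition mark3 (l : 'I_r.+3) : 'I_B.+1 := nth ord0 [:: h1, ord0, ord0 & marks_of hs] l.
Definition base3 : kriz X r.+3 :=
  kmonomial x mark3 [:: (inord 0, inord 1); (inord 0, inord 2)].
Definition triple (i j k : nat) : kriz X r.+3 :=
  kpull (inord i) (x h1) * (kG X (inord i) (inord j) * kG X (inord i) (inord k))
  * mark_prod r.+2 x 3 hs.

Lemma kmonomial_mark3 (e1 e2 : 'I_r.+3 * 'I_r.+3) :
  kmonomial x mark3 [:: e1; e2] =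
  kpull (inord 0) (x h1) * (kG X e1.1 e1.2 * kG X e2.1 e2.2) * mark_prod r.+2 x 3 hs.
Proof.
rewrite /kmonomial !big_cons big_nil mulr1 /= !big_ord_recl /mark3 /=.
rewrite (ob_first x) !kpull1 !mul1r.
have -> : \prod_(l < r) kpull (lift ord0 (lift ord0 (lift ord0 l)))
    (x (nth ord0 (marks_of hs) l)) = mark_prod r.+2 x 3 hs.
  rewrite mark_prodE size_r; apply: eq_bigr => l _; rewrite /pull_at.
  have ltl := ltn_ord l; congr kpull; apply: val_inj.
  by rewrite /= inordK; rewrite /bump; lia.
rewrite -mulrA mark_prodGG mulrA.
by congr (kpull _ _ * _ * _); apply: val_inj; rewrite /= inordK.
Qed.

Lemma base3E : base3 = triple 0 1 2.
Proof. exact: kmonomial_mark3. Qed.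

Lemma kact_triple (t : 'S_r.+3) :
  (forall i, (2 < i < r.+3)%N -> t (inord i) = inord i) ->
  kact t base3 = triple (t (inord 0)) (t (inord 1)) (t (inord 2)).
Proof.
move=> fix_t; rewrite base3E /triple !kactM !kact_pull !kact_G !inord_val.
congr (_ * _); rewrite (kact_mark_prod (g := 1%g)) => [|i lti]; last first.
  rewrite young_fun1 fix_t //; move: lti; rewrite young_size_eps -size_marks_of size_r.
  by rewrite -(ltn_add2l 3) add3n.
by rewrite eps_sign1 scale1r.
Qed.

Lemma triple_swap i j k : triple i k j = - triple i j k.
Proof. by rewrite /triple kGC mulrN mulNr. Qed.

(** The edges carry the mark from one vertex to another by [kGpull], so all three terms can be given
    the same pullback; what remains is the Arnold relation. Up to sign only two of the three stars
    are needed. *)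
Lemma triple_arnold : triple 2 0 1 = triple 1 0 2 - triple 0 1 2.
Proof.
rewrite /triple -mulrBl; congr (_ * _).
have ne i j : (i < 3)%N -> (j < 3)%N -> i != j -> (inord i : 'I_r.+3) != inord j.
  by move=> li lj ij; rewrite -val_eqE /= !inordK // (leq_trans _ (leq_addr r 3)).
rewrite [kG X (inord 2) (inord 0)]kGsym [kG X (inord 2) (inord 1)]kGsym.
rewrite [kG X (inord 1) (inord 0)]kGsym.
rewrite mulrA [kpull (inord 2) _ * _]kGpull -mulrA (karnold X (ne 0 1 _ _ _) (ne 1 2 _ _ _) (ne 0 2 _ _ _))%N //.
by rewrite mulrBr; congr (_ - _); rewrite !mulrA [kpull (inord 1) _ * _]kGpull.
Qed.

Lemma triple_combination (s : 'S_3) (i := one_line s) :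
  triple (nth 0 i 0) (nth 0 i 1) (nth 0 i 2) =
  \sum_(p <- [:: 0; 1]%N) c21 p i *: (if p is 0 then triple 0 1 2 else triple 1 0 2)%N.
Proof.
rewrite {}/i !big_cons big_nil addr0; perm_cases s; rewrite /c21 /sg21 /=.
all: rewrite ?(subrr, subr0, sub0r, addr0, add0r, mulr1, mul1r, mulr0, mulrN, scale0r, scale1r, scaleN1r, opprK) //.
- by rewrite triple_arnold addrC.
- by rewrite triple_swap.
- by rewrite triple_swap.
- by rewrite triple_swap triple_arnold opprB.
Qed.

End Triple.

Section TwoPairs.

Variables h1 h2 : 'I_B.+1.

Definition mark22 (l : 'I_r.+4) : 'I_B.+1 :=
  nth ord0 [:: h1, ord0, h2, ord0 & marks_of hs] l.
Definition base22 : kriz X r.+4 :=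
  kmonomial x mark22 [:: (inord 0, inord 1); (inord 2, inord 3)].
Definition two_pairs (i j k l : nat) : kriz X r.+4 :=
  kpull (inord i) (x h1) * kpull (inord k) (x h2) *
  (kG X (inord i) (inord j) * kG X (inord k) (inord l)) * mark_prod r.+3 x 4 hs.

Lemma base22E : base22 = two_pairs 0 1 2 3.
Proof.
rewrite /base22 /kmonomial !big_cons big_nil mulr1 /= !big_ord_recl /mark22 /=.
rewrite (ob_first x) !kpull1 !mul1r.
have -> : \prod_(l < r) kpull (lift ord0 (lift ord0 (lift ord0 (lift ord0 l))))
    (x (nth ord0 (marks_of hs) l)) = mark_prod r.+3 x 4 hs.
  rewrite mark_prodE size_r; apply: eq_bigr => l _; rewrite /pull_at.
  have ltl := ltn_ord l; congr kpull; apply: val_inj.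
  by rewrite /= inordK; rewrite /bump; lia.
rewrite /two_pairs -!mulrA mark_prodGG !mulrA.
by congr (kpull _ _ * kpull _ _ * _ * _ * _); apply: val_inj; rewrite /= inordK.
Qed.

Lemma kact_two_pairs (t : 'S_r.+4) :
  (forall i, (3 < i < r.+4)%N -> t (inord i) = inord i) ->
  kact t base22 =
  two_pairs (t (inord 0)) (t (inord 1)) (t (inord 2)) (t (inord 3)).
Proof.
move=> fix_t; rewrite base22E /two_pairs !kactM !kact_pull !kact_G !inord_val.
congr (_ * _); rewrite (kact_mark_prod (g := 1%g)) => [|i lti]; last first.
  rewrite young_fun1 fix_t //; move: lti; rewrite young_size_eps -size_marks_of size_r.
  by rewrite -(ltn_add2l 4) add4n.
by rewrite eps_sign1 scale1r.
Qed.

Lemma two_pairs_sym1 i j k l : two_pairs j i k l = two_pairs i j k l.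
Proof.
rewrite /two_pairs; congr (_ * _); rewrite !mulrA; congr (_ * _).
rewrite [kG X (inord j) (inord i)]kGsym.
rewrite !(kpullC _ _ (ob_homog x h1) (ob_homog x h2)) -!kscaleAl; congr (_ *: _).
by rewrite -!mulrA kGpull.
Qed.

Lemma two_pairs_sym2 i j k l : two_pairs i j l k = two_pairs i j k l.
Proof.
rewrite /two_pairs; congr (_ * _); rewrite -!mulrA; congr (_ * _).
rewrite [kG X (inord l) (inord k)]kGsym !mulrA.
rewrite !(kpullG _ _ _ (ob_homog x h2)) -!kscaleAl; congr (_ *: _).
by rewrite -!mulrA kGpull.
Qed.

End TwoPairs.

(** One sign comes from the anticommuting generators, the other from the two equal marks; the
    product is the [eta] of [matching]. *)
Lemma two_pairs_swap h i j k l :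
  two_pairs h h k l i j = - (-1) ^+ ob_deg x h *: two_pairs h h i j k l.
Proof.
rewrite /two_pairs kGC (kpullC _ _ (ob_homog x h) (ob_homog x h)).
rewrite mulrN mulNr -!kscaleAl scaleNr; congr (- (_ *: _)).
by rewrite -signr_odd oddM andbb signr_odd.
Qed.

Definition rest4 (p : nat * nat) : seq nat :=
  [seq i <- iota 0 4 | (i != p.1) && (i != p.2)].

Definition pair_element h1 h2 (p : nat * nat) : kriz X r.+4 :=
  two_pairs h1 h2 p.1 p.2 (nth 0 (rest4 p) 0)%N (nth 0 (rest4 p) 1)%N.

Lemma two_pairs_combination h1 h2 (s : 'S_4) (i := one_line s) :
  two_pairs h1 h2 (nth 0 i 0) (nth 0 i 1) (nth 0 i 2) (nth 0 i 3) =
  \sum_(p <- pairs4) pair_at p.1 p.2 i *: pair_element h1 h2 p.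
Proof.
rewrite {}/i !big_cons big_nil; perm_cases s; rewrite /pair_at /pair_element /=.
all: rewrite ?scale0r ?scale1r ?addr0 ?add0r ?addr0 //.
all: first [by rewrite two_pairs_sym1 | by rewrite two_pairs_sym2
  | by rewrite two_pairs_sym1 two_pairs_sym2].
Qed.

Lemma matching_combination h (s : 'S_4) (i := one_line s) :
  two_pairs h h (nth 0 i 0) (nth 0 i 1) (nth 0 i 2) (nth 0 i 3) =
  \sum_(p <- matchings) matching (- (-1) ^+ ob_deg x h) p i *: pair_element h h p.
Proof.
rewrite {}/i !big_cons big_nil; perm_cases s; rewrite /matching /pair_at /pair_element /=.
all: rewrite ?(mulr0, mulr1) ?(addr0, add0r) ?scale0r ?scale1r ?(addr0, add0r) //.
all: rewrite -?two_pairs_swap.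
all: first [by rewrite two_pairs_sym1 | by rewrite two_pairs_sym2
  | by rewrite two_pairs_sym1 two_pairs_sym2].
Qed.

End BaseElements.

(** * The span of a generating monomial *)

Lemma perm_stable (T : finType) (g : {perm T}) (A : {set T}) :
  (forall i, i \in A -> g i \in A) -> forall i, (g i \in A) = (i \in A).
Proof.
move=> gA i; have gAA : g @: A = A.
  apply/eqP; rewrite eqEcard card_imset ?leqnn ?andbT; last exact: perm_inj.
  by apply/subsetP=> _ /imsetP[j jA ->]; apply: gA.
by rewrite -{1}gAA mem_imset //; apply: perm_inj.
Qed.

(** The blocks are split off one at a time: a map that preserves block indices restricts to the
    first block and, after a shift, to the remaining points. *)
Lemma young_fun_ex Vs (phi : nat -> nat) :
  (forall i, (i < young_size Vs)%N -> (phi i < young_size Vs)%N) ->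
  (forall i j, (i < young_size Vs)%N -> (j < young_size Vs)%N -> phi i = phi j -> i = j) ->
  (forall i, (i < young_size Vs)%N ->
     reshape_index [seq sm_arity V | V <- Vs] (phi i) =
     reshape_index [seq sm_arity V | V <- Vs] i) ->
  exists y : young_group Vs, forall i, (i < young_size Vs)%N -> young_fun y i = phi i.
Proof.
elim: Vs phi => [|V Vs IH] phi lt_phi phi_inj phiE; first by exists 1%g.
set k := sm_arity V; have szE : young_size (V :: Vs) = (k + young_size Vs)%N by [].
have phi_lt i : (i < k + young_size Vs)%N -> (phi i < k)%N = (i < k)%N.
  by move=> /phiE; rewrite /= !reshape_index_cons; case: ltnP => _; case: ltnP.
have lt_k (i : 'I_k) : (i < k + young_size Vs)%N by rewrite ltn_addr.
have lt1 (i : 'I_k) : (phi i < k)%N by rewrite phi_lt.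
have s_inj : injective (fun i => Ordinal (lt1 i)).
  by move=> i j /(congr1 val) /= /(phi_inj _ _ (lt_k i) (lt_k j)) /val_inj.
have ge_k i : (i < young_size Vs)%N -> (k <= phi (k + i))%N.
  by move=> lti; rewrite leqNgt phi_lt ?ltn_add2l // ltnNge leq_addr.
have [||| y yE] := IH (fun i => phi (k + i) - k)%N.
- move=> i lti; rewrite ltn_subLR ?ge_k //; apply: lt_phi.
  by rewrite szE ltn_add2l.
- move=> i j lti ltj e; apply/(@addnI k)/phi_inj; rewrite ?szE ?ltn_add2l //.
  by rewrite -[LHS](subnKC (ge_k i lti)) e (subnKC (ge_k j ltj)).
- move=> i lti; have := phiE (k + i)%N; rewrite szE ltn_add2l => /(_ lti).
  rewrite /= !reshape_index_cons [(k + i < _)%N]ltnNge leq_addr /= addKn.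
  by rewrite ltnNge ge_k //= => -[].
exists (perm s_inj, y) => i; rewrite szE => lti /=.
case: insubP => [j _ <-|]; first by rewrite permE.
rewrite -leqNgt => leki; have lti' : (i - k < young_size Vs)%N by rewrite ltn_subLR.
have := ge_k _ lti'; rewrite subnKC // => ge; by rewrite yE // (subnKC leki) subnKC.
Qed.

Lemma young_embed_ex Vs n (g : 'S_n.+1) :
  young_size Vs = n.+1 ->
  (forall i : 'I_n.+1, reshape_index [seq sm_arity V | V <- Vs] (g i) =
     reshape_index [seq sm_arity V | V <- Vs] i) ->
  exists y : young_group Vs, g = young_embed n.+1 y.
Proof.
move=> sz gE; have [||| y yE] := @young_fun_ex Vs (fun i => g (inord i)).
- by move=> i lti; rewrite [X in (_ < X)%N]sz.
- move=> i j; rewrite sz => lti ltj /val_inj/perm_inj/(congr1 val).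
  by rewrite /= !inordK.
- by move=> i; rewrite sz => lti; rewrite gE inordK.
exists y; apply/permP=> i; apply: val_inj.
by rewrite /= young_embedE // yE ?sz // inord_val.
Qed.

Section Marks.

Variable (B : nat).
Implicit Types (hs : seq ('I_B.+1 * nat)).

Lemma mult_list_cons p hs : mult_list (p :: hs) ->
  mult_list hs /\ forall a, a \in marks_of hs -> (a < p.1)%N.
Proof.
rewrite /mult_list /= => /andP[ps /andP[_ ps_gt0]].
rewrite (path_sorted ps) ps_gt0; split=> // a /flattenP[_ /mapP[q qhs ->]].
rewrite mem_nseq => /andP[_ /eqP->].
have tr : transitive (fun p q : 'I_B.+1 * nat => q.1 < p.1)%N.
  by move=> p1 p2 p3 h21 h13; apply: ltn_trans h13 h21.
by have /allP/(_ _ qhs) := order_path_min tr ps.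
Qed.

Lemma marks_of_cons p hs : marks_of (p :: hs) = nseq p.2 p.1 ++ marks_of hs.
Proof. by []. Qed.

(** The marks decrease strictly from one block to the next, so equal marks lie in the same block. A
    permutation that preserves marks therefore preserves the blocks. *)
Lemma marks_reshape_index hs i j : mult_list hs ->
  (i < size (marks_of hs))%N -> (j < size (marks_of hs))%N ->
  nth ord0 (marks_of hs) i = nth ord0 (marks_of hs) j ->
  reshape_index [seq p.2 | p <- hs] i = reshape_index [seq p.2 | p <- hs] j.
Proof.
elim: hs i j => // p hs IH i j /mult_list_cons[hs_ok lt_p].
rewrite marks_of_cons size_cat size_nseq !nth_cat !size_nseq /= !reshape_index_cons.
case: (ltnP i p.2) => [ltip|leip]; case: (ltnP j p.2) => [ltjp|lejp] // lti ltj.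
- rewrite nth_nseq ltip => e; have := lt_p p.1; rewrite {1}e mem_nth ?ltn_subLR //.
  by rewrite ltnn => /(_ isT).
- rewrite nth_nseq ltjp => e; have := lt_p p.1; rewrite -{1}e mem_nth ?ltn_subLR //.
  by rewrite ltnn => /(_ isT).
by move=> e; congr _.+1; apply: IH; rewrite ?ltn_subLR.
Qed.

End Marks.

Definition kspan m (X : cohomology_algebra m) n (mu b : kriz X n) : Prop :=
  exists c : 'S_n -> rat, b = \sum_y c y *: kact y mu.

Lemma kact_linear m (X : cohomology_algebra m) n (s : 'S_n) :
  linear (kact s : kriz X n -> kriz X n).
Proof. by move=> c a b; rewrite kactD kactZ. Qed.

(** The values of D on the translates by S_k are written as a multiple of a function of lists, so
    that separation becomes a statement about S_k alone. In the applications [d] is D mu. *)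
Lemma young_block_iso m (X : cohomology_algebra m) n k
    (U : representation rat [set: 'S_k]) (J : 'S_k -> 'cV[rat]_(rdegree U))
    (Vs : seq sym_module) (eps : young_group Vs -> rat) (mu : kriz X n.+1)
    (D : kriz X n.+1 -> rat) (d : rat) (g : seq nat -> rat)
    (iota := @young_embed (SymModule U :: Vs) n.+1) :
  young_size (SymModule U :: Vs) = n.+1 ->
  (forall s t, U t *m J s = J (s * t^-1)%g) ->
  affords (young_tensor Vs) eps ->
  (forall h, kact (iota (1%g, h)) mu = eps h *: mu) ->
  scalar D ->
  (forall y, D (kact y mu) != 0 -> exists h, y = iota h) ->
  (forall s, D (kact (iota (s, 1%g)) mu) = d * g (one_line s)) -> d != 0 ->
  separates J g ->
  (exists u : 'rV[rat]_(rdegree U),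
     \sum_s (u *m J s) 0 0 *: kact (iota (s, 1%g)) mu = mu) ->
  iso_block (kspan mu) (young_ind n.+1 (SymModule U :: Vs)).
Proof.
move=> sz JM E_eps mu_eps D_lin D_in DE d0 J_sep mu_cyc.
have iotaM : {morph iota : y z / (y * z)%g} by move=> y z; apply: young_embedM.
have D_out y : (forall h, y <> iota h) -> D (kact y mu) = 0.
  by move=> yH; apply/eqP; apply: contraT => /D_in[h /yH].
have D_sep (u : 'rV[rat]_(rdegree U)) :
    (forall t, \sum_s (u *m J s) 0 0 * D (kact (iota (s * t, 1))%g mu) = 0) -> u = 0.
  move=> u0; apply: J_sep => t; apply: (mulfI d0); rewrite mulr0 -[RHS](u0 t).
  by rewrite mulr_sumr; apply: eq_bigr => s _; rewrite DE mulrCA.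
have [phi [phi_inj phi_im phiM]] := cyclic_block_iso iotaM (young_embed_inj sz)
  (@kact_linear _ X n.+1) (@kactMperm _ X n.+1) JM E_eps mu_eps D_lin D_out D_sep mu_cyc.
by exists phi; split=> // b; split=> [/phi_im|/phi_im].
Qed.

(** * The orbit span for one component with three vertices *)

Section Blocks.

Variables (m : nat) (X : cohomology_algebra m) (B : nat) (x : ordered_basis X B).
Variables (hs : seq ('I_B.+1 * nat)) (r : nat).
Hypothesis hs_ok : mult_list hs.
Hypothesis size_r : size (marks_of hs) = r.

Lemma reshape_stable (T : finType) (g : {perm T}) (P : pred T) :
  (forall i, P i -> P (g i)) -> forall i, P (g i) = P i.
Proof.
move=> gP i; have := @perm_stable T g [set i | P i] _ i; rewrite !inE; apply=> j.
by rewrite !inE; apply: gP.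
Qed.

Section Triple.

Variable h1 : 'I_B.+1.
Local Notation D := (detector3 x (@mark3 B hs r h1)).
Local Notation mu := (base3 x hs r h1).
Local Notation Vs := (SymModule (specht 3 [:: 2; 1]%N) :: eps_modules x hs).

Lemma detector3_scalar : scalar D.
Proof. exact: detector_scalar. Qed.

Lemma size3 : young_size Vs = r.+3.
Proof. by rewrite -size_r size_marks_of -(young_size_eps x). Qed.

(** If D does not vanish, g keeps both edges among the first three points, hence preserves these; on
    the other points it preserves the marks, hence the blocks of equal marks. *)
Lemma detector3_in g : D (kact g mu) != 0 -> exists y, g = @young_embed Vs r.+3 y.
Proof.
move=> nz; have {nz} : D (kmonomial x (@mark3 B hs r h1 \o g^-1)%g
    (ren_edges g [:: (inord 0, inord 1); (inord 0, inord 2)])) != 0.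
  apply: contra nz => /eqP e; apply/eqP; apply: detector_pm e.
  exact/pm_sym/pm_kact_monomial.
case/detector3_neq0 => /= l0 l1 _ l2 mE.
have stab i : (g i < 3)%N = (i < 3)%N.
  apply: (reshape_stable (P := fun j : 'I_r.+3 => j < 3)%N) => {i} -[[|[|[|i]]] lti] // _.
  - by move: l0; congr (nat_of_ord (g _) < 3)%N; apply: val_inj; rewrite /= inordK.
  - by move: l1; congr (nat_of_ord (g _) < 3)%N; apply: val_inj; rewrite /= inordK.
  - by move: l2; congr (nat_of_ord (g _) < 3)%N; apply: val_inj; rewrite /= inordK.
apply: young_embed_ex size3 _ => i; rewrite /= -map_comp.
rewrite !reshape_index_cons stab; case: ltnP => // le3i; congr _.+1.
have le3g : (2 < g i)%N by rewrite ltnNge -ltnS stab -leqNgt.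
apply: (marks_reshape_index hs_ok); rewrite ?size_r ?ltn_subLR //.
have := mE (g i) le3g; rewrite /= permK /mark3.
move: (nat_of_ord (g i)) (nat_of_ord i) le3g le3i => a b.
by case: a => [|[|[|a]]] //; case: b => [|[|[|b]]] //= _ _ e;
  rewrite !subSS !subn0 e.
Qed.

Local Notation iota := (@young_embed Vs r.+3).

Lemma kact_embed3 (s : 'S_3) (l := one_line s) :
  kact (iota (s, 1%g)) mu = triple x hs r h1 (nth 0 l 0) (nth 0 l 1) (nth 0 l 2).
Proof.
rewrite (kact_triple x size_r) => [|i /andP[lei lti]]; last first.
  by rewrite (young_embed_at size3) // young_fun_fixed.
rewrite /l (nth_one_line s (Ordinal (isT : 0 < 3)%N)).
rewrite (nth_one_line s (Ordinal (isT : 1 < 3)%N)) (nth_one_line s (Ordinal (isT : 2 < 3)%N)).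
have iE (i : 'I_3) : iota (s, 1%g) (inord i) = s i :> nat.
  by rewrite (young_embed_at size3) ?young_fun_left ?inordK // (leq_trans (ltn_ord _)).
by rewrite -(iE (Ordinal (isT : 0 < 3)%N)) -(iE (Ordinal (isT : 1 < 3)%N))
   -(iE (Ordinal (isT : 2 < 3)%N)).
Qed.

Lemma kact_eps3 h : kact (iota (1%g, h)) mu = eps_sign h *: mu.
Proof.
have fix_iota i : (i < 3)%N -> iota (1%g, h) (inord i) = inord i.
  move=> lti; rewrite (young_embed_at size3) ?young_fun_right_fixed //.
  exact: leq_trans lti _.
rewrite (base3E x size_r) /triple !kactM kact_pull !kact_G !fix_iota //.
rewrite (kact_mark_prod (g := h)) => [|i lti]; first by rewrite -kscaleAr.
by rewrite (young_embed_at size3) ?young_fun_right // -size3 /young_size /= ltn_add2l.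
Qed.

(** The collapse identifies the centres 0 and 1, and the larger ends of the edges are 1 and 2 in
    both trees. *)
Lemma detector3_triple102 : D (triple x hs r h1 1 0 2) = D mu.
Proof.
rewrite (base3E x size_r) /triple; apply: detector_relabel.
- by apply: val_inj; rewrite /= !ord_beta3E !inordK.
- by rewrite /keval_G -!val_eqE /= !ord_beta3E !inordK.
- by rewrite /keval_G -!val_eqE /= !ord_beta3E !inordK.
Qed.

Lemma kspan3_iso : iso_block (kspan mu) (young_ind r.+3 Vs).
Proof.
have Dl : linear (D : kriz X r.+3 -> rat^o) := detector3_scalar.
have actE s : kact (iota (s, 1%g)) mu = \sum_(p <- [:: 0; 1]%N) c21 p (one_line s) *:
    (if p is 0 then triple x hs r h1 0 1 2 else triple x hs r h1 1 0 2)%N.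
  by rewrite kact_embed3 triple_combination.
apply: (young_block_iso (D := D) (d := D mu) size3 _ (affords_eps x hs) kact_eps3
  detector3_scalar detector3_in _ _ separates21).
- exact: specht_coefM.
- move=> s; rewrite actE !big_cons big_nil addr0 (lin_add Dl) !(lin_scale Dl).
  rewrite /= detector3_triple102 -(base3E x size_r) -scalerDl.
  exact: mulrC.
- by apply: detector3_base; rewrite /mark3 inordK.
- have [u uE] := generates21 actE; exists u; rewrite uE.
  by rewrite (base3E x size_r).
Qed.

End Triple.
End Blocks.

(** * The orbit span for two components with two vertices *)

Section TwoPairs.

Variables (m : nat) (X : cohomology_algebra m) (B : nat) (x : ordered_basis X B).
Variables (hs : seq ('I_B.+1 * nat)) (r : nat).
Hypothesis hs_ok : mult_list hs.
Hypothesis size_r : size (marks_of hs) = r.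
Variables h1 h2 : 'I_B.+1.

Local Notation mark := (@mark22 B hs r h1 h2).
Local Notation D := (detector22 x mark).
Local Notation mu := (base22 x hs r h1 h2).

Lemma detector22_scalar : scalar D.
Proof. exact: detector_scalar. Qed.

Lemma detector22_out g : D (kact g mu) != 0 ->
  [/\ (g (inord 0) < 2)%N && (g (inord 1) < 2)%N ||
        (1 < g (inord 0) < 4)%N && (1 < g (inord 1) < 4)%N,
      (g (inord 2) < 2)%N && (g (inord 3) < 2)%N ||
        (1 < g (inord 2) < 4)%N && (1 < g (inord 3) < 4)%N,
      forall l : 'I_r.+4, (3 < l)%N -> mark (g^-1 l)%g = mark l
    & bcoord x (mark (inord 0))
        (x (mark (g^-1 (inord 0))%g) * x (mark (g^-1 (inord 1))%g)) != 0].
Proof.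
move=> nz; have {nz} : D (kmonomial x (mark \o g^-1)%g
    (ren_edges g [:: (inord 0, inord 1); (inord 2, inord 3)])) != 0.
  apply: contra nz => /eqP e; apply/eqP; apply: detector_pm e.
  exact/pm_sym/pm_kact_monomial.
by case/detector22_neq0.
Qed.

Lemma detector22_stable4 g : D (kact g mu) != 0 -> forall i, (g i < 4)%N = (i < 4)%N.
Proof.
case/detector22_out => l01 l23 _ _ i.
have lt4 j : (j < 4)%N -> (g (inord j) < 4)%N.
  by case: j => [|[|[|[|j]]]] // _; lia.
apply: (reshape_stable (P := fun j : 'I_r.+4 => j < 4)%N) => {i} i lti.
by have := lt4 i lti; rewrite inord_val.
Qed.

Lemma detector22_marks g : D (kact g mu) != 0 -> forall i : 'I_r.+4, (4 <= i)%N ->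
  reshape_index [seq p.2 | p <- hs] (g i - 4) = reshape_index [seq p.2 | p <- hs] (i - 4).
Proof.
move=> nz i le4i; have [_ _ mE _] := detector22_out nz.
have le4g : (3 < g i)%N by rewrite ltnNge -ltnS (detector22_stable4 nz) -leqNgt.
apply: (marks_reshape_index hs_ok); rewrite ?size_r ?ltn_subLR //.
have := mE (g i) le4g; rewrite /= permK /mark22.
move: (nat_of_ord (g i)) (nat_of_ord i) le4g le4i => a b.
by case: a => [|[|[|[|a]]]] //; case: b => [|[|[|[|b]]]] //= _ _ e;
  rewrite !subSS !subn0 e.
Qed.

(** If g exchanged the pairs, slot 0 would hold x_(h2) times 1 (or a square of these with itself
    excluded by injectivity), whose coordinate on x_(h1) is zero. *)
Lemma detector22_stable2 g : h1 != h2 -> D (kact g mu) != 0 ->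
  forall i, (g i < 2)%N = (i < 2)%N.
Proof.
move=> ne12 nz; have stab4 := detector22_stable4 nz.
have [l01 l23 _ bnz] := detector22_out nz.
suff lt2 : (g (inord 0) < 2)%N && (g (inord 1) < 2)%N.
  move=> i; apply: (reshape_stable (P := fun j : 'I_r.+4 => j < 2)%N) => {i} -[[|[|i]] lti] // _.
  - by case/andP: lt2 => + _; congr (nat_of_ord (g _) < 2)%N; apply: val_inj; rewrite /= inordK.
  - by case/andP: lt2 => _; congr (nat_of_ord (g _) < 2)%N; apply: val_inj; rewrite /= inordK.
case/orP: l01 => // /andP[lt0 lt1]; case/negP: bnz.
have back j : (j < 2)%N -> (g^-1 (inord j))%g = inord 2 \/ (g^-1 (inord j))%g = inord 3.
  move=> ltj; set i := (g^-1 (inord j))%g.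
  have gi : g i = j :> nat by rewrite permKV inordK // (leq_trans ltj).
  have lti : (i < 4)%N by rewrite -stab4 gi (leq_trans ltj).
  have := inord_val i; case: (nat_of_ord i) lti => [|[|[|[|k]]]] // _ iE.
  - by move: lt0; rewrite iE gi; lia.
  - by move: lt1; rewrite iE gi; lia.
  - by left.
  - by right.
have m2 : mark (inord 2) = h2 by rewrite /mark22 inordK.
have m3 : mark (inord 3) = ord0 by rewrite /mark22 inordK.
have m0 : mark (inord 0) = h1 by rewrite /mark22 inordK.
have ne01 : (g^-1 (inord 0))%g != (g^-1 (inord 1))%g :> 'I_r.+4.
  by rewrite (inj_eq perm_inj) -val_eqE /= !inordK.
have ne21 : (h2 == h1) = false by rewrite eq_sym; apply: negPf.
rewrite m0; move: ne01; have [->|->] := back 0%N isT; have [->|->] := back 1%N isT;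
  rewrite ?eqxx ?m2 ?m3 ?(ob_first x) ?mul1r ?mulr1 ?bcoord_basis // => _;
  by rewrite ne21.
Qed.

Lemma detector22_in4 (U : representation rat [set: 'S_4])
    (Vs := SymModule U :: eps_modules x hs) g :
  D (kact g mu) != 0 -> exists y, g = @young_embed Vs r.+4 y.
Proof.
move=> nz; apply: young_embed_ex => [|i].
  by rewrite -size_r size_marks_of -(young_size_eps x).
rewrite /= -map_comp !reshape_index_cons (detector22_stable4 nz).
by case: ltnP => // le4i; congr _.+1; apply: (detector22_marks nz).
Qed.

Lemma detector22_in2 (U V : representation rat [set: 'S_2])
    (Vs := [:: SymModule U, SymModule V & eps_modules x hs]) g :
  h1 != h2 -> D (kact g mu) != 0 -> exists y, g = @young_embed Vs r.+4 y.
Proof.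
move=> ne12 nz; apply: young_embed_ex => [|i].
  by rewrite -size_r size_marks_of -(young_size_eps x).
rewrite /= -map_comp !reshape_index_cons (detector22_stable2 ne12 nz).
case: ltnP => // le2i; congr _.+1.
have stab4 := detector22_stable4 nz i.
have le2g : (1 < g i)%N by rewrite ltnNge -ltnS (detector22_stable2 ne12 nz) -leqNgt.
have -> : (g i - 2 < 2)%N = (i - 2 < 2)%N by rewrite !ltn_subLR.
case: ltnP => // le4i; congr _.+1; rewrite -!subnDA.
by apply: (detector22_marks nz); rewrite leq_subRL in le4i.
Qed.

Lemma detector22_pair_element p : p \in [:: (0, 2); (0, 3); (1, 2); (1, 3)]%N ->
  D (pair_element x hs r h1 h2 p) = 0.
Proof.
rewrite !inE => pE; apply: detector_cut; rewrite -val_eqE /= !ord_beta22E.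
by case/or4P: pE => /eqP->; rewrite /= !inordK.
Qed.

(** The element is the translate of the generator by a permutation exchanging {0, 1} and {2, 3},
    which [detector22_stable2] excludes. *)
Lemma detector22_pair23 : h1 != h2 -> D (pair_element x hs r h1 h2 (2, 3)%N) = 0.
Proof.
move=> ne12; pose t : 'S_r.+4 := (tperm (inord 0) (inord 2) * tperm (inord 1) (inord 3))%g.
have ne i j : (i < 4)%N -> (j < 4)%N -> i != j -> (inord i : 'I_r.+4) != inord j.
  by move=> li lj ij; rewrite -val_eqE /= !inordK // (leq_trans _ (leq_addr r 4)).
have t0 : t (inord 0) = inord 2.
  by rewrite permM tpermL tpermD ?ne.
have t1 : t (inord 1) = inord 3.
  by rewrite permM [tperm _ _ (inord 1)]tpermD ?ne // tpermL.
have t2 : t (inord 2) = inord 0.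
  by rewrite permM tpermR tpermD ?ne.
have t3 : t (inord 3) = inord 1.
  by rewrite permM [tperm (inord 0) _ _]tpermD ?ne // tpermR.
have -> : pair_element x hs r h1 h2 (2, 3)%N = kact t mu.
  rewrite (kact_two_pairs x size_r) => [|i /andP[le4i lti]]; last first.
    by rewrite permM !tpermD // -val_eqE /= !inordK //; lia.
  by rewrite t0 t1 t2 t3 !inordK.
apply/eqP; apply: contraT => /(detector22_stable2 ne12)/(_ (inord 0)).
by rewrite t0 !inordK.
Qed.

Lemma kact_eps22 (U : representation rat [set: 'S_4])
    (Vs := SymModule U :: eps_modules x hs) h :
  kact (@young_embed Vs r.+4 (1%g, h)) mu = eps_sign h *: mu.
Proof.
have sz : young_size Vs = r.+4.
  by rewrite -size_r size_marks_of -(young_size_eps x).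
have fix_iota i : (i < 4)%N -> @young_embed Vs r.+4 (1%g, h) (inord i) = inord i.
  move=> lti; rewrite (young_embed_at sz) ?young_fun_right_fixed //.
  exact: leq_trans lti _.
rewrite (base22E x size_r) /two_pairs !kactM !kact_pull !kact_G !fix_iota //.
rewrite (kact_mark_prod (g := h)) => [|i lti]; first by rewrite -kscaleAr.
by rewrite (young_embed_at sz) ?young_fun_right // -sz /young_size /= ltn_add2l.
Qed.

Lemma kact_embed22 (U : representation rat [set: 'S_4])
    (Vs := SymModule U :: eps_modules x hs) (s : 'S_4) (l := one_line s) :
  kact (@young_embed Vs r.+4 (s, 1%g)) mu =
  two_pairs x hs r h1 h2 (nth 0 l 0) (nth 0 l 1) (nth 0 l 2) (nth 0 l 3).
Proof.
have sz : young_size Vs = r.+4.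
  by rewrite -size_r size_marks_of -(young_size_eps x).
rewrite (kact_two_pairs x size_r) => [|i /andP[lei lti]]; last first.
  by rewrite (young_embed_at sz) // young_fun_fixed.
have iE (i : 'I_4) : @young_embed Vs r.+4 (s, 1%g) (inord i) = nth 0%N l i :> nat.
  rewrite (young_embed_at sz) ?young_fun_left ?inordK // ?(leq_trans (ltn_ord _)) //.
  by rewrite /l nth_one_line.
by rewrite -(iE (Ordinal (isT : 0 < 4)%N)) -(iE (Ordinal (isT : 1 < 4)%N))
   -(iE (Ordinal (isT : 2 < 4)%N)) -(iE (Ordinal (isT : 3 < 4)%N)).
Qed.

End TwoPairs.

Section TwoPairs.

Variables (m : nat) (X : cohomology_algebra m) (B : nat) (x : ordered_basis X B).
Variables (hs : seq ('I_B.+1 * nat)) (r : nat).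
Hypothesis hs_ok : mult_list hs.
Hypothesis size_r : size (marks_of hs) = r.

Lemma young_size4 (U : representation rat [set: 'S_4]) :
  young_size (SymModule U :: eps_modules x hs) = r.+4.
Proof. by rewrite -size_r size_marks_of -(young_size_eps x). Qed.

Lemma pair_element_base h1 h2 : pair_element x hs r h1 h2 (0, 1)%N = base22 x hs r h1 h2.
Proof. by rewrite (base22E x size_r). Qed.

Lemma detector22_mu h1 h2 : detector22 x (@mark22 B hs r h1 h2) (base22 x hs r h1 h2) != 0.
Proof. by apply: detector22_base; rewrite /mark22 inordK. Qed.

Lemma kspan22_same_iso h (U : representation rat [set: 'S_4]) J
    (eta := - (-1) ^+ ob_deg x h) :
  (forall s t, U t *m J s = J (s * t^-1)%g) ->
  separates J (matching eta (0, 1)%N) ->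
  generates J matchings (matching eta) (0, 1)%N ->
  iso_block (kspan (base22 x hs r h h)) (young_ind r.+4 (SymModule U :: eps_modules x hs)).
Proof.
move=> JM Jsep Jgen.
have Dl : linear (detector22 x (@mark22 B hs r h h) : kriz X r.+4 -> rat^o).
  exact: detector22_scalar.
have actE (s : 'S_4) : kact (@young_embed (SymModule U :: eps_modules x hs) r.+4 (s, 1%g))
    (base22 x hs r h h) =
    \sum_(p <- matchings) matching eta p (one_line s) *: pair_element x hs r h h p.
  by rewrite kact_embed22 // matching_combination.
apply: (young_block_iso (D := detector22 x (@mark22 B hs r h h)) (young_size4 U) JM
  (affords_eps x hs) (@kact_eps22 _ _ _ x hs r size_r h h U) (@detector22_scalar _ _ _ _ _ _ _ _)
  (@detector22_in4 _ _ _ x hs r hs_ok size_r h h U) _ (detector22_mu h h) Jsep).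
  move=> s; rewrite actE !big_cons big_nil addr0 !(lin_add Dl) !(lin_scale Dl).
  rewrite pair_element_base !detector22_pair_element //.
  rewrite !scaler0 !addr0; exact: mulrC.
by have [u uE] := Jgen _ _ _ actE; exists u; rewrite uE pair_element_base.
Qed.

Lemma kspan22_diff_iso h1 h2 (U : representation rat [set: 'S_4]) J : h1 != h2 ->
  (forall s t, U t *m J s = J (s * t^-1)%g) ->
  separates J (pair_at 0 1) ->
  generates J pairs4 (fun p => pair_at p.1 p.2) (0, 1)%N ->
  iso_block (kspan (base22 x hs r h1 h2)) (young_ind r.+4 (SymModule U :: eps_modules x hs)).
Proof.
move=> ne12 JM Jsep Jgen.
have Dl : linear (detector22 x (@mark22 B hs r h1 h2) : kriz X r.+4 -> rat^o).
  exact: detector22_scalar.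
have actE (s : 'S_4) : kact (@young_embed (SymModule U :: eps_modules x hs) r.+4 (s, 1%g))
    (base22 x hs r h1 h2) =
    \sum_(p <- pairs4) pair_at p.1 p.2 (one_line s) *: pair_element x hs r h1 h2 p.
  by rewrite kact_embed22 // two_pairs_combination.
apply: (young_block_iso (D := detector22 x (@mark22 B hs r h1 h2)) (young_size4 U) JM
  (affords_eps x hs) (@kact_eps22 _ _ _ x hs r size_r h1 h2 U) (@detector22_scalar _ _ _ _ _ _ _ _)
  (@detector22_in4 _ _ _ x hs r hs_ok size_r h1 h2 U) _ (detector22_mu h1 h2) Jsep).
  move=> s; rewrite actE !big_cons big_nil addr0 !(lin_add Dl) !(lin_scale Dl).
  rewrite pair_element_base (detector22_pair23 x hs_ok size_r ne12) !detector22_pair_element //.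
  rewrite !scaler0 !addr0; exact: mulrC.
by have [u uE] := Jgen _ _ _ actE; exists u; rewrite uE pair_element_base.
Qed.

Local Notation V2 := (SymModule (specht 2 [:: 2]%N)).
Local Notation Vs2 := [:: V2, V2 & eps_modules x hs].

(** The first S_2 is taken as the generating factor. The second one joins the factors permuting
    single marks, as one more factor through which the group acts on the monomial by a character,
    here the trivial one. *)
Lemma kspan22_diff_iso2 h1 h2 : h1 != h2 ->
  iso_block (kspan (base22 x hs r h1 h2)) (young_ind r.+4 Vs2).
Proof.
move=> ne12; set mu := base22 x hs r h1 h2.
have sz : young_size Vs2 = r.+4 by rewrite -size_r size_marks_of -(young_size_eps x).
have embE y i : (i < r.+4)%N -> @young_embed Vs2 r.+4 y (inord i) = inord (young_fun y i).
  exact: young_embed_at.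
have actE (s : 'S_2) : kact (@young_embed Vs2 r.+4 (s, 1%g)) mu = mu.
  have fixE i : (2 <= i)%N -> young_fun ((s, 1%g) : young_group Vs2) i = i.
    exact: (young_fun_fixed (V := V2)).
  have sE (i : 'I_2) : young_fun ((s, 1%g) : young_group Vs2) i = s i.
    exact: (young_fun_left (V := V2)).
  rewrite /mu (kact_two_pairs x size_r) => [|i /andP[lei lti]]; last first.
    by rewrite embE // fixE // (leq_trans _ lei).
  rewrite (base22E x size_r) !embE // (fixE 2%N) // (fixE 3%N) //.
  rewrite (sE (Ordinal (isT : 0 < 2)%N)) (sE (Ordinal (isT : 1 < 2)%N)) !inordK //;
    try exact: leq_trans (ltn_ord _) _.
  have := ltn_ord (s (Ordinal (isT : 0 < 2)%N)).
  have := ltn_ord (s (Ordinal (isT : 1 < 2)%N)).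
  have : s (Ordinal (isT : 0 < 2)%N) != s (Ordinal (isT : 1 < 2)%N).
    by rewrite (inj_eq perm_inj).
  rewrite -val_eqE /=; move: (nat_of_ord _) (nat_of_ord _) => [|[|a]] [|[|b]] //= _ _ _.
  exact: two_pairs_sym1.
have mu_eps (h : young_group (V2 :: eps_modules x hs)) :
    kact (@young_embed Vs2 r.+4 (1%g, h)) mu = (1 * eps_sign h.2) *: mu.
  case: h => s h; rewrite mul1r.
  have fixE i : (i < 2)%N -> young_fun ((1%g, (s, h)) : young_group Vs2) i = i.
    exact: (@young_fun_right_fixed V2 (V2 :: eps_modules x hs) (s, h)).
  have rightE i : young_fun ((1%g, (s, h)) : young_group Vs2) (2 + i) =
      (2 + young_fun ((s, h) : young_group (V2 :: eps_modules x hs)) i)%N.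
    exact: (@young_fun_right V2 (V2 :: eps_modules x hs) (s, h)).
  have sE (i : 'I_2) : young_fun ((s, h) : young_group (V2 :: eps_modules x hs)) i = s i.
    by rewrite /= valK.
  rewrite /mu (base22E x size_r) /two_pairs !kactM !kact_pull !kact_G !embE //.
  rewrite (fixE 0%N) // (fixE 1%N) // (rightE 0%N) (rightE 1%N).
  rewrite (kact_mark_prod (g := h)) => [|i lti]; last first.
    rewrite embE; last by rewrite -sz /young_size /= !addnA ltn_add2l.
    rewrite (rightE (2 + i)%N) /= insubN -?leqNgt ?leq_addr // addKn.
    by rewrite addnA.
  rewrite -kscaleAr; congr (_ *: _).
  have -> : kpull (inord 0) (x h1) * kpull (inord (2 + young_fun ((s, h) : young_group (V2 :: eps_modules x hs)) 0)) (x h2) *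
    (kG X (inord 0) (inord 1) * kG X
      (inord (2 + young_fun ((s, h) : young_group (V2 :: eps_modules x hs)) 0))
      (inord (2 + young_fun ((s, h) : young_group (V2 :: eps_modules x hs)) 1)))
    * mark_prod r.+3 x 4 hs = two_pairs x hs r h1 h2 0 1 (2 + s (Ordinal (isT : 0 < 2)%N))
      (2 + s (Ordinal (isT : 1 < 2)%N)).
    by rewrite -(sE (Ordinal (isT : 0 < 2)%N)) -(sE (Ordinal (isT : 1 < 2)%N)).
  have := ltn_ord (s (Ordinal (isT : 0 < 2)%N)).
  have := ltn_ord (s (Ordinal (isT : 1 < 2)%N)).
  have : s (Ordinal (isT : 0 < 2)%N) != s (Ordinal (isT : 1 < 2)%N).
    by rewrite (inj_eq perm_inj).
  rewrite -val_eqE /=; move: (nat_of_ord _) (nat_of_ord _) => [|[|a]] [|[|b]] //= _ _ _.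
  exact: two_pairs_sym2.
have E_eps : affords (young_tensor (V2 :: eps_modules x hs))
    (fun h : young_group (V2 :: eps_modules x hs) => 1 * eps_sign h.2).
  exact: affords_xtensor (affords_row 2) (affords_eps x hs).
apply: (young_block_iso (D := detector22 x (@mark22 B hs r h1 h2)) sz
  (@specht_coefM 2 [:: 2]%N) E_eps mu_eps (@detector22_scalar _ _ _ _ _ _ _ _)
  (@detector22_in2 _ _ _ x hs r hs_ok size_r h1 h2 _ _ ^~ ne12) _
  (detector22_mu h1 h2) separates_2).
  by move=> s; rewrite actE mulr1.
have genE (s : 'S_2) : kact (@young_embed Vs2 r.+4 (s, 1%g)) mu =
    \sum_(p <- [:: (0, 1)]%N) 1 *: mu.
  by rewrite big_seq1 scale1r actE.
exact: (generates_2 (e := fun=> mu) genE).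
Qed.

End TwoPairs.

Local Close Scope ring_scope.

(** * Numberings of marked graphs *)

Section Components.

Variables (n : nat).
Implicit Types (es : seq ('I_n * 'I_n)).

Lemma edge_rel_sym es : symmetric [rel u v | ((u, v) \in es) || ((v, u) \in es)].
Proof. by move=> u v /=; rewrite orbC. Qed.

Lemma same_component_sym es u v : same_component es u v = same_component es v u.
Proof. exact/sym_connect_sym/edge_rel_sym. Qed.

Lemma same_component_edge es e : e \in es -> same_component es e.1 e.2.
Proof. by move=> ees; apply: connect1; rewrite /= -surjective_pairing ees. Qed.

Lemma same_component_incident es u v : same_component es u v -> u != v ->
  exists2 e, e \in es & (e.1 == u) || (e.2 == u).
Proof.
case/connectP=> -[|w p] /=; first by move=> _ ->; rewrite eqxx.
case/andP=> /orP[uw|wu] _ _ _; first by exists (u, w); rewrite //= eqxx.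
by exists (w, u); rewrite //= eqxx orbT.
Qed.

Lemma same_component_const (T : eqType) es (c : 'I_n -> T) u v :
  (forall e, e \in es -> c e.1 = c e.2) -> same_component es u v -> c u = c v.
Proof.
move=> ces uv; have cl : closed [rel u v | ((u, v) \in es) || ((v, u) \in es)] [pred w | c w == c u].
  by move=> w1 w2 /= /orP[] /ces /= e; rewrite !inE e.
by have := closed_connect cl uv; rewrite !inE eqxx => /esym/eqP.
Qed.

Lemma enum_set_sorted (A : {set 'I_n}) : sorted (fun i j : 'I_n => (i < j)%N) (enum A).
Proof.
rewrite /enum_mem; apply: sorted_filter.
  by move=> i j k; apply: ltn_trans.
by have := iota_ltn_sorted 0 n; rewrite -val_enum_ord sorted_map enumT.
Qed.

End Components.

Section Reshape.

Lemma count_reshape_index L i :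
  count (fun j => reshape_index L j == i) (iota 0 (sumn L)) = nth 0%N L i.
Proof.
elim: L i => [|k L IH] i /=; first by rewrite nth_nil.
rewrite iotaD count_cat add0n.
have -> : count (fun j => reshape_index (k :: L) j == i) (iota 0 k) = ((i == 0) * k)%N.
  rewrite (@eq_in_count _ _ (fun=> i == 0)) => [|j]; last first.
    by rewrite mem_iota add0n /= reshape_index_cons => ->; rewrite eq_sym.
  by case: (i == 0); rewrite ?count_predT ?count_pred0 ?size_iota ?mul1n.
have -> : iota k (sumn L) = [seq (k + j)%N | j <- iota 0 (sumn L)].
  by rewrite -iotaDl addn0.
rewrite count_map; case: i => [|i] /=.
  rewrite mul1n (@eq_count _ _ pred0) ?count_pred0 ?addn0 // => j /=.
  by rewrite reshape_index_cons ltnNge leq_addr.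
rewrite add0n -IH; apply: eq_count => j /=.
by rewrite reshape_index_cons ltnNge leq_addr /= addKn.
Qed.

Lemma reshape_offset_lt L j k : reshape_index L j = reshape_index L k ->
  (j < k)%N -> (reshape_offset L j < reshape_offset L k)%N.
Proof.
move=> e; rewrite -{1}(reshape_indexK L j) -{1}(reshape_indexK L k) e.
by rewrite /flatten_index ltn_add2l.
Qed.

(** Positions are filled block by block, each with the vertices of one component in increasing
    order; a position of offset 0 thus receives the smallest vertex of its component. *)
Lemma block_numbering L n (c : 'I_n.+1 -> 'I_(size L)) : sumn L = n.+1 ->
  (forall i, #|[set u | c u == i]| = nth 0%N L i) ->
  exists g : 'S_n.+1, (forall j, c (g j) = reshape_index L j :> nat) /\
    (forall j k : 'I_n.+1, (j < k)%N -> reshape_index L j = reshape_index L k ->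
       (g j < g k)%N).
Proof.
move=> sumL cL; pose cls i := enum [set u | c u == i :> nat].
have size_cls i : (i < size L)%N -> size (cls i) = nth 0%N L i.
  by move=> lti; rewrite -cardE -(cL (Ordinal lti)); apply: eq_card => u; rewrite !inE.
pose f (j : 'I_n.+1) := nth ord0 (cls (reshape_index L j)) (reshape_offset L j).
have lt_off (j : 'I_n.+1) : (reshape_offset L j < size (cls (reshape_index L j)))%N.
  by rewrite size_cls ?reshape_offsetP ?reshape_indexP ?sumL.
have cf j : c (f j) = reshape_index L j :> nat.
  have : f j \in cls (reshape_index L j) by apply: mem_nth.
  by rewrite mem_enum inE => /eqP.
have f_inj : injective f.
  move=> j k e; have ejk : reshape_index L j = reshape_index L k by rewrite -!cf e.
  apply: val_inj; rewrite /= -(reshape_indexK L j) -(reshape_indexK L k) ejk; congr flatten_index.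
  have lt_j := lt_off j; move: e lt_j; rewrite /f ejk => e lt_j.
  by apply/eqP; rewrite -(nth_uniq ord0 lt_j (lt_off k) (enum_uniq _)) e.
exists (perm f_inj); split=> [j|j k ltjk ejk]; rewrite !permE // /f ejk.
apply: (sorted_ltn_nth (leT := fun i j : 'I_n.+1 => (i < j)%N)).
- by move=> i1 i2 i3; apply: ltn_trans.
- exact: enum_set_sorted.
- by rewrite inE -ejk.
- by rewrite inE.
- exact: reshape_offset_lt.
Qed.

End Reshape.

Section MarkedGraphs.

Variables (L : seq nat) (n : nat) (B : nat) (gs : seq 'I_B.+1).
Hypothesis sumL : sumn L = n.+1.

Local Notation idx := (reshape_index L).
Local Notation off := (reshape_offset L).

Definition increasing_blocks (g : 'S_n.+1) : Prop :=
  forall j k : 'I_n.+1, (j < k)%N -> idx j = idx k -> (g j < g k)%N.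

Lemma card_block (g : 'S_n.+1) i : #|[set u | idx ((g^-1)%g u) == i]| = nth 0%N L i.
Proof.
rewrite -[RHS]count_reshape_index sumL.
have -> : [set u | idx ((g^-1)%g u) == i] = g @: [set j : 'I_n.+1 | idx j == i].
  apply/setP=> u; apply/idP/imsetP => [|[j]]; rewrite !inE.
    by exists (g^-1 u)%g; rewrite ?inE ?permKV.
  by move=> /eqP ji ->; rewrite permK ji.
rewrite card_imset; last exact: perm_inj.
by rewrite cardsE cardE /enum_mem size_filter -val_enum_ord count_map enumT.
Qed.

(** Transports a monomial of the block to standard positions, where the possible edge lists can be
    enumerated. *)
Lemma marked_type_numbering a es : canonical a es -> has_marked_type L gs a es ->
  exists g : 'S_n.+1,
  [/\ increasing_blocks g,
      forall e, e \in es -> exists j k : 'I_n.+1, [/\ (j < k)%N, idx j = idx k & e = (g j, g k)],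
      forall j k : 'I_n.+1, j != k -> idx j = idx k ->
        exists2 e, e \in es & (e.1 == g j) || (e.2 == g j)
    & forall j : 'I_n.+1, off j = 0%N -> a (g j) = nth ord0 gs (idx j)].
Proof.
case/and3P=> /allP lt_es _ _ [_ [c [cE cL aE]]].
have [g [cg g_inc]] := block_numbering sumL cL; exists g.
have same_idx j k : same_component es (g j) (g k) = (idx j == idx k).
  by rewrite -cE -val_eqE /= !cg.
split=> // [[u v] ees|j k jk ejk|j j0].
- exists (g^-1 u)%g, (g^-1 v)%g; rewrite !permKV.
  have e_idx : idx (g^-1 u)%g = idx (g^-1 v)%g.
    by apply/eqP; rewrite -same_idx !permKV; apply: (same_component_edge ees).
  split=> //; have ltuv := lt_es _ ees; rewrite ltnNge leq_eqVlt negb_or -leqNgt.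
  apply/andP; split; first by apply: contraTneq ltuv => /= /val_inj/perm_inj->; rewrite ltnn.
  rewrite leqNgt; apply: contraTN ltuv => ltvu /=; rewrite -leqNgt ltnW //.
  by have := g_inc _ _ ltvu (esym e_idx); rewrite !permKV.
- have : same_component es (g j) (g k) by rewrite same_idx ejk.
  by move/same_component_incident; apply; rewrite (inj_eq perm_inj).
- rewrite aE ?cg // => u; rewrite -[u](permKV g) same_idx => /eqP e.
  have [<- //|ne] := eqVneq (g^-1 u)%g j; rewrite leqNgt; apply/negP => lt_u.
  have lt_j : ((g^-1)%g u < j)%N.
    rewrite ltnNge leq_eqVlt; apply/negP => /predU1P[/val_inj e1|ltj].
      by rewrite e1 eqxx in ne.
    by have := g_inc _ _ ltj e; rewrite ltnNge ltnW.
  by have := reshape_offset_lt (esym e) lt_j; rewrite j0.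
Qed.

Lemma ren_edges_connected (g : 'S_n.+1) E u v :
  same_component E u v -> same_component (ren_edges g E) (g u) (g v).
Proof.
case/connectP=> p; elim: p u => [|w p IH] u /=; first by move=> _ ->; apply: connect0.
case/andP=> uw /IH{}IH /IH; apply: connect_trans; apply: connect1 => /=.
case/orP: uw => [uw|wu]; apply/orP; [left|right].
  by apply/mapP; exists (u, w).
by apply/mapP; exists (w, u).
Qed.

(** Going down along edges from any position ends at the position of offset 0 in its block, which is
    unique. *)
Lemma block_root (E : seq ('I_n.+1 * 'I_n.+1)) :
  (forall e, e \in E -> (e.1 < e.2)%N /\ idx e.1 = idx e.2) ->
  (forall j : 'I_n.+1, off j != 0%N -> exists k, (k, j) \in E) ->
  forall j k : 'I_n.+1, idx j = idx k -> same_component E j k.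
Proof.
move=> ltE targetE.
have root N (j : 'I_n.+1) : (j < N)%N ->
    exists2 i : 'I_n.+1, off i = 0%N /\ idx i = idx j & same_component E i j.
  elim: N j => // N IH j; rewrite ltnS => lejN.
  have [j0|/targetE[k kjE]] := eqVneq (off j) 0%N; first by exists j => //; apply: connect0.
  have /= [ltkj ekj] := ltE _ kjE.
  have [i [i0 eik] conn_ik] := IH k (leq_trans ltkj lejN); exists i; first by rewrite eik.
  exact: connect_trans conn_ik (same_component_edge kjE).
move=> j k ejk; have [i [i0 ij] cij] := root _ j (leqnn _).
have [i' [i'0 ik] cik] := root _ k (leqnn _).
suff eii : i = i'.
  by rewrite -eii in cik; apply: connect_trans cik; rewrite -/(same_component E j i) same_component_sym.
apply: val_inj; rewrite /= -(reshape_indexK L i) -(reshape_indexK L i').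
by rewrite i0 i'0 ij ik ejk.
Qed.

Lemma numbering_marked_type (mark : 'I_n.+1 -> 'I_B.+1) (E : seq ('I_n.+1 * 'I_n.+1)) (g : 'S_n.+1) :
  size gs = size L ->
  (forall j : 'I_n.+1, mark j = if off j == 0%N then nth ord0 gs (idx j) else ord0) ->
  (forall e, e \in E -> (e.1 < e.2)%N /\ idx e.1 = idx e.2) ->
  (forall j : 'I_n.+1, off j != 0%N -> exists k, (k, j) \in E) ->
  increasing_blocks g -> sorted ltn [seq val e.2 | e <- ren_edges g E] ->
  canonical (mark \o g^-1)%g (ren_edges g E) /\
  has_marked_type L gs (mark \o g^-1)%g (ren_edges g E).
Proof.
move=> size_gs markE ltE targetE g_inc g_sorted.
have connE := block_root ltE targetE; split.
  apply/and3P; split=> //; apply/allP => _ /mapP[[j k] /ltE[/= ltjk ejk] ->] /=.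
    exact: g_inc.
  rewrite permK markE; case: (off k =P 0%N) => [k0|]; last by rewrite eqxx.
  by have := reshape_offset_lt ejk ltjk; rewrite k0.
have lt_idx (j : 'I_n.+1) : (idx j < size L)%N by rewrite reshape_indexP ?sumL.
split=> //; exists (fun v => Ordinal (lt_idx (g^-1 v)%g)).
have conn j k : same_component (ren_edges g E) (g j) (g k) = (idx j == idx k).
  apply/idP/eqP => [|/connE/(ren_edges_connected g) //].
  move/(same_component_const (c := fun v => idx (g^-1 v)%g)).
  rewrite !permK; apply=> _ /mapP[[j' k'] /ltE[/= _ ejk] ->] /=.
  by rewrite !permK.
split=> [u v|i|v v_small].
- by rewrite -val_eqE /= -conn !permKV.
- exact: card_block.
(* A smallest vertex has offset 0, since otherwise an edge would join it to a smaller one. *)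
- rewrite /= markE; case: (off _ =P 0%N) => [//|/eqP] /targetE[k kE].
  have /= [ltk ek] := ltE _ kE; have := v_small (g k).
  rewrite -{1}(permKV g v) conn ek eqxx => /(_ isT).
  by rewrite -{1}(permKV g v) leqNgt g_inc.
Qed.

End MarkedGraphs.

Local Open Scope ring_scope.

(** * Blocks are spans of one orbit *)

Section Spans.

Variables (m : nat) (X : cohomology_algebra m) (n : nat) (B : nat) (x : ordered_basis X B).
Implicit Types (a : 'I_n -> 'I_B.+1) (es : seq ('I_n * 'I_n)) (b : kriz X n).

Lemma kmonomial_ext a a' es : a =1 a' -> kmonomial x a es = kmonomial x a' es.
Proof. by move=> e; congr (_ * _); apply: eq_bigr => l _; rewrite e. Qed.

Section Blocks.

Variables (L : seq nat) (gs : seq 'I_B.+1).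
Local Notation kb := (@kblock m X n B x L gs).

Lemma kblock_monomial a es : canonical a es -> has_marked_type L gs a es ->
  kb (kmonomial x a es).
Proof.
move=> can typ; exists 1%N, (fun=> 1), (fun=> a), (fun=> es); split=> //.
by rewrite big_ord1 scale1r.
Qed.

Lemma kblockD b1 b2 : kb b1 -> kb b2 -> kb (b1 + b2).
Proof.
case=> [N1 [l1 [a1 [e1 [ok1 ->]]]]] [N2 [l2 [a2 [e2 [ok2 ->]]]]].
pose pick T (f1 : 'I_N1 -> T) (f2 : 'I_N2 -> T) (k : 'I_(N1 + N2)) :=
  match split k with inl i => f1 i | inr i => f2 i end.
exists (N1 + N2)%N, (pick _ l1 l2), (pick _ a1 a2), (pick _ e1 e2); split.
  by rewrite /pick => k; case: split.
rewrite big_split_ord; congr (_ + _); apply: eq_bigr => i _; rewrite /pick.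
  by rewrite -[lshift _ _]/(unsplit (inl i)) unsplitK.
by rewrite -[rshift _ _]/(unsplit (inr i)) unsplitK.
Qed.

Lemma kblockZ c b : kb b -> kb (c *: b).
Proof.
case=> [N [l [a [e [ok ->]]]]]; exists N, (fun k => c * l k), a, e; split=> //.
by rewrite scaler_sumr; apply: eq_bigr => k _; rewrite scalerA.
Qed.

Lemma kblock_pm b1 b2 : pm_eq b1 b2 -> kb b2 -> kb b1.
Proof. by case=> -> // /(kblockZ (-1)); rewrite scaleN1r. Qed.

End Blocks.

Section Orbit.

Variable mu : kriz X n.

Lemma kspan_act g : kspan mu (kact g mu).
Proof.
exists (fun y => (y == g)%:R); rewrite (bigD1 g) //= eqxx scale1r big1 ?addr0 // => y /negPf->.
by rewrite scale0r.
Qed.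

Lemma kspanZ c b : kspan mu b -> kspan mu (c *: b).
Proof.
case=> l ->; exists (fun y => c * l y).
by rewrite scaler_sumr; apply: eq_bigr => k _; rewrite scalerA.
Qed.

Lemma kspanD b1 b2 : kspan mu b1 -> kspan mu b2 -> kspan mu (b1 + b2).
Proof.
case=> l1 -> [l2 ->]; exists (fun y => l1 y + l2 y).
by rewrite -big_split; apply: eq_bigr => k _; rewrite scalerDl.
Qed.

Lemma kspan_pm b1 b2 : pm_eq b1 b2 -> kspan mu b2 -> kspan mu b1.
Proof. by case=> -> // /(kspanZ (-1)); rewrite scaleN1r. Qed.

Lemma kspan_sum (I : Type) (s : seq I) (F : I -> kriz X n) :
  (forall i, kspan mu (F i)) -> kspan mu (\sum_(i <- s) F i).
Proof.
move=> FP; elim: s => [|i s IH]; last by rewrite big_cons; apply: kspanD.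
by rewrite big_nil -(scale0r mu); apply: kspanZ; rewrite -[X in kspan _ X]kact_id; apply: kspan_act.
Qed.

End Orbit.

Lemma kblock_kspan L gs mu :
  (forall a es, canonical a es -> has_marked_type L gs a es -> kspan mu (kmonomial x a es)) ->
  (forall g, kblock x L gs (kact g mu)) ->
  forall b, kblock x L gs b <-> kspan mu b.
Proof.
move=> mono act b; split=> [[N [l [a [e [ok ->]]]]]|[l ->]].
  by apply: kspan_sum => k; apply: kspanZ; have [] := ok k; apply: mono.
elim/big_ind: _ => [||y _]; last exact/kblockZ/act.
  by have := kblockZ 0 (act 1%g); rewrite scale0r.
exact: kblockD.
Qed.

Lemma iso_block_ext (S S' : kriz X n -> Prop) rho :
  (forall b, S b <-> S' b) -> iso_block S rho -> iso_block S' rho.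
Proof.
move=> SS' [phi [inj im equi]]; exists phi; split=> // b.
by rewrite -SS'.
Qed.

End Spans.

(** The choice of a coset representative that is increasing on each block; the other factor t
    permutes positions inside the blocks. *)
Lemma increasing_sort L n (g : 'S_n.+1) : sumn L = n.+1 ->
  exists2 t : 'S_n.+1, forall j : 'I_n.+1, reshape_index L (t j) = reshape_index L j &
  exists2 g' : 'S_n.+1, increasing_blocks L g' & g = (t * g')%g.
Proof.
move=> sumL.
have lt_idx (j : 'I_n.+1) : (reshape_index L j < size L)%N by rewrite reshape_indexP ?sumL.
have [|g' [cg' g'_inc]] :=
  @block_numbering L n (fun v => Ordinal (lt_idx ((g^-1)%g v))) sumL.
  by move=> i; apply: card_block.
exists (g * g'^-1)%g => [j|]; last by exists g'; rewrite ?mulgKV.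
by have := cg' ((g * g'^-1)%g j); rewrite /= permM permKV permK => ->.
Qed.

(** * One component with three vertices: the block is the orbit span *)

Section Triples.

Variables (m : nat) (X : cohomology_algebra m) (B : nat) (x : ordered_basis X B).
Variables (hs : seq ('I_B.+1 * nat)) (r : nat).
Hypothesis size_r : size (marks_of hs) = r.
Variable h1 : 'I_B.+1.

Local Notation L := (3 :: nseq r 1)%N.
Local Notation gs := (h1 :: marks_of hs).
Local Notation mu := (base3 x hs r h1).
Local Notation mark := (@mark3 B hs r h1).
Local Notation o0 := (inord 0 : 'I_r.+3).
Local Notation o1 := (inord 1 : 'I_r.+3).
Local Notation o2 := (inord 2 : 'I_r.+3).

Lemma sumn_hook : sumn L = r.+3.
Proof. by rewrite /= sumn_nseq mul1n. Qed.

Lemma index_hook i : (i < r.+3)%N ->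
  reshape_index L i = if (i < 3)%N then 0%N else (i - 3).+1.
Proof.
move=> lti; rewrite reshape_index_cons; case: (ltnP i 3) => // le3.
by rewrite reshape_index_ones //; lia.
Qed.

Lemma offset_hook i : (i < r.+3)%N ->
  reshape_offset L i = if (i < 3)%N then i else 0%N.
Proof.
move=> lti; rewrite reshape_offset_cons; case: (ltnP i 3) => // le3.
by rewrite reshape_offset_ones //; lia.
Qed.

Lemma small3 (j : 'I_r.+3) : (j < 3)%N -> [\/ j = o0, j = o1 | j = o2].
Proof.
by case: j => [[|[|[|//]]] lt] _; [apply: Or31|apply: Or32|apply: Or33];
  apply: val_inj; rewrite /= inordK.
Qed.

Lemma same_hook (j k : 'I_r.+3) : reshape_index L j = reshape_index L k ->
  j = k \/ (j < 3)%N && (k < 3)%N.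
Proof.
rewrite !index_hook ?ltn_ord //; case: (ltnP j 3); case: (ltnP k 3) => // lek lej; first by right.
by case=> e; left; apply: val_inj => /=; lia.
Qed.

Lemma hook_edge (j k : 'I_r.+3) : (j < k)%N -> reshape_index L j = reshape_index L k ->
  [\/ (j, k) = (o0, o1), (j, k) = (o0, o2) | (j, k) = (o1, o2)].
Proof.
move=> ltjk /same_hook[e|/andP[/small3 cj /small3 ck]]; first by rewrite e ltnn in ltjk.
move: ltjk; case: cj => ->; case: ck => ->; rewrite !inordK // => _.
- exact: Or31.
- exact: Or32.
- exact: Or33.
Qed.

Lemma mark_hook (j : 'I_r.+3) :
  mark j = if reshape_offset L j == 0%N then nth ord0 gs (reshape_index L j) else ord0.
Proof.
rewrite /mark3 index_hook ?offset_hook //; case: j => [[|[|[|j]]] lt] //=.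
by rewrite !subSS subn0.
Qed.

(** With [path3], the two canonical trees on three vertices; the third tree, with edges {0, 2} and
    {1, 2}, repeats its larger end. *)
Definition star3 := [:: (o0, o1); (o0, o2)].
Definition path3 := [:: (o0, o1); (o1, o2)].

Lemma kmonomial_path3 : kmonomial x mark path3 = triple x hs r h1 1 0 2.
Proof.
rewrite (kmonomial_mark3 x size_r) /triple; congr (_ * _).
by rewrite mulrA -kGpull -mulrA [kG X o0 o1]kGsym.
Qed.

Lemma sorted3 (g : 'S_r.+3) es : (g o0 < g o1)%N -> (g o1 < g o2)%N ->
  (forall e, e \in es -> [\/ e = (g o0, g o1), e = (g o0, g o2) | e = (g o1, g o2)]) ->
  sorted ltn [seq val e.2 | e <- es] ->
  (forall j : 'I_r.+3, (j < 3)%N -> exists2 e, e \in es & (e.1 == g j) || (e.2 == g j)) ->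
  es = ren_edges g star3 \/ es = ren_edges g path3.
Proof.
move=> lt01 lt12 esE es_sort inc.
have := inc o0; have := inc o1; have := inc o2; rewrite !inordK // => /(_ isT) i2 /(_ isT) i1 /(_ isT) i0.
have ne01 : (o0 == o1) = false by apply/eqP => /(congr1 val); rewrite /= !inordK.
have ne02 : (o0 == o2) = false by apply/eqP => /(congr1 val); rewrite /= !inordK.
have ne12 : (o1 == o2) = false by apply/eqP => /(congr1 val); rewrite /= !inordK.
have neE := (inj_eq (@perm_inj _ g), eqxx, eq_sym o1 o0, eq_sym o2 o0, eq_sym o2 o1, ne01, ne02, ne12).
case: es esE es_sort i0 i1 i2 {inc} => [_ _ []//|e1 [|e2 es]] esE.
  have [] := esE e1 (mem_head _ _) => {esE} e1E _ i0 i1 i2.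
  - by case: i2 => e; rewrite inE => /eqP ->; rewrite e1E /= !neE.
  - by case: i1 => e; rewrite inE => /eqP ->; rewrite e1E /= !neE.
  - by case: i0 => e; rewrite inE => /eqP ->; rewrite e1E /= !neE.
rewrite /= => /andP[lt_e] path_es _ _ _.
have m2 : e2 \in e1 :: e2 :: es by rewrite !inE eqxx orbT.
have le_g2 e : e \in e1 :: e2 :: es -> (e.2 <= g o2)%N.
  by case/esE=> -> //=; apply: ltnW.
have -> : es = [::].
  case: es esE path_es le_g2 m2 => // e3 es esE /= /andP[lt_e3 _] /(_ e3) le3 m2.
  have {}le3 : (e3.2 <= g o2)%N by apply: le3; rewrite !inE eqxx !orbT.
  have ltg1 : (g o1 < e2.2)%N.
    apply: leq_ltn_trans lt_e; have [] := esE e1 (mem_head _ _) => -> //=; apply: ltnW => //.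
  have [] := esE e2 m2 => e2E; move: ltg1 lt_e3 le3; rewrite e2E /=; lia.
have [] := esE e1 (mem_head _ _) => e1E; have [] := esE e2 m2 => e2E.
all: move: lt_e; rewrite e1E e2E /= ?ltnn // => lt_e; try by rewrite ltnNge ltnW in lt_e.
- by left.
- by right.
Qed.

Lemma hook_increasing (g : 'S_r.+3) : increasing_blocks L g ->
  (g o0 < g o1)%N /\ (g o1 < g o2)%N.
Proof. by move=> g_inc; split; apply: g_inc; rewrite ?index_hook !inordK. Qed.

(** Such a t moves only the first three points, so it turns the star into a star centred at one of
    them; [triple_combination] expresses it by the two canonical trees. *)
Lemma kact_hook (t : 'S_r.+3) :
  (forall j : 'I_r.+3, reshape_index L (t j) = reshape_index L j) ->
  exists c1 c2 : rat, kact t mu = c1 *: kmonomial x mark star3 + c2 *: kmonomial x mark path3.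
Proof.
move=> tL.
have t_fix i : (2 < i < r.+3)%N -> t (inord i) = inord i.
  case/andP=> lti ltir; have := tL (inord i); case/same_hook=> [//|/andP[_]].
  by rewrite inordK // ltnNge lti.
have t_small i : (i < 3)%N -> (t (inord i) < 3)%N.
  move=> lti; have ltir : (i < r.+3)%N by apply: leq_trans lti _.
  case/same_hook: (tL (inord i)) => [->|/andP[]//]; by rewrite inordK.
pose l : seq nat := [:: val (t o0); val (t o1); val (t o2)].
have l_uniq : uniq l by rewrite /= !inE !(inj_eq val_inj) !(inj_eq perm_inj) -!val_eqE /= !inordK.
have l_sub : {subset l <= iota 0 3}.
  by move=> k; rewrite mem_iota !in_cons in_nil orbF => /or3P[] /eqP->; rewrite t_small.
have [_ l_eq] := uniq_min_size l_uniq l_sub isT.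
have [|s sE] := @one_line_ex 3 l; first by rewrite mem_permutations uniq_perm ?iota_uniq.
have := triple_combination x hs r h1 s; rewrite -sE kact_triple //= => ->.
rewrite !big_cons big_nil addr0; exists (c21 0 l), (c21 1 l).
by rewrite kmonomial_path3 -base3E.
Qed.

Lemma kblock_hook b : kblock x L gs b <-> kspan mu b.
Proof.
have size_gs : size gs = size L by rewrite /= size_nseq size_r.
apply: kblock_kspan b => [a es can typ|g].
  have [g [g_inc esE inc aE]] := marked_type_numbering sumn_hook can typ.
  have [lt01 lt12] := hook_increasing g_inc.
  have es2 : es = ren_edges g star3 \/ es = ren_edges g path3.
    apply: sorted3 lt01 lt12 _ _ _.
    - move=> e /esE[j [k [ltjk ejk ->]]].
      by case: (hook_edge ltjk ejk) => -[-> ->]; [apply: Or31|apply: Or32|apply: Or33].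
    - by case/and3P: can.
    move=> j lt3; pose k := if j == o0 then o1 else o0.
    apply: (inc j k).
      by rewrite /k; case: (eqVneq j o0) => [->|//]; rewrite -val_eqE /= !inordK.
    by rewrite !index_hook // lt3 /k; case: (eqVneq j o0); rewrite inordK.
  have aE' : a =1 (mark \o (g^-1)%g).
    move=> v; rewrite -[v](permKV g) /= permK; move: ((g^-1)%g v) => j.
    rewrite mark_hook; case: eqP => [/aE //|off_j].
    case/and3P: can => _ _ /allP tgt; apply/eqP.
    have [e|e] : j = o1 \/ j = o2.
      have lt3 : (j < 3)%N.
        by move: off_j; rewrite offset_hook //; case: ltnP.
      case: (small3 lt3) => e; [|by left|by right].
      by case: off_j; rewrite e offset_hook inordK.
    - by apply: (tgt (g o0, g j)); case: es2 => ->; rewrite !inE e eqxx ?orbT.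
    - by case: es2 => esE2; [apply: (tgt (g o0, g j))|apply: (tgt (g o1, g j))];
        rewrite esE2 !inE e eqxx ?orbT.
  rewrite (kmonomial_ext x es aE').
  case: es2 => ->; apply: kspan_pm (pm_sym (pm_kact_monomial x g mark _)) _.
    exact: kspan_act.
  have tp_fix i : (2 < i < r.+3)%N -> tperm o0 o1 (inord i) = inord i :> 'I_r.+3.
    by move=> lti; apply: tpermD; rewrite -val_eqE /= !inordK //; lia.
  (* The path is the star with its centre moved from 0 to 1. *)
  have -> : kmonomial x mark path3 = kact (tperm o0 o1) mu.
    rewrite kmonomial_path3 kact_triple // tpermL tpermR tpermD ?inordK //.
      by rewrite -val_eqE /= !inordK.
    by rewrite -val_eqE /= !inordK.
  by rewrite -kactMperm; apply: kspan_act.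
have [t tL [g' g_inc ->]] := increasing_sort g sumn_hook.
have [lt01 lt12] := hook_increasing g_inc.
rewrite kactMperm; have [c1 [c2 ->]] := kact_hook tL.
have typed E : E = star3 \/ E = path3 -> kblock x L gs (kact g' (kmonomial x mark E)).
  move=> E12; apply: kblock_pm (pm_kact_monomial x g' mark _) _.
  have [|||can typ] := numbering_marked_type sumn_hook size_gs mark_hook (E := E) _ _ g_inc.
  - case: E12 => -> e; rewrite !inE => /orP[] /eqP-> /=; rewrite !index_hook !inordK //.
  - move=> j off_j; have lt3 : (j < 3)%N by move: off_j; rewrite offset_hook //; case: ltnP.
    case: (small3 lt3) off_j => -> ; rewrite offset_hook inordK // => _.
      by exists o0; case: E12 => ->; rewrite inE eqxx.
    by case: E12 => ->; [exists o0|exists o1]; rewrite !inE eqxx orbT.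
  - by case: E12 => -> /=; rewrite andbT.
  exact: kblock_monomial.
by rewrite kactD !kactZ; apply: kblockD; apply: kblockZ; apply: typed; [left|right].
Qed.

End Triples.

(** * Two components with two vertices: the block is the orbit span *)

Section Pairs.

Variables (m : nat) (X : cohomology_algebra m) (B : nat) (x : ordered_basis X B).
Variables (hs : seq ('I_B.+1 * nat)) (r : nat).
Hypothesis size_r : size (marks_of hs) = r.
Variables h1 h2 : 'I_B.+1.

Local Notation L := [:: 2, 2 & nseq r 1]%N.
Local Notation gs := [:: h1, h2 & marks_of hs].
Local Notation mu := (base22 x hs r h1 h2).
Local Notation mark := (@mark22 B hs r h1 h2).
Local Notation o0 := (inord 0 : 'I_r.+4).
Local Notation o1 := (inord 1 : 'I_r.+4).
Local Notation o2 := (inord 2 : 'I_r.+4).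
Local Notation o3 := (inord 3 : 'I_r.+4).

Lemma sumn_pairs : sumn L = r.+4.
Proof. by rewrite /= sumn_nseq mul1n. Qed.

Lemma index_pairs i : (i < r.+4)%N ->
  reshape_index L i = if (i < 2)%N then 0%N else if (i < 4)%N then 1%N else i.-2.
Proof.
move=> lti; rewrite !reshape_index_cons; case: (ltnP i 2) => // le2.
have -> : (i - 2 < 2)%N = (i < 4)%N by lia.
by case: (ltnP i 4) => // le4; rewrite reshape_index_ones //; lia.
Qed.

Lemma offset_pairs i : (i < r.+4)%N ->
  reshape_offset L i = if (i < 2)%N then i else if (i < 4)%N then (i - 2)%N else 0%N.
Proof.
move=> lti; rewrite !reshape_offset_cons; case: (ltnP i 2) => // le2.
have -> : (i - 2 < 2)%N = (i < 4)%N by lia.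
by case: (ltnP i 4) => // le4; rewrite reshape_offset_ones //; lia.
Qed.

Lemma small4 (j : 'I_r.+4) : (j < 4)%N -> [\/ j = o0, j = o1, j = o2 | j = o3].
Proof.
by case: j => [[|[|[|[|//]]]] lt] _; [apply: Or41|apply: Or42|apply: Or43|apply: Or44];
  apply: val_inj; rewrite /= inordK.
Qed.

Lemma same_pairs (j k : 'I_r.+4) : reshape_index L j = reshape_index L k ->
  j = k \/ (j < 4)%N && (k < 4)%N.
Proof.
rewrite !index_pairs ?ltn_ord // => e.
have [lt|le] := boolP ((j < 4)%N && (k < 4)%N); [by right|left].
by apply: val_inj => /=; move: le e; do ?case: ifP => ?; lia.
Qed.

Lemma pairs_edge (j k : 'I_r.+4) : (j < k)%N -> reshape_index L j = reshape_index L k ->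
  (j, k) = (o0, o1) \/ (j, k) = (o2, o3).
Proof.
move=> ltjk e; have [ejk|/andP[/small4 cj /small4 ck]] := same_pairs e.
  by rewrite ejk ltnn in ltjk.
move: ltjk e; rewrite !index_pairs //.
by case: cj => ->; case: ck => ->; rewrite !inordK // => _ _; [left|right].
Qed.

Lemma mark_pairs (j : 'I_r.+4) :
  mark j = if reshape_offset L j == 0%N then nth ord0 gs (reshape_index L j) else ord0.
Proof. by rewrite /mark22 index_pairs ?offset_pairs //; case: j => [[|[|[|[|j]]]] lt]. Qed.

Definition edges22 := [:: (o0, o1); (o2, o3)].
Definition edges22' := [:: (o2, o3); (o0, o1)].

Lemma kmonomial_edges22' : kmonomial x mark edges22' = - mu.
Proof. by rewrite /base22 /kmonomial !big_cons big_nil !mulr1 kGC mulrN. Qed.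

Lemma sorted22 (g : 'S_r.+4) es :
  (forall e, e \in es -> e = (g o0, g o1) \/ e = (g o2, g o3)) ->
  sorted ltn [seq val e.2 | e <- es] ->
  (forall j : 'I_r.+4, (j < 4)%N -> exists2 e, e \in es & (e.1 == g j) || (e.2 == g j)) ->
  es = ren_edges g edges22 \/ es = ren_edges g edges22'.
Proof.
move=> esE es_sort inc.
have := inc o0; have := inc o2; rewrite !inordK // => /(_ isT) i2 /(_ isT) i0.
have neE i j : (i < 4)%N -> (j < 4)%N -> ((inord i : 'I_r.+4) == inord j) = (i == j).
  by move=> lti ltj; rewrite -val_eqE /= !inordK //; apply: leq_trans (_ : _ <= 4)%N _.
case: es esE es_sort i0 i2 {inc} => [_ _ []//|e1 [|e2 es]] esE.
  have [] := esE e1 (mem_head _ _) => {esE} e1E _ i0 i2.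
    by case: i2 => e; rewrite inE => /eqP ->; rewrite e1E /= !(inj_eq perm_inj) !neE.
  by case: i0 => e; rewrite inE => /eqP ->; rewrite e1E /= !(inj_eq perm_inj) !neE.
rewrite /= => /andP[lt_e] path_es _ _.
have m2 : e2 \in e1 :: e2 :: es by rewrite !inE eqxx orbT.
have e1E := esE e1 (mem_head _ _); have e2E := esE e2 m2.
have -> : es = [::].
  case: es esE path_es m2 => // e3 es esE /= /andP[lt_e3 _] _.
  have m3 : e3 \in [:: e1, e2, e3 & es] by rewrite !inE eqxx !orbT.
  have e3E := esE e3 m3; move: lt_e lt_e3.
  by case: e1E e2E e3E => -> [] -> [] -> /=; rewrite ?ltnn //; lia.
by move: lt_e; case: e1E e2E => -> [] ->; rewrite /= ?ltnn // => _; [left|right].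
Qed.

Lemma pairs_increasing (g : 'S_r.+4) : increasing_blocks L g ->
  (g o0 < g o1)%N /\ (g o2 < g o3)%N.
Proof. by move=> g_inc; split; apply: g_inc; rewrite ?index_pairs !inordK. Qed.

Lemma kact_pairs (t : 'S_r.+4) :
  (forall j : 'I_r.+4, reshape_index L (t j) = reshape_index L j) -> kact t mu = mu.
Proof.
move=> tL.
have t_fix i : (3 < i < r.+4)%N -> t (inord i) = inord i.
  case/andP=> lti ltir; have := tL (inord i); case/same_pairs=> [//|/andP[_]].
  by rewrite inordK // ltnNge lti.
have t_small j k : (j < 4)%N -> t (inord j) = k -> (k < 4)%N /\ (k < 2)%N = (j < 2)%N.
  move=> ltj tjk; have ltjr : (j < r.+4)%N by apply: leq_trans ltj _.
  have := tL (inord j); rewrite tjk => e; have : (k < 4)%N.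
    by case: (same_pairs e) => [->|/andP[]//]; rewrite inordK.
  move: e; rewrite !index_pairs // inordK // ltj => e ltk; split=> //.
  by move: e; rewrite ltk; case: ifP; case: ifP.
have ne i j : (i < j < 4)%N -> t (inord i) != t (inord j).
  case/andP=> ltij ltj; rewrite (inj_eq perm_inj) -val_eqE /= !inordK; lia.
rewrite kact_two_pairs // base22E //.
have sw i j : (i < j < 4)%N -> (i < 2)%N = (j < 2)%N ->
    [:: val (t (inord i)); val (t (inord j))] = [:: i; j] \/
    [:: val (t (inord i)); val (t (inord j))] = [:: j; i].
  move=> ltij eij; have := ne _ _ ltij; case/andP: ltij => ltij ltj; have lti := ltn_trans ltij ltj.
  have [lta a2] := t_small i _ lti erefl; have [ltb b2] := t_small j _ ltj erefl.
  rewrite -val_eqE /= => neab.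
  have [[-> ->]|[-> ->]] : (t (inord i) = i :> nat /\ t (inord j) = j :> nat) \/
      (t (inord i) = j :> nat /\ t (inord j) = i :> nat) by lia.
    by left.
  by right.
have [] := sw 0%N 1%N isT erefl; have [] := sw 2%N 3%N isT erefl; move=> [-> ->] [-> ->].
- by [].
- exact: two_pairs_sym2.
- exact: two_pairs_sym1.
- by rewrite two_pairs_sym1 two_pairs_sym2.
Qed.

Lemma kblock_pairs b : kblock x L gs b <-> kspan mu b.
Proof.
have size_gs : size gs = size L by rewrite /= size_nseq size_r.
have root_pairs (j : 'I_r.+4) : reshape_offset L j != 0%N -> j = o1 \/ j = o3.
  move=> off_j; have lt4 : (j < 4)%N.
    by move: off_j; rewrite offset_pairs //; do ?case: ifP => ?; lia.
  by case: (small4 lt4) off_j => ->; rewrite offset_pairs inordK // => _; [left|right].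
apply: kblock_kspan b => [a es can typ|g].
  have [g [g_inc esE inc aE]] := marked_type_numbering sumn_pairs can typ.
  have es2 : es = ren_edges g edges22 \/ es = ren_edges g edges22'.
    apply: sorted22.
    - move=> e /esE[j [k [ltjk ejk ->]]].
      by case: (pairs_edge ltjk ejk) => -[-> ->]; [left|right].
    - by case/and3P: can.
    have inc2 i k : (i < 4)%N -> (k < 4)%N -> i != k -> (i < 2)%N = (k < 2)%N ->
        exists2 e, e \in es & (e.1 == g (inord i)) || (e.2 == g (inord i)).
      move=> lti ltk neik eik.
      have ltir : (i < r.+4)%N by apply: leq_trans lti _.
      have ltkr : (k < r.+4)%N by apply: leq_trans ltk _.
      apply: (inc _ (inord k)); first by rewrite -val_eqE /= !inordK.
      by rewrite !index_pairs // !inordK // eik lti ltk.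
    move=> j lt4; case: (small4 lt4) => ->.
    - exact: (inc2 0 1)%N.
    - exact: (inc2 1 0)%N.
    - exact: (inc2 2 3)%N.
    - exact: (inc2 3 2)%N.
  have aE' : a =1 (mark \o (g^-1)%g).
    move=> v; rewrite -[v](permKV g) /= permK; move: ((g^-1)%g v) => j.
    rewrite mark_pairs; case: eqP => [/aE //|/eqP/root_pairs off_j].
    case/and3P: can => _ _ /allP tgt; apply/eqP.
    case: off_j => e; [apply: (tgt (g o0, g j))|apply: (tgt (g o2, g j))];
      by case: es2 => ->; rewrite !inE e eqxx ?orbT.
  rewrite (kmonomial_ext x es aE').
  have span_mu : kspan mu (kact g mu) by apply: kspan_act.
  case: es2 => ->; apply: kspan_pm (pm_sym (pm_kact_monomial x g mark _)) _ => //.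
  by rewrite kmonomial_edges22' -scaleN1r kactZ; apply: kspanZ.
have [t tL [g' g'_inc ->]] := increasing_sort g sumn_pairs.
have [lt01 lt23] := pairs_increasing g'_inc.
have typed E : E = edges22 \/ E = edges22' -> sorted ltn [seq val e.2 | e <- ren_edges g' E] ->
    kblock x L gs (kact g' (kmonomial x mark E)).
  move=> E12 sortE; apply: kblock_pm (pm_kact_monomial x g' mark _) _.
  have [||can typ] := numbering_marked_type sumn_pairs size_gs mark_pairs (E := E) _ _ g'_inc sortE.
  - by case: E12 => -> e; rewrite !inE => /orP[] /eqP-> /=; rewrite !index_pairs !inordK.
  - by move=> j /root_pairs[]->; [exists o0|exists o2]; case: E12 => ->; rewrite !inE eqxx ?orbT.
  exact: kblock_monomial.
rewrite kactMperm kact_pairs //.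
(* The canonical order of the two edges is that of their larger ends; if g' reverses it, exchanging
   the two generators costs a sign. *)
have [lt13|lt31|e13] := ltngtP (g' o1) (g' o3).
- by apply: typed; [left|rewrite /= andbT].
- rewrite -[mu]opprK -kmonomial_edges22' -scaleN1r kactZ; apply: kblockZ.
  by apply: typed; [right|rewrite /= andbT].
- by move/val_inj/perm_inj/(congr1 val): e13; rewrite /= !inordK.
Qed.

End Pairs.

(** * The isomorphisms *)

Section Uniqueness.

Variables (m : nat) (X : cohomology_algebra m) (n : nat) (S : kriz X n -> Prop).

(** Both maps have the image S, so every basis vector of one module has a counterpart in the other
    with the same image; the chosen counterparts are the rows of M and N. *)
Lemma iso_block_transfer (rho1 rho2 : Srep n) :
  iso_block S rho1 -> iso_block S rho2 ->
  exists M : 'M[rat]_(rdegree rho1, rdegree rho2),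
  exists N : 'M[rat]_(rdegree rho2, rdegree rho1),
  M *m N = 1%:M /\ forall s, rho1 s *m M = M *m rho2 s.
Proof.
case=> phi1 [inj1 im1 act1] [phi2 [inj2 im2 act2]].
have ex12 v : exists w, phi1 v == phi2 w.
  by have [w e] := (im2 (phi1 v)).1 ((im1 (phi1 v)).2 (ex_intro _ v erefl)); exists w; apply/eqP.
have ex21 w : exists v, phi2 w == phi1 v.
  by have [v e] := (im1 (phi2 w)).1 ((im2 (phi2 w)).2 (ex_intro _ w erefl)); exists v; apply/eqP.
pose f v := xchoose (ex12 v); pose g w := xchoose (ex21 w).
have fE v : phi2 (f v) = phi1 v by apply/esym/eqP/(xchooseP (ex12 v)).
have gE w : phi1 (g w) = phi2 w by apply/esym/eqP/(xchooseP (ex21 w)).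
pose M : 'M[rat]_(rdegree rho1, rdegree rho2) := \matrix_i f (delta_mx 0 i).
pose N : 'M[rat]_(rdegree rho2, rdegree rho1) := \matrix_i g (delta_mx 0 i).
have ME v : phi2 (v *m M) = phi1 v.
  rewrite mulmx_sum_row linear_sum [v in RHS]row_sum_delta linear_sum.
  by apply: eq_bigr => i _; rewrite !linearZ rowK fE.
have NE w : phi1 (w *m N) = phi2 w.
  rewrite mulmx_sum_row linear_sum [w in RHS]row_sum_delta linear_sum.
  by apply: eq_bigr => i _; rewrite !linearZ rowK gE.
exists M, N; split=> [|s].
  by apply/row_matrixP=> i; rewrite !rowE mulmxA mulmx1; apply: inj1; rewrite NE ME.
apply/row_matrixP=> i; rewrite !rowE !mulmxA; apply: inj2.
by rewrite ME act1 act2 ME.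
Qed.

Lemma iso_block_rsim (rho1 rho2 : Srep n) :
  iso_block S rho1 -> iso_block S rho2 -> mx_rsim rho1 rho2.
Proof.
move=> iso1 iso2; have [M [N [MN rhoM]]] := iso_block_transfer iso1 iso2.
have [M' [N' [MN' _]]] := iso_block_transfer iso2 iso1.
have M_free : row_free M by apply/row_freeP; exists N.
have M'_free : row_free M' by apply/row_freeP; exists N'.
have deg : rdegree rho1 = rdegree rho2.
  apply/eqP; rewrite eqn_leq -{1}(eqP M_free) rank_leq_col.
  by rewrite -[X in (X <= _)%N](eqP M'_free) rank_leq_col.
by exists M => // s _; rewrite rhoM.
Qed.

End Uniqueness.

Section Blocks.

Variables (m : nat) (X : cohomology_algebra m) (B : nat) (x : ordered_basis X B).
Variables (hs : seq ('I_B.+1 * nat)) (r : nat).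
Hypothesis hs_ok : mult_list hs.
Hypothesis size_r : size (marks_of hs) = r.

Lemma kblock_hook_iso h1 :
  iso_block (@kblock m X r.+3 B x (3 :: nseq r 1)%N (h1 :: marks_of hs))
    (young_ind r.+3 (SymModule (specht 3 [:: 2; 1]%N) :: eps_modules x hs)).
Proof.
apply: iso_block_ext (kspan3_iso x hs_ok size_r h1) => b.
by apply: iff_sym; apply: kblock_hook.
Qed.

Local Notation block22 h1 h2 :=
  (@kblock m X r.+4 B x [:: 2, 2 & nseq r 1]%N [:: h1, h2 & marks_of hs]).

Lemma kspan_block22 h1 h2 rho :
  iso_block (kspan (base22 x hs r h1 h2)) rho -> iso_block (block22 h1 h2) rho.
Proof. by apply: iso_block_ext => b; apply: iff_sym; apply: kblock_pairs. Qed.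

Lemma kblock22_even_iso h : ~~ odd (ob_deg x h) ->
  iso_block (block22 h h)
    (young_ind r.+4 (SymModule (specht 4 [:: 3; 1]%N) :: eps_modules x hs)).
Proof.
move=> deg_h; apply: kspan_block22.
have eta : - (-1) ^+ ob_deg x h = -1 :> rat by rewrite -signr_odd (negPf deg_h) expr0.
apply: (kspan22_same_iso hs_ok size_r (J := specht_coef [:: 3; 1]%N)).
- exact: specht_coefM.
- by rewrite eta; apply: separates31.
- by rewrite eta; apply: generates31.
Qed.

Lemma kblock22_odd_iso h : odd (ob_deg x h) ->
  iso_block (block22 h h)
    (young_ind r.+4 (SymModule (dadd_grepr (specht 4 [:: 4]%N) (specht 4 [:: 2; 2]%N))
       :: eps_modules x hs)).
Proof.
move=> deg_h; apply: kspan_block22.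
have eta : - (-1) ^+ ob_deg x h = 1 :> rat by rewrite -signr_odd deg_h expr1 opprK.
apply: (kspan22_same_iso hs_ok size_r (J := coefs_4_22)).
- by apply: dadd_coefM => s t; apply: specht_coefM.
- by rewrite eta; apply: separates_4_22.
- by rewrite eta; apply: generates_4_22.
Qed.

Lemma kblock22_diff_iso h1 h2 : h1 != h2 ->
  iso_block (block22 h1 h2)
    (young_ind r.+4 (SymModule (dadd_grepr (specht 4 [:: 4]%N)
       (dadd_grepr (specht 4 [:: 3; 1]%N) (specht 4 [:: 2; 2]%N))) :: eps_modules x hs)).
Proof.
move=> ne12; apply: kspan_block22.
apply: (@kspan22_diff_iso m X B x hs r hs_ok size_r h1 h2 _ coefs_4_31_22 ne12).
- by apply: dadd_coefM; [|apply: dadd_coefM] => s t; apply: specht_coefM.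
- exact: separates_4_31_22.
- exact: generates_4_31_22.
Qed.

End Blocks.

Local Close Scope ring_scope.

Theorem proposition3p8 (m : nat) (m_ge1 : (1 <= m)%N)
    (X : cohomology_algebra m) (B : nat) (x : ordered_basis X B) :
  [/\ forall (n : nat) (h1 : 'I_B.+1) (hs : seq ('I_B.+1 * nat)),
        (3 <= n)%N -> mult_list hs -> (3 + \sum_(p <- hs) p.2 = n)%N ->
        iso_block
          (kblock x (3 :: nseq (n - 3) 1) (h1 :: marks_of hs))
          (young_ind n (SymModule (specht 3 [:: 2; 1]) :: eps_modules x hs)),
      forall (n : nat) (h1 : 'I_B.+1) (hs : seq ('I_B.+1 * nat)),
        (4 <= n)%N -> mult_list hs -> (4 + \sum_(p <- hs) p.2 = n)%N ->
        (~~ odd (ob_deg x h1) ->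
          iso_block
            (kblock x (nseq 2 2 ++ nseq (n - 4) 1) (nseq 2 h1 ++ marks_of hs))
            (young_ind n
              (SymModule (specht 4 [:: 3; 1]) :: eps_modules x hs))) /\
        (odd (ob_deg x h1) ->
          iso_block
            (kblock x (nseq 2 2 ++ nseq (n - 4) 1) (nseq 2 h1 ++ marks_of hs))
            (young_ind n
              (SymModule
                 (dadd_grepr (specht 4 [:: 4]) (specht 4 [:: 2; 2]))
               :: eps_modules x hs)))
    & forall (n : nat) (h1 h2 : 'I_B.+1) (hs : seq ('I_B.+1 * nat)),
        (4 <= n)%N -> (h2 < h1)%N -> mult_list hs ->
        (4 + \sum_(p <- hs) p.2 = n)%N ->
        iso_block
          (kblock x (nseq 2 2 ++ nseq (n - 4) 1) [:: h1, h2 & marks_of hs])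
          (young_ind n
            [:: SymModule (specht 2 [:: 2]), SymModule (specht 2 [:: 2])
              & eps_modules x hs]) /\
        mx_rsim
          (young_ind n
            [:: SymModule (specht 2 [:: 2]), SymModule (specht 2 [:: 2])
              & eps_modules x hs])
          (young_ind n
            (SymModule
               (dadd_grepr (specht 4 [:: 4])
                 (dadd_grepr (specht 4 [:: 3; 1]) (specht 4 [:: 2; 2])))
             :: eps_modules x hs))].
Proof.
split.
- move=> n h1 hs _ hs_ok; rewrite -size_marks_of => <-; rewrite addKn.
  exact: kblock_hook_iso.
- move=> n h1 hs _ hs_ok; rewrite -size_marks_of => <-; rewrite addKn.
  by split=> deg_h1; [apply: kblock22_even_iso|apply: kblock22_odd_iso].
move=> n h1 h2 hs _ lt21 hs_ok; rewrite -size_marks_of => <-; rewrite addKn.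
have ne12 : h1 != h2 by rewrite -val_eqE gtn_eqF.
have iso2 := kspan_block22 (erefl _) (kspan22_diff_iso2 x hs_ok (erefl _) ne12).
split; first exact: iso2.
exact: iso_block_rsim iso2 (kblock22_diff_iso x hs_ok (erefl _) ne12).
Qed.
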